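(* The $\mathcal{T}$-consistency problem for the tile set $\mathcal{T}=\{t_1,t_2\}$ consisting of the horizontal domino $t_1=\{(0,0),(0,1)\}$ (a $1\times 2$ rectangle) and the vertical domino $t_2=\{(0,0),(1,0)\}$ (a $2\times 1$ rectangle) is $\mathbb{NP}$-complete.
   Context: A tile is a finite subset of $\mathbb{Z}^2$ (here a hole-less polyomino) containing $(0,0)$, its center, which is its upper-left corner; coordinates are (row, column), rows numbered top to bottom and columns left to right. For $(i,j)\in\mathbb{Z}^2$, $(i,j)+t=\{(i+i',j+j'):(i',j')\in t\}$. Fix a finite list of tiles $\mathcal{T}=(t_1,\dots,t_h)$; the index $k$ is the type of $t_k$ (different types may have the same shape). Tiles may only be translated, not rotated. A $\mathcal{T}$-tiling of the grid $G=\mathbb{Z}_n\times\mathbb{Z}_n=\{0,\dots,n-1\}^2$ is a finite set $T\subseteq \mathbb{Z}_n\times\mathbb{Z}_n\times\{1,\dots,h\}$ such that the sets $(i,j)+t_k$, $(i,j,k)\in T$, are pairwise disjoint and contained in $G$ (the tiling need not cover the whole grid). Its (center) projections are $r,c\in\mathbb{N}^{n\times h}$ with $r_{i,k}=|\{j:(i,j,k)\in T\}|$ and $c_{j,k}=|\{i:(i,j,k)\in T\}|$, i.e. the number of tiles of type $k$ whose center lies in row $i$, resp. column $j$. The $\mathcal{T}$-consistency problem is: given $n$ and vectors $r,c\in\mathbb{N}^{n\times h}$, decide whether there exists a $\mathcal{T}$-tiling of the $n\times n$ grid with projections $r,c$. *)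

(* Defs.v *)
From HB Require Import structures.
From mathcomp Require Import all_boot all_order all_algebra finmap.

Set Implicit Arguments.
Unset Strict Implicit.
Unset Printing Implicit Defensive.

Variant move := MoveL | Stay | MoveR.

(* [None] is the blank, [Some (inl b)] an input/output bit and [Some (inr a)]
   an auxiliary work symbol. *)
Definition symbol (A : finType) : finType := option (bool + A)%type.

Record machine := Machine {
  ntapes : nat;  (* the machine has [ntapes.+1] tapes *)
  aux : finType;
  state : finType;
  start : state;
  halting : pred state;
  delta : state -> {ffun 'I_ntapes.+1 -> symbol aux} ->
    state * {ffun 'I_ntapes.+1 -> symbol aux * move}
}.

(* A two-way infinite tape that is blank almost everywhere: the cells on the
   left of the head (nearest first), the scanned cell, and the cells on the
   right of the head (nearest first); all the cells not listed are blank. *)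
Record tape (A : finType) := Tape {
  tape_left : seq (symbol A);
  scanned : symbol A;
  tape_right : seq (symbol A)
}.

Definition tape_write (A : finType) (t : tape A) (a : symbol A) : tape A :=
  Tape (tape_left t) a (tape_right t).

Definition tape_move (A : finType) (t : tape A) (d : move) : tape A :=
  let: Tape l a r := t in
  match d with
  | MoveL => Tape (behead l) (head None l) (a :: r)
  | Stay => t
  | MoveR => Tape (a :: l) (head None r) (behead r)
  end.

Record config (M : machine) := Config {
  cstate : state M;
  ctapes : {ffun 'I_(ntapes M).+1 -> tape (aux M)}
}.

(* A halted configuration is left unchanged. *)
Definition step (M : machine) (c : config M) : config M :=
  if halting (cstate c) then c else
  let: (q, act) := delta (cstate c) [ffun i => scanned (ctapes c i)] in
  Config q
    [ffun i => tape_move (tape_write (ctapes c i) (act i).1) (act i).2].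

(* The word [w] written from the head rightwards on an otherwise blank tape. *)
Definition word_tape (A : finType) (w : seq bool) : tape A :=
  let s := [seq Some (inl b) | b <- w] in
  Tape [::] (head None s) (behead s).

(* The input is on the first tape, all the other tapes are blank. *)
Definition init_config (M : machine) (w : seq bool) : config M :=
  Config (start M) [ffun i => word_tape (aux M) (if i == ord0 then w else [::])].

Fixpoint bits_prefix (A : finType) (s : seq (symbol A)) : seq bool :=
  if s is Some (inl b) :: s' then b :: bits_prefix s' else [::].

(* The longest word of bits that starts at the head of the last tape. *)
Definition output (M : machine) (c : config M) : seq bool :=
  let t := ctapes c ord_max in bits_prefix (scanned t :: tape_right t).

Definition computes_in_time (M : machine) (f : seq bool -> seq bool)
    (T : nat -> nat) : Prop :=
  forall w, let c := iter (T (size w)) (@step M) (init_config M w) in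
    halting (cstate c) /\ output c = f w.

Definition polytime (f : seq bool -> seq bool) : Prop :=
  exists (M : machine) (p : {poly nat}), computes_in_time M f (fun n => p.[n]%R).

Definition language := seq bool -> Prop.

Definition in_P (L : language) : Prop :=
  exists f : seq bool -> bool,
    polytime (fun w => [:: f w]) /\ (forall w, L w <-> f w).

(* Prefix-free coding: each bit is preceded by a 1, and a 0 marks the end. *)
Definition delimit (w : seq bool) : seq bool :=
  rcons (flatten [seq [:: true; b] | b <- w]) false.

Definition pair_word (x y : seq bool) : seq bool := delimit x ++ y.

Definition in_NP (L : language) : Prop :=
  exists (R : seq bool -> seq bool -> Prop) (p : {poly nat}),
    in_P (fun w => exists x y, w = pair_word x y /\ R x y) /\
    (forall x, L x <-> exists y, size y <= p.[size x]%R /\ R x y).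

Definition poly_reducible (L L' : language) : Prop :=
  exists f : seq bool -> seq bool, polytime f /\ (forall w, L w <-> L' (f w)).

Definition NP_hard (L : language) : Prop :=
  forall L', in_NP L' -> poly_reducible L' L.

Definition NP_complete (L : language) : Prop := in_NP L /\ NP_hard L.

(* The language of a decision problem [P] on instances encoded by [enc]. *)
Definition problem_language (X : Type) (enc : X -> seq bool) (P : X -> Prop) :
    language :=
  fun w => exists x, w = enc x /\ P x.

(* Binary numeral, least significant bit first; 0 has the numeral "0". *)
Definition binary (n : nat) : seq bool :=
  mkseq (fun i => odd (n %/ 2 ^ i)) (trunc_log 2 n).+1.

(* Cells are pairs (row, column). *)
Notation cell := (int * int)%type.

Record tile := Tile_of {
  tile_cells : {fset cell};
  tile_center : (0, 0)%R \in tile_cells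
}.

Definition translate (i j : int) (t : tile) : {fset cell} :=
  [fset (i + x.1, j + x.2)%R | x in tile_cells t]%fset.

Definition in_grid (n : nat) (x : cell) : Prop :=
  (0 <= x.1 < n%:Z)%R /\ (0 <= x.2 < n%:Z)%R.

(* The types 1, ..., h are numbered from 0 as elements of ['I_h]. *)
Definition placed (h : nat) (ts : h.-tuple tile) (n : nat)
    (x : 'I_n * 'I_n * 'I_h) : {fset cell} :=
  translate (x.1.1 : nat)%:Z (x.1.2 : nat)%:Z (tnth ts x.2).

Definition is_tiling (h : nat) (ts : h.-tuple tile) (n : nat)
    (T : {set 'I_n * 'I_n * 'I_h}) : Prop :=
  (forall x, x \in T -> forall z, z \in placed ts x -> in_grid n z) /\
  (forall x y, x \in T -> y \in T -> x <> y ->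
     [disjoint placed ts x & placed ts y]%fset).

Definition row_projection (h n : nat) (T : {set 'I_n * 'I_n * 'I_h}) :
    'M[nat]_(n, h) :=
  \matrix_(i < n, k < h) #|[set j | (i, j, k) \in T]|.

Definition col_projection (h n : nat) (T : {set 'I_n * 'I_n * 'I_h}) :
    'M[nat]_(n, h) :=
  \matrix_(j < n, k < h) #|[set i | (i, j, k) \in T]|.

Record instance (h : nat) := Instance {
  grid_size : nat;
  row_data : 'M[nat]_(grid_size, h);
  col_data : 'M[nat]_(grid_size, h)
}.

Definition consistent (h : nat) (ts : h.-tuple tile) (I : instance h) : Prop :=
  exists T : {set 'I_(grid_size I) * 'I_(grid_size I) * 'I_h},
    [/\ is_tiling ts T, row_projection T = row_data I
      & col_projection T = col_data I].

Definition entries (h n : nat) (A : 'M[nat]_(n, h)) : seq nat :=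
  [seq A i k | i <- enum 'I_n, k <- enum 'I_h].

(* [n], then the entries of [r] and of [c] row by row, all in binary. *)
Definition encode_instance (h : nat) (I : instance h) : seq bool :=
  flatten [seq delimit (binary m)
    | m <- grid_size I :: entries (row_data I) ++ entries (col_data I)].

Definition consistency_problem (h : nat) (ts : h.-tuple tile) : language :=
  problem_language (@encode_instance h) (consistent ts).

Definition hcells : {fset cell} :=
  [fset (0, 0)%R; (0, 1)%R]%fset.

Definition vcells : {fset cell} :=
  [fset (0, 0)%R; (1, 0)%R]%fset.

Lemma hcells_center : (0, 0)%R \in hcells.
Proof. by rewrite !inE eqxx. Qed.

Lemma vcells_center : (0, 0)%R \in vcells.
Proof. by rewrite !inE eqxx. Qed.

Definition horizontal_domino : tile := Tile_of hcells_center.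

Definition vertical_domino : tile := Tile_of vcells_center.

Definition dominoes : 2.-tuple tile :=
  [tuple horizontal_domino; vertical_domino].

(* Main.v *)
(** Membership: a tiling is a certificate with two bits per grid cell, and the
    verification is an arithmetic expression in bounded sums, which a multitape
    machine evaluates in polynomial time with numbers stored in unary.

    Hardness: the accepting runs of a verifier are the tile assignments of a
    tableau in which neighbouring tiles have equal colours.  A tile at a place is
    an arc both of a horizontal graph, where the assignment is a path through all
    the places, and of a vertical graph, where it is a circulation; so one looks
    for a set of arcs that is a flow in two graphs at once.  Each arc becomes a
    cycle of eight points in the plane, in which the lines of two directions force
    the points to be selected alternately while the lines of the third direction
    express the conservation laws.  Finally, a set of points with prescribed
    numbers of elements on the lines of three directions is coded by two disjoint
    0-1 matrices with prescribed margins: an extremal weight forces every entry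
    that is not on a line through its point.  If no domino has its center in an
    odd row or column, then the dominoes lie in disjoint 2x2 blocks, and each
    block is free, horizontal or vertical; these are the two matrices. *)
From HB Require Import structures.
From mathcomp Require Import all_boot all_order all_algebra finmap zify ring.
From Stdlib Require Import FunctionalExtensionality.
Require Import Defs.

Set Implicit Arguments.
Unset Strict Implicit.
Unset Printing Implicit Defensive.
Import Order.TTheory GRing.Theory Num.Theory.

(** Margins only fix numbers, so every constraint must become a count. A conservation law becomes
    one when the tail of an arc is represented with the opposite truth value: selected heads plus
    unselected tails on a line have a fixed number. Hence each of the four ends of an arc, two in
    each graph, gets two points of opposite parity, which gives eight points; the cycle makes all of
    them carry one truth value up to parity. The obstacle for lines in the plane is that a matrix
    offers only rows and columns. The points become columns and the lines of all directions become
    rows. For this the entries off the line must be rigid, which an extremal weight achieves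
    provided that its total is known in advance. One number per column remains unknown, the
    deviation in the rows of the third direction, and it cancels because [D c = A c + B c]. A
    circulation alone could put no tile or several tiles at a place; the unit flow along all places,
    row after row, excludes this. All numbers that occur are polynomially bounded, so that unary
    arithmetic suffices, and every polynomial-time claim reduces to the existence of an arithmetic
    expression. *)

(** * Tapes as functions on the integers, relative to the head *)

Definition cell_at (A : finType) (t : tape A) (z : int) : symbol A :=
  match z with
  | Posz 0 => scanned t
  | Posz i.+1 => nth None (tape_right t) i
  | Negz i => nth None (tape_left t) i
  end.

Definition shift (d : move) : int :=
  match d with MoveL => (-1)%R | Stay => 0%R | MoveR => 1%R end.

(** Positions are relative to the head, so a move translates the argument. Tapes are compared only
    through [cell_at], for which lists that differ by trailing blanks are the same tape. *)
Lemma cell_at_move (A : finType) (t : tape A) d z :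
  cell_at (tape_move t d) z = cell_at t (z + shift d)%R.
Proof.
case: t => l a r; case: d => /=; last first.
- case: z => [i|[|i]].
  + have -> : (Posz i + 1)%R = Posz i.+1 by lia.
    by case: i => [|i] /=; rewrite ?nth0 ?nth_behead.
  + by [].
  + by have -> : (Negz i.+1 + 1)%R = Negz i by lia.
- by rewrite addr0.
- case: z => [[|i]|i].
  + by rewrite /= nth0.
  + have -> : (Posz i.+1 + -1)%R = Posz i by lia.
    by case: i.
  + have -> : (Negz i + -1)%R = Negz i.+1 by lia.
    by rewrite /= nth_behead.
Qed.

Lemma cell_at_write (A : finType) (t : tape A) a z :
  cell_at (tape_write t a) z = if z == 0%R then a else cell_at t z.
Proof. by case: t => l b r; case: z => [[|i]|i]. Qed.

Lemma cell_at_word (A : finType) w z :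
  cell_at (word_tape A w) z =
  if z is Posz i then nth None [seq Some (inl b) | b <- w] i else None.
Proof.
case: z => [[|i]|i] /=; first by rewrite nth0.
  by rewrite nth_behead.
by rewrite nth_nil.
Qed.

(** * Register programs on Turing machines *)

Inductive basic :=
  BInc of nat | BDec of nat | BInR | BInL | BBit of nat | BOut of nat | BOutL.

Inductive instr :=
  IB of basic | IDecJ of nat & nat | IJmp of nat | IScan of nat & nat.

Record store := Store {
  regs : nat -> nat; ip : int; outw : seq bool; op : int }.

Definition setr (s : store) (r n : nat) : store :=
  Store (fun r' => if r' == r then n else regs s r') (ip s) (outw s) (op s).

Definition incell (w : seq bool) (z : int) : symbol unit :=
  if z is Posz i then nth None [seq Some (inl b) | b <- w] i else None.

Definition bstep (w : seq bool) (b : basic) (s : store) : store :=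
  match b with
  | BInc r => setr s r (regs s r).+1
  | BDec r => setr s r (regs s r).-1
  | BInR => Store (regs s) (ip s + 1)%R (outw s) (op s)
  | BInL => Store (regs s) (ip s - 1)%R (outw s) (op s)
  | BBit r => setr s r (regs s r + (incell w (ip s) == Some (inl true)))
  | BOut r => Store (regs s) (ip s) (rcons (outw s) (0 < regs s r)) (op s + 1)%R
  | BOutL => Store (regs s) (ip s) (outw s) (op s - 1)%R
  end.

(* Output is only ever appended at the end of the word. *)
Definition bvalid (b : basic) (s : store) : Prop :=
  if b is BOut _ then op s = size (outw s) else True.

Inductive cmd :=
  | CB of basic
  | CSeq of cmd & cmd
  | CLoop of nat & cmd
  | CScan of nat.

(** The times are exact machine times: a round of a loop costs the test, the body and the jump back,
    and a scan costs two steps for each bit and a final test. The summands are in the order in which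
    [iterD] composes runs. *)
Inductive ev (w : seq bool) : cmd -> store -> nat -> store -> Prop :=
  | EvB b s : bvalid b s -> ev w (CB b) s 1 (bstep w b s)
  | EvSeq c1 c2 s t1 s1 t2 s2 : ev w c1 s t1 s1 -> ev w c2 s1 t2 s2 ->
      ev w (CSeq c1 c2) s (t1 + t2) s2
  | EvLoop0 r c s : regs s r = 0 -> ev w (CLoop r c) s 1 s
  | EvLoopS r c s n t1 s1 t2 s2 : regs s r = n.+1 ->
      ev w c (setr s r n) t1 s1 -> ev w (CLoop r c) s1 t2 s2 ->
      ev w (CLoop r c) s (t2 + (1 + (t1 + 1))) s2
  | EvScan r s : ip s = 0%R ->
      ev w (CScan r) s ((size w).*2.+1)
        (Store (regs (setr s r (regs s r + size w))) (size w) (outw s) (op s)).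

Definition breg (b : basic) : nat :=
  match b with BInc r | BDec r | BBit r | BOut r => r | _ => 0 end.

Fixpoint regbound (c : cmd) : nat :=
  match c with
  | CB b => breg b
  | CSeq c1 c2 => maxn (regbound c1) (regbound c2)
  | CLoop r c => maxn r (regbound c)
  | CScan r => r
  end.

(** Jumps are absolute, hence the address [o] of the first instruction. A loop exits to
    [o + size p + 2], behind its test, its body and the jump back. *)
Fixpoint code (o : nat) (c : cmd) : seq instr :=
  match c with
  | CB b => [:: IB b]
  | CSeq c1 c2 => let p := code o c1 in p ++ code (o + size p) c2
  | CLoop r c => let p := code o.+1 c in
      IDecJ r (o + size p + 2) :: rcons p (IJmp o)
  | CScan r => [:: IScan r (o + 2); IJmp o]
  end.

Section Machine.
Variables (R : nat) (prog : seq instr).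

Definition mark : symbol unit := Some (inr tt).

(* Tape 0 is the input, tape [r.+1] the register [r < R], tape [R.+1] the
   output; the value of a register is the distance of the head of its tape from
   the only marked cell. *)
Definition next_pc (i : instr) (pc : nat) (sc : nat -> symbol unit) : nat :=
  match i with
  | IB _ => pc.+1
  | IDecJ r l => if sc r.+1 == mark then l else pc.+1
  | IJmp l => l
  | IScan r l => if sc 0 == None then l else pc.+1
  end.

Definition tape_act (i : instr) (sc : nat -> symbol unit) (j : nat) :
    symbol unit * move :=
  match i with
  | IB (BInc r) => (sc j, if j == r.+1 then MoveR else Stay)
  | IB (BDec r) =>
      (sc j, if (j == r.+1) && (sc j != mark) then MoveL else Stay)
  | IB BInR => (sc j, if j == 0 then MoveR else Stay)
  | IB BInL => (sc j, if j == 0 then MoveL else Stay)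
  | IB (BBit r) =>
      (sc j, if (j == r.+1) && (sc 0 == Some (inl true)) then MoveR else Stay)
  | IB (BOut r) =>
      if j == R.+1 then (Some (inl (sc r.+1 != mark)), MoveR) else (sc j, Stay)
  | IB BOutL => (sc j, if j == R.+1 then MoveL else Stay)
  | IDecJ r l =>
      (sc j, if (j == r.+1) && (sc j != mark) then MoveL else Stay)
  | IJmp l => (sc j, Stay)
  | IScan r l =>
      (sc j, if (sc 0 != None) && ((j == 0) || (j == r.+1)) then MoveR else Stay)
  end.

Definition mstate : finType := option 'I_(size prog).+1.

(** The state [None] is left after a single step, which writes the marks on the register tapes and
    thereby sets all registers to 0. *)
Definition mdelta (q : mstate) (s : {ffun 'I_R.+2 -> symbol unit}) :
    mstate * {ffun 'I_R.+2 -> symbol unit * move} :=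
  if q is Some pc then
    let i := nth (IJmp 0) prog pc in
    let sc := fun j => s (inord j) in
    (Some (inord (next_pc i pc sc)), [ffun j : 'I_R.+2 => tape_act i sc j])
  else (Some ord0,
        [ffun j : 'I_R.+2 => (if 0 < j < R.+1 then mark else s j, Stay)]).

Definition mach : machine :=
  @Machine R.+1 unit mstate None
    (fun q => if q is Some pc then size prog <= pc else false) mdelta.

Definition repr (w : seq bool) (pc : nat) (s : store) (c : config mach) : Prop :=
  [/\ cstate c = Some (inord pc),
      forall z, cell_at (ctapes c (inord 0)) z = incell w (ip s + z)%R,
      forall r z, r < R -> cell_at (ctapes c (inord r.+1)) z =
         if (Posz (regs s r) + z == 0)%R then mark else None
    & forall z, cell_at (ctapes c (inord R.+1)) z = incell (outw s) (op s + z)%R].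

Definition istep (w : seq bool) (i : instr) (pc : nat) (s : store) :
    nat * store :=
  match i with
  | IB b => (pc.+1, bstep w b s)
  | IDecJ r l => if regs s r == 0 then (l, s) else (pc.+1, setr s r (regs s r).-1)
  | IJmp l => (l, s)
  | IScan r l => if incell w (ip s) == None then (l, s) else
      (pc.+1, Store (regs (setr s r (regs s r).+1)) (ip s + 1)%R (outw s) (op s))
  end.

Definition ireg (i : instr) : nat :=
  match i with IB b => breg b | IDecJ r _ | IScan r _ => r | IJmp _ => 0 end.

Lemma incell_rcons v b z :
  incell (rcons v b) z = if z == Posz (size v) then Some (inl b) else incell v z.
Proof.
case: z => [i|i] //=.
rewrite map_rcons nth_rcons size_map.
case: ltngtP => [h|h|->].
- by case: eqP => // -[e]; lia.
- by case: eqP => [[e]|_]; [lia | rewrite nth_default // size_map ltnW].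
- by rewrite eqxx.
Qed.

Lemma cell_at0 (A : finType) (t : tape A) : scanned t = cell_at t 0%R.
Proof. by []. Qed.

(** Only an output instruction changes the content of a cell; every other action writes back the
    scanned symbol, so each tape is either the same function of the position ([same]) or a translate
    of it ([mv]). *)
Lemma repr_step w pc s c i : 0 < R -> repr w pc s c -> pc < size prog ->
  i = nth (IJmp 0) prog pc -> ireg i < R ->
  (if i is IB b then bvalid b s else True) ->
  let: (pc', s') := istep w i pc s in repr w pc' s' (step c).
Proof.
move=> R0 [hq hin hr hout] hpc hi hir hv.
case e: (istep w i pc s) => [pc' s'].
have hst : step c = Config (M := mach)
   (Some (inord (next_pc i pc (fun j => scanned (ctapes c (inord j))))))
   [ffun j : 'I_R.+2 => let a := tape_act i (fun j => scanned (ctapes c (inord j))) j in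
     tape_move (tape_write (ctapes c j) a.1) a.2].
  have pcK : nat_of_ord (inord pc : 'I_(size prog).+1) = pc.
    by rewrite inordK // ltnS ltnW.
  rewrite /step hq /= pcK leqNgt hpc /= -hi; congr Config.
    congr (Some (inord _)); case: (i) => //= [r l|r l]; by rewrite !ffunE.
  apply/ffunP => j; rewrite !ffunE.
  have -> : (fun j0 : nat => [ffun i0 => scanned (ctapes c i0)] (inord j0)) =
            (fun j0 => scanned (ctapes c (inord j0))).
    by apply: functional_extensionality => x; rewrite ffunE.
  by [].
set sc := (fun j => scanned (ctapes c (inord j))) in hst *.
have sc0 : sc 0 = incell w (ip s) by rewrite /sc cell_at0 hin addr0.
have scr r : r < R -> (sc r.+1 == mark) = (regs s r == 0).
  move=> hr'; rewrite /sc cell_at0 hr // addr0.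
  by case: ifP => h; rewrite ?eqxx; apply/esym; [apply/eqP|apply/negbTE/eqP]; lia.
have cellS j z : j < R.+2 -> cell_at (ctapes (step c) (inord j)) z =
   let a := tape_act i sc j in
   if (z + shift a.2 == 0)%R then a.1 else cell_at (ctapes c (inord j)) (z + shift a.2)%R.
  move=> hj; rewrite hst; cbn [ctapes]; rewrite ffunE inordK //.
  by case: tape_act => a d; cbv zeta; cbn [fst snd]; rewrite cell_at_move cell_at_write.
have scz j z : (z = 0)%R -> sc j = cell_at (ctapes c (inord j)) z by move=> ->.
have same j z : j < R.+2 -> tape_act i sc j = (sc j, Stay) ->
   cell_at (ctapes (step c) (inord j)) z = cell_at (ctapes c (inord j)) z.
  by move=> hj ha; rewrite cellS // ha /= addr0; case: eqP => // h; apply: scz.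
have mv j z d : j < R.+2 -> tape_act i sc j = (sc j, d) ->
   cell_at (ctapes (step c) (inord j)) z =
   cell_at (ctapes c (inord j)) (z + shift d)%R.
  by move=> hj ha; rewrite cellS // ha /=; case: eqP => // h; apply: scz.
have hq' : cstate (step c) = Some (inord (next_pc i pc sc)) by rewrite hst.
have lr r : r < R -> r.+1 < R.+2 by lia.
have ne r : r < R -> (R.+1 == r.+1) = false by lia.
have ne' r : r < R -> (r.+1 == R.+1) = false by lia.
clear hst.
case: i hi hir hv e cellS same mv hq' => [b|r l|l|r l] hi hir hv e cellS same mv hq';
  rewrite /= in hir hq'.
- case: e => <- <-; split=> //.
  + move=> z; case: b hir {hi hv hq' cellS} same mv => [r|r|||r|r|] hir same mv /=;
      first [by rewrite same //= hin
            |by rewrite (mv 0 _ MoveR) //= hin; congr incell; lia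
            |by rewrite (mv 0 _ MoveL) //= hin; congr incell; lia].
  + move=> r z hrR; case: b hir {hi hv hq' cellS} same mv => [r'|r'|||r'|r'|] hir same mv /=.
    * case: (eqVneq r r') => [->|nr].
        by rewrite (mv _ _ MoveR) ?lr //= ?eqxx // hr //; congr (if _ then _ else _); lia.
      by rewrite same ?lr //= ?hr // eqSS (negbTE nr).
    * case: (eqVneq r r') => [->|nr]; last first.
        by rewrite same ?lr //= ?hr // eqSS (negbTE nr).
      case z0: (regs s r' == 0).
        rewrite same ?lr //= ?hr //= ?eqxx ?scr ?z0 //=; congr (if _ then _ else _); lia.
      rewrite (mv _ _ MoveL) ?lr //= ?hr // ?eqxx ?scr ?z0 //=; congr (if _ then _ else _); lia.
    * by rewrite same ?lr //= hr.
    * by rewrite same ?lr //= hr.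
    * case: (eqVneq r r') => [->|nr]; last first.
        by rewrite same ?lr //= ?hr // eqSS (negbTE nr).
      rewrite -sc0; case z0: (sc 0 == Some (inl true)).
        rewrite (mv _ _ MoveR) ?lr //= ?eqxx ?z0 ?hr //=; congr (if _ then _ else _); lia.
      rewrite same ?lr //= ?eqxx ?z0 ?hr //=; congr (if _ then _ else _); lia.
    * by rewrite same ?lr //= ?ne' // hr.
    * by rewrite same ?lr //= ?ne' // hr.
  + move=> z; case: b hir {hi hq'} hv cellS same mv => [r'|r'|||r'|r'|] hir hv cellS same mv /=;
      rewrite ?ne //.
    1-5: by rewrite same //= ?ne // hout.
    * rewrite cellS //= eqxx /= scr // hv incell_rcons.
      rewrite -lt0n (_ : (_ + _ == _)%R = (z + 1 == 0)%R); last by lia.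
      by case: ifP => // _; rewrite hout hv; congr incell; lia.
    * by rewrite (mv _ _ MoveL) //= ?eqxx // hout; congr incell; lia.
- rewrite scr // in hq'; rewrite /= in e.
  case: (eqVneq (regs s r) 0) e hq' => [z0|nz] [<- <-] hq'; split=> //.
  + by move=> z; rewrite same // hin.
  + move=> r' z hr'; rewrite same ?lr //= ?hr //.
    by case: eqP => //= -[->]; rewrite scr // z0 eqxx.
  + by move=> z; rewrite same //= ?ne // hout.
  + by move=> z; rewrite same // hin.
  + move=> r' z hr'; case: (eqVneq r' r) => [->|nr] /=; last first.
      by rewrite same ?lr //= ?eqSS ?(negbTE nr) //= ?hr.
    rewrite (mv _ _ MoveL) ?lr //= ?hr ?eqxx ?scr ?nz //=.
    congr (if _ then _ else _); lia.
  + by move=> z; rewrite same //= ?ne // hout.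
- case: e => <- <-; split=> //.
  + by move=> z; rewrite same // hin.
  + by move=> r z hrR; rewrite same ?lr // hr.
  + by move=> z; rewrite same // hout.
- rewrite sc0 in hq'; rewrite /= in e.
  case z0: (incell w (ip s) == None) e hq' => [] [<- <-] hq'; split=> //.
  + by move=> z; rewrite same //= ?sc0 ?z0 // hin.
  + by move=> r' z hr'; rewrite same ?lr //= ?sc0 ?z0 // hr.
  + by move=> z; rewrite same //= ?sc0 ?z0 // hout.
  + by move=> z; rewrite (mv _ _ MoveR) //= ?sc0 ?z0 // hin; congr incell; lia.
  + move=> r' z hr'; case: (eqVneq r' r) => [->|nr] /=; last first.
      by rewrite same ?lr //= ?eqSS ?(negbTE nr) ?andbF //= ?hr.
    rewrite (mv _ _ MoveR) ?lr //= ?hr ?eqxx ?sc0 ?z0 //=.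
    congr (if _ then _ else _); lia.
  + by move=> z; rewrite same //= ?ne ?andbF // hout.
Qed.

Lemma repr_istep w pre post i s cfg pc' s' : 0 < R ->
  prog = pre ++ i :: post -> ireg i < R ->
  (if i is IB b then bvalid b s else True) ->
  repr w (size pre) s cfg -> istep w i (size pre) s = (pc', s') ->
  repr w pc' s' (step cfg).
Proof.
move=> R0 hp hi hv hrep e.
have := @repr_step w (size pre) s cfg i R0 hrep; rewrite e; apply=> //.
  by rewrite hp size_cat /= -addSnnS leq_addr.
by rewrite hp nth_cat ltnn subnn.
Qed.

Lemma exec_scan w r m k pre post s cfg : r < R ->
  prog = pre ++ [:: IScan r (size pre + 2); IJmp (size pre)] ++ post ->
  k + m = size w -> ip s = k -> repr w (size pre) s cfg ->
  repr w (size pre + 2)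
    (Store (regs (setr s r (regs s r + m))) (size w) (outw s) (op s))
    (iter m.*2.+1 (@step mach) cfg).
Proof.
move=> hr hp; have R0 : 0 < R by case: R hr.
elim: m k s cfg => [|m IH] k s cfg hk hip hrep.
  have e : incell w (ip s) = None.
    by rewrite hip /= nth_default // size_map -hk addn0.
  apply: (repr_istep R0 hp _ _ hrep) => //.
  rewrite /= e eqxx -hk !addn0; case: s hip {hrep e} => /= g a b c ->.
  congr (_, Store _ _ _ _); apply: functional_extensionality => x.
  by case: eqP => // ->.
have e : incell w (ip s) != None.
  by rewrite hip /= (nth_map false) // -hk; lia.
rewrite doubleS iterSr iterSr.
set s1 := Store (regs (setr s r (regs s r).+1)) (ip s + 1)%R (outw s) (op s).
have h1 : repr w (size pre).+1 s1 (step cfg).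
  by apply: (repr_istep R0 hp _ _ hrep) => //=; rewrite (negbTE e).
have h2 : repr w (size pre) s1 (step (step cfg)).
  apply: (@repr_istep w (rcons pre (IScan r (size pre + 2))) post
    (IJmp (size pre)) s1 (step cfg)) => //=; first by rewrite hp cat_rcons.
  by rewrite size_rcons.
have := IH k.+1 s1 _ _ _ h2; rewrite addSnnS => /(_ hk).
have -> : ip s1 = k.+1 by rewrite /= hip; lia.
move=> /(_ erefl); congr (repr _ _ _ _).
rewrite /s1 /=; congr (Store _ _ _ _); apply: functional_extensionality => x.
by rewrite eqxx; case: eqP => // _; rewrite addSnnS.
Qed.

(** By induction on the evaluation, with the surrounding program generalised: the code of a
    subcommand is the same list placed at another offset. *)
Lemma exec_code w c s t s' : ev w c s t s' -> regbound c < R ->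
  forall pre post cfg, prog = pre ++ code (size pre) c ++ post ->
  repr w (size pre) s cfg ->
  repr w (size pre + size (code (size pre) c)) s' (iter t (@step mach) cfg).
Proof.
elim=> {c s t s'}.
- move=> b s hb /= hr pre post cfg hp hrep.
  have R0 : 0 < R by case: R hr.
  by apply: (repr_istep R0 hp _ _ hrep) => //; rewrite addn1.
- move=> c1 c2 s t1 s1 t2 s2 _ IH1 _ IH2 /=; rewrite gtn_max => /andP[h1 h2].
  move=> pre post cfg hp hrep.
  have hp1 : prog = pre ++ code (size pre) c1 ++
      (code (size pre + size (code (size pre) c1)) c2 ++ post).
    by rewrite hp -!catA.
  have := IH1 h1 _ _ _ hp1 hrep.
  have := IH2 h2 (pre ++ code (size pre) c1) post.
  rewrite size_cat -catA => /(_ _ hp1) H /H.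
  by rewrite [t1 + t2]addnC iterD size_cat addnA.
- move=> r c s h0 /=; rewrite gtn_max => /andP[h1 h2] pre post cfg hp hrep.
  have R0 : 0 < R by case: R h1.
  apply: (repr_istep R0 hp _ _ hrep) => //.
  by rewrite /= h0 eqxx size_rcons; congr (_, _); lia.
- move=> r c s n t1 s1 t2 s2 hn _ IH1 _ IH2 /=; rewrite gtn_max => /andP[h1 h2].
  have R0 : 0 < R by case: R h1.
  move=> pre post cfg hp hrep.
  set i0 := IDecJ _ _ in hp *.
  have hA : repr w (size pre).+1 (setr s r n) (step cfg).
    apply: (repr_istep R0 hp _ _ hrep) => //.
    by rewrite /= hn.
  have hB := IH1 h2 (rcons pre i0) (IJmp (size pre) :: post) (step cfg).
  rewrite size_rcons in hB.
  have {}hB := hB _ hA.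
  have hpB : prog = rcons pre i0 ++ code (size pre).+1 c ++ IJmp (size pre) :: post.
    by rewrite hp cat_rcons /= cat_rcons.
  have {}hB := hB hpB.
  have hC : repr w (size pre) s1 (step (iter t1 (@step mach) (step cfg))).
    apply: (@repr_istep w (rcons pre i0 ++ code (size pre).+1 c) post
       (IJmp (size pre)) s1) => //.
      by rewrite hpB -catA.
    by rewrite size_cat size_rcons.
  have := IH2 _ pre post _ _ hC; rewrite /= gtn_max h1 h2 => /(_ erefl hp).
  by rewrite -/i0 !iterD.
- move=> r s h0 /= hr pre post cfg hp hrep.
  by apply: (exec_scan (k := 0) hr hp).
Qed.

End Machine.

Lemma bits_prefix_nth (A : finType) (l : seq (symbol A)) (v : seq bool) :
  (forall i, nth None l i = nth None [seq Some (inl b) | b <- v] i) ->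
  bits_prefix l = v.
Proof.
elim: v l => [|b v IH] [|a l] h //=.
- by have /= := h 0 => ->.
- by have := h 0.
- have /= -> := h 0; congr (_ :: _).
  by apply: IH => i; have := h i.+1.
Qed.

Definition store0 : store := Store (fun=> 0) 0%R [::] 0%R.

Lemma horner_shift_exp k n : (('X + 2%:P : {poly nat}) ^+ k).[n]%R = n.+2 ^ k.
Proof.
elim: k => [|k IH]; first by rewrite expr0 hornerC.
rewrite exprS hornerM IH hornerD hornerX hornerC expnS.
by congr (_ * _); rewrite -[(n + 2)%R]/(n + 2)%N addn2.
Qed.

(** Bounds have the form [n.+2 ^ k]: as the base is at least 2, constant factors and sums of such
    bounds are absorbed by a larger exponent. *)
Lemma cmd_polytime c (f : seq bool -> seq bool) k :
  (forall w, exists t s', [/\ t <= (size w).+2 ^ k, ev w c store0 t s',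
     outw s' = f w & op s' = 0%R]) -> polytime f.
Proof.
move=> H; set R := (regbound c).+1; set prog := code 0 c.
exists (mach R prog), (('X + 2%:P) ^+ k + 1%:P)%R => w.
have -> : (('X + 2%:P) ^+ k + 1%:P : {poly nat}).[size w]%R =
    (size w).+2 ^ k + 1 :> nat.
  by rewrite hornerD hornerC horner_shift_exp.
have [t [s' [ht hev ho hop]]] := H w.
have h0 : repr w 0 store0 (step (init_config (mach R prog) w)).
  rewrite /init_config /step /=; split=> /=.
  - by congr Some; apply: val_inj; rewrite /= inordK.
  - move=> z; rewrite !ffunE inordK //= add0r cell_at_write cell_at_word.
    rewrite (_ : inord 0 == ord0 :> 'I_R.+2); last by apply/eqP/val_inj; rewrite /= inordK.
    by case: eqP => // ->; rewrite /= nth0.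
  - move=> r z hr; rewrite !ffunE inordK; last by lia.
    rewrite /= ltnS hr cell_at_write add0r cell_at_word.
    rewrite (_ : inord r.+1 == ord0 :> 'I_R.+2 = false).
      by case: eqP => // _; case: z => // i; rewrite nth_nil.
    by apply/negbTE/eqP => /(congr1 val) /=; rewrite inordK //; lia.
  - move=> z; rewrite !ffunE inordK // ltnn /= cell_at_write cell_at_word add0r.
    rewrite (_ : inord R.+1 == ord0 :> 'I_R.+2 = false).
      by case: eqP => [->|_]; case: (z) => // i; rewrite nth_nil.
    by apply/negbTE/eqP => /(congr1 val) /=; rewrite inordK //; lia.
have h1 := @exec_code R prog w c _ _ _ hev (ltnSn _) [::] [::] _ _ h0.
have {}h1 := h1 (esym (cats0 _)); rewrite /= add0n in h1.
set c1 := iter t _ _ in h1.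
have hs n : iter n (@step (mach R prog)) c1 = c1.
  elim: n => //= n ->; rewrite /step.
  by case: h1 => -> _ _ _ /=; rewrite inordK // leqnn.
(* One step sets the marks, [t] steps execute the code, and the machine is halted during the
   remaining ones. *)
have -> : (size w).+2 ^ k + 1 = ((size w).+2 ^ k - t) + t.+1 by lia.
rewrite iterD iterSr hs /=.
case: h1 => -> _ _ hout; split; first by rewrite /= inordK.
rewrite /output (_ : ord_max = inord R.+1); last first.
  by apply: val_inj; rewrite /= inordK.
apply: bits_prefix_nth => i; rewrite -ho.
by have := hout (Posz i); rewrite hop add0r /=; case: i.
Qed.

(** * Arithmetic expressions with unary values *)

Inductive expr :=
  | EVar of nat
  | EOne
  | ESize
  | EBit of expr
  | EAdd of expr & expr
  | ESub of expr & expr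
  | ESum of expr & expr
  | ELet of expr & expr
  | EWk of expr.

Fixpoint eval (w : seq bool) (v : seq nat) (e : expr) : nat :=
  match e with
  | EVar i => nth 0 v i
  | EOne => 1
  | ESize => size w
  | EBit e => nth false w (eval w v e)
  | EAdd e1 e2 => eval w v e1 + eval w v e2
  | ESub e1 e2 => eval w v e1 - eval w v e2
  | ESum e1 e2 => \sum_(i < eval w v e1) eval w (val i :: v) e2
  | ELet e1 e2 => eval w (eval w v e1 :: v) e2
  | EWk e => eval w (behead v) e
  end.

Definition move_reg (r d : nat) : cmd := CLoop r (CB (BInc d)).

Definition copy_reg (r d : nat) : cmd :=
  CSeq (CLoop r (CSeq (CB (BInc d)) (CB (BInc d.+1)))) (move_reg d.+1 r).

(* Register [d] is assumed to hold 0. *)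
Definition clear_reg (r d : nat) : cmd := CLoop r (CB (BDec d)).

(** [rho] lists the registers of the variables and [d] is the first free one; it receives the value,
    and all later registers are 0 before and after. A sum keeps its counter in [d], the index in
    [d.+1], the accumulator in [d.+2] and the summand in [d.+3]. A variable outside of [rho] has
    value 0, and clearing the register [d], which is already 0, is a command without effect. *)
Fixpoint comp (rho : seq nat) (d : nat) (e : expr) : cmd :=
  match e with
  | EVar i => if i < size rho then copy_reg (nth 0 rho i) d else clear_reg d d.+1
  | EOne => CB (BInc d)
  | ESize => copy_reg 0 d
  | EBit e => CSeq (comp rho d e)
      (CSeq (CLoop d (CSeq (CB BInR) (CB (BInc d.+1))))
      (CSeq (CB (BBit d)) (CLoop d.+1 (CB BInL))))
  | EAdd e1 e2 => CSeq (comp rho d e1) (CSeq (comp rho d.+1 e2) (move_reg d.+1 d))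
  | ESub e1 e2 =>
      CSeq (comp rho d e1) (CSeq (comp rho d.+1 e2) (CLoop d.+1 (CB (BDec d))))
  | ESum e1 e2 => CSeq (comp rho d e1)
      (CSeq (CLoop d (CSeq (comp (d.+1 :: rho) d.+3 e2)
               (CSeq (move_reg d.+3 d.+2) (CB (BInc d.+1)))))
      (CSeq (clear_reg d.+1 d.+3) (move_reg d.+2 d)))
  | ELet e1 e2 => CSeq (comp rho d e1)
      (CSeq (comp (d :: rho) d.+1 e2) (CSeq (clear_reg d d.+2) (move_reg d.+1 d)))
  | EWk e => comp (behead rho) d e
  end.

Definition runs (w : seq bool) (c : cmd) (s : store) (B : nat) (s' : store) :=
  exists2 t, t <= B & ev w c s t s'.

Lemma store_eq s s' : regs s =1 regs s' -> ip s = ip s' -> outw s = outw s' ->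
  op s = op s' -> s = s'.
Proof.
case: s => a b c d; case: s' => a' b' c' d' /= h -> -> ->; congr Store.
exact: functional_extensionality.
Qed.

Ltac steq := apply: store_eq;
  [move=> ?; rewrite /setr /=;
   repeat (let E := fresh "E" in case: eqP => E;
           [try (exfalso; lia); try rewrite E|]; try done);
   try lia
  |rewrite /=; try done; try lia
  |by rewrite /=
  |rewrite /=; try done; try lia].

Lemma runs_seq w c1 c2 s B1 s1 B2 s2 : runs w c1 s B1 s1 -> runs w c2 s1 B2 s2 ->
  runs w (CSeq c1 c2) s (B1 + B2) s2.
Proof.
move=> [t1 h1 e1] [t2 h2 e2]; exists (t1 + t2); first exact: leq_add.
exact: EvSeq e1 e2.
Qed.

Lemma runs_basic w b s s' : bvalid b s -> bstep w b s = s' ->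
  runs w (CB b) s 1 s'.
Proof. by move=> h <-; exists 1 => //; constructor. Qed.

Lemma runs_weaken w c s B s' B' s'' : runs w c s B s' -> B <= B' -> s' = s'' ->
  runs w c s B' s''.
Proof. by move=> [t h e] hB <-; exists t => //; apply: leq_trans hB. Qed.

Lemma runs_loop w (S : nat -> store) r c B m :
  (forall j, j <= m -> regs (S j) r = m - j) ->
  (forall j, j < m -> runs w c (setr (S j) r (m - j.+1)) B (S j.+1)) ->
  runs w (CLoop r c) (S 0) (m * (B + 2) + 1) (S m).
Proof.
elim: m S => [|m IH] S h1 h2.
  by exists 1 => //; constructor; rewrite h1.
have [t1 l1 e1] := h2 0 isT.
have [j hj|j hj|t2 l2 e2] := IH (fun j => S j.+1).
- by rewrite h1.
- exact: h2.
exists (t2 + (1 + (t1 + 1))); first by lia.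
apply: EvLoopS e1 e2; by rewrite h1 // subn0 subn1.
Qed.

Lemma runs_move w r d s : r != d -> runs w (move_reg r d) s (regs s r * 3 + 1)
  (setr (setr s r 0) d (regs s d + regs s r)).
Proof.
move=> /eqP hrd; set m := regs s r.
pose S j := setr (setr s r (m - j)) d (regs s d + j).
have hS0 : s = S 0 by steq.
have hSm : setr (setr s r 0) d (regs s d + m) = S m by rewrite /S subnn.
rewrite {1}hS0 hSm; apply: (runs_loop (B := 1)).
  by move=> j hj; rewrite /S /setr /= eqxx; case: eqP => // /hrd.
move=> j hj; apply: runs_basic => //=; rewrite /S; steq.
Qed.

Lemma runs_clear w r d s : r != d -> regs s d = 0 ->
  runs w (clear_reg r d) s (regs s r * 3 + 1) (setr s r 0).
Proof.
move=> /eqP hrd hd; set m := regs s r.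
pose S j := setr s r (m - j).
have hS0 : s = S 0 by steq.
have hSm : setr s r 0 = S m by rewrite /S subnn.
rewrite {1}hS0 hSm; apply: (runs_loop (B := 1)).
  by move=> j hj; rewrite /S /setr /= eqxx.
move=> j hj; apply: runs_basic => //=; rewrite /S; steq.
Qed.

Lemma runs_copy w r d s : r < d -> regs s d.+1 = 0 ->
  runs w (copy_reg r d) s (regs s r * 7 + 2) (setr s d (regs s d + regs s r)).
Proof.
move=> hrd h0; set m := regs s r.
pose S j := setr (setr (setr s r (m - j)) d (regs s d + j)) d.+1 j.
have hS0 : s = S 0 by steq.
have l1 : runs w (CLoop r (CSeq (CB (BInc d)) (CB (BInc d.+1)))) (S 0)
    (m * 4 + 1) (S m).
  apply: (runs_loop (B := 2)).
    move=> j hj; rewrite /S /setr /= eqxx; do !case: eqP => ?; lia.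
  move=> j hj; apply: (@runs_seq _ _ _ _ 1 _ 1); first exact: runs_basic.
  by apply: runs_basic => //=; rewrite /S; steq.
rewrite -hS0 in l1.
have l2 := @runs_move w d.+1 r (S m) _.
have {}l2 := l2 (ltac:(lia)).
apply: runs_weaken (runs_seq l1 l2) _ _.
  by rewrite /S /setr /= eqxx; lia.
by rewrite /S; steq.
Qed.

(** The bound [n] is kept apart from the input size because under a sum the index may exceed the
    latter; [0 < d] protects register 0, which holds the input size. *)
Definition fits (w : seq bool) (n : nat) (rho v : seq nat) (d : nat) (s : store) :=
  [/\ v = [seq regs s r | r <- rho], all (fun r => r < d) rho, 0 < d,
      forall r, d <= r -> regs s r = 0 &
      [/\ regs s 0 = size w, ip s = 0%R, size w <= n & all (fun x => x <= n) v]].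

Lemma map_setr rho d s x : all (fun r => r < d) rho ->
  [seq regs (setr s d x) r | r <- rho] = [seq regs s r | r <- rho].
Proof.
move=> h; apply/eq_in_map => r /(allP h) hr /=; case: eqP => // e.
by rewrite e ltnn in hr.
Qed.

Lemma expX_lin c n k : c * n.+2 ^ k <= n.+2 ^ (c + k).
Proof.
rewrite expnD leq_mul2r; apply/orP; right.
by apply: ltnW; apply: ltn_expl.
Qed.

Lemma expX_mono n k k' : k <= k' -> n.+2 ^ k <= n.+2 ^ k'.
Proof. by move=> h; rewrite leq_exp2l. Qed.

Lemma fitsS w n rho v d s x : fits w n rho v d s ->
  fits w n rho v d.+1 (setr s d x).
Proof.
case=> hv hr hd hz [h0 hip hw hn]; split=> //.
- by rewrite map_setr.
- by apply: sub_all hr => r; apply: leqW.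
- by move=> r hr'; rewrite /= gtn_eqF // hz // ltnW.
- by split=> //=; case: eqP => // e; rewrite -e in hd.
Qed.

(** The exponent depends on the expression only, so the bound may be used with a larger [n] for the
    body of a sum. The value has to be bounded along with the time, since it can become a number of
    rounds. *)
Definition compiles (e : expr) : Prop :=
  exists k, forall w n rho v d s, fits w n rho v d s ->
    eval w v e <= n.+2 ^ k /\
    runs w (comp rho d e) s (n.+2 ^ k) (setr s d (eval w v e)).

(** Polynomial bounds compose: [n + n.+2 ^ k1] bounds the variables in the scope of a binder whose
    value is at most [n.+2 ^ k1]. *)
Lemma expX_comp n k1 k2 :
  (n + n.+2 ^ k1).+2 ^ k2 <= n.+2 ^ ((k1 + 2) * k2).
Proof.
rewrite expnM; have [->|k2p] := posnP k2; first by rewrite !expn0.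
rewrite leq_exp2r // addn2 !expnS.
have : 0 < n.+2 ^ k1 by rewrite expn_gt0.
by nia.
Qed.

Lemma compiles_var i : compiles (EVar i).
Proof.
exists 9 => w n rho v d s [-> hr hd hz [h0 hip hw hn]] /=.
have hX := expX_lin 8 n 1; rewrite expn1 in hX.
case: ltnP => hi; last first.
  rewrite (nth_default _ (s := map _ _)) ?size_map //; split=> //.
  apply: runs_weaken (runs_clear _ _ _) _ _; rewrite ?hz //; lia.
rewrite (nth_map 0) //.
have hle : regs s (nth 0 rho i) <= n.
  by move/allP: hn; apply; apply: map_f; apply: mem_nth.
split; first by lia.
have := @runs_copy w (nth 0 rho i) d s.
rewrite (hz d.+1) // (hz d) // add0n => H.
apply: runs_weaken (H _ _) _ _ => //; last by lia.
by apply: (allP hr); apply: mem_nth.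
Qed.

Lemma compiles_one : compiles (EOne).
Proof.
exists 1 => w n rho v d s [_ hr hd hz _] /=; rewrite expn1; split=> //.
by apply: runs_weaken (runs_basic _ _) _ _ => //=; rewrite hz.
Qed.

Lemma compiles_size : compiles (ESize).
Proof.
exists 9 => w n rho v d s [_ hr hd hz [h0 hip hw hn]] /=.
have hX := expX_lin 8 n 1; rewrite expn1 in hX.
split; first by lia.
have := @runs_copy w 0 d s.
rewrite (hz d.+1) // (hz d) // add0n h0 => H.
by apply: runs_weaken (H _ _) _ _ => //; lia.
Qed.

Lemma compiles_bit e : compiles e -> compiles (EBit e).
Proof.
move=> [k IH].
exists (12 + k) => w n rho v d s hf.
have [hv hrun] := IH w n rho v d s hf.
have hX := expX_lin 12 n k; have h1 := expn_gt0 n.+2 k; rewrite /= in h1.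
case: (hf) => _ hr hd hz [h0 hip hw hn] /=.
split; first by case: nth; lia.
set x := eval w v e in hv hrun *.
(* The input head walks [x] cells to the right; register [d.+1] records the distance for the way
   back, as [d] is consumed. *)
pose S j := Store (regs (setr (setr s d (x - j)) d.+1 j)) (Posz j) (outw s) (op s).
have e0 : setr s d x = S 0.
  by rewrite /S; steq; rewrite hz //; lia.
have l1 : runs w (CLoop d (CSeq (CB BInR) (CB (BInc d.+1)))) (S 0) (x * 4 + 1) (S x).
  apply: (runs_loop (B := 2)) => j hj.
    by rewrite /= eqxx; case: eqP => //; lia.
  apply: (@runs_seq _ _ _ _ 1 _ 1); first exact: runs_basic.
  by apply: runs_basic => //=; rewrite /S; apply: store_eq => //=; [move=> r; do !case: eqP => //; lia | lia].
pose S' j := Store (regs (setr (setr s d (nth false w x)) d.+1 (x - j))) (Posz x - Posz j)%R (outw s) (op s).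
have hbit : (nth None [seq Some (inl b) | b <- w] x ==
     Some (inl true : bool + unit)) = nth false w x.
  case: (ltnP x (size w)) => hx; last by rewrite !nth_default // size_map.
  by rewrite (nth_map false) //; case: nth.
have l2 : runs w (CB (BBit d)) (S x) 1 (S' 0).
  by apply: runs_basic => //; rewrite /S /S' /= hbit; steq.
have l3 : runs w (CLoop d.+1 (CB BInL)) (S' 0) (x * 3 + 1) (S' x).
  apply: (runs_loop (B := 1)) => j hj; first by rewrite /= eqxx.
  by apply: runs_basic => //=; rewrite /S'; apply: store_eq => //=; [move=> r; do !case: eqP => //; lia | lia].
rewrite e0 in hrun.
apply: runs_weaken (runs_seq hrun (runs_seq l1 (runs_seq l2 l3))) _ _; first by lia.
rewrite /S'; apply: store_eq => //=; last by lia.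
move=> r; rewrite subnn; case: (eqVneq r d.+1) => // ->; rewrite ?hz //.
by case: eqP => //; lia.
Qed.

Lemma compiles_add e1 e2 : compiles e1 -> compiles e2 -> compiles (EAdd e1 e2).
Proof.
move=> [k1 IH1] [k2 IH2].
exists (6 + (k1 + k2)) => w n rho v d s hf /=.
have [hv1 hrun1] := IH1 w n rho v d s hf.
have [hv2 hrun2] := IH2 w n rho v d.+1 _ (fitsS (eval w v e1) hf).
have hX := expX_lin 6 n (k1 + k2).
have a1 := expX_mono n (leq_addr k2 k1); have a2 := expX_mono n (leq_addl k1 k2).
have h1 := expn_gt0 n.+2 (k1 + k2); rewrite /= in h1.
split; first by lia.
have l3 := @runs_move w d.+1 d (setr (setr s d (eval w v e1)) d.+1 (eval w v e2)).
have {}l3 := l3 (ltac:(lia)).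
rewrite /= eqxx [d == _]ltn_eqF // eqxx in l3.
apply: runs_weaken (runs_seq hrun1 (runs_seq hrun2 l3)) _ _; first by lia.
by case: (hf) => _ _ _ hz _; steq; rewrite hz //; lia.
Qed.

Lemma compiles_sub e1 e2 : compiles e1 -> compiles e2 -> compiles (ESub e1 e2).
Proof.
move=> [k1 IH1] [k2 IH2].
exists (6 + (k1 + k2)) => w n rho v d s hf /=.
have [hv1 hrun1] := IH1 w n rho v d s hf.
have [hv2 hrun2] := IH2 w n rho v d.+1 _ (fitsS (eval w v e1) hf).
have hX := expX_lin 6 n (k1 + k2).
have a1 := expX_mono n (leq_addr k2 k1); have a2 := expX_mono n (leq_addl k1 k2).
have h1 := expn_gt0 n.+2 (k1 + k2); rewrite /= in h1.
split; first by lia.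
set x1 := eval w v e1 in hv1 hrun1 hrun2 *.
set x2 := eval w v e2 in hv2 hrun2 *.
pose S j := setr (setr s d (x1 - j)) d.+1 (x2 - j).
have l3 : runs w (CLoop d.+1 (CB (BDec d))) (S 0) (x2 * 3 + 1) (S x2).
  apply: (runs_loop (B := 1)) => j hj; first by rewrite /= eqxx.
  by apply: runs_basic => //=; rewrite /S; steq.
rewrite {1}/S !subn0 in l3.
apply: runs_weaken (runs_seq hrun1 (runs_seq hrun2 l3)) _ _; first by lia.
by case: (hf) => _ _ _ hz _; rewrite /S; steq; rewrite hz //; lia.
Qed.

Lemma compiles_sum e1 e2 : compiles e1 -> compiles e2 -> compiles (ESum e1 e2).
Proof.
move=> [k1 IH1] [k2 IH2].
exists (30 + (k1 + (k1 + 2) * k2)) => w n rho v d s hf /=.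
have [hv1 hrun1] := IH1 w n rho v d s hf.
set x1 := eval w v e1 in hv1 hrun1 *.
set n' := n + n.+2 ^ k1.
have hY := expX_comp n k1 k2; rewrite -/n' in hY.
have hX := expX_lin 30 n (k1 + (k1 + 2) * k2).
rewrite expnD in hX.
set X := n.+2 ^ k1 in hv1 hrun1 hX n' hY *.
set Y := n.+2 ^ _ in hX hY *.
have X1 : 0 < X by rewrite expn_gt0.
have Y1 : 0 < Y by rewrite expn_gt0.
have XP : X <= X * Y by rewrite leq_pmulr.
have YP : Y <= X * Y by rewrite leq_pmull.
case: (hf) => hv hr hd hz [h0 hip hw hn].
pose acc j := \sum_(i < j) eval w (val i :: v) e2.
have hb j : j < x1 -> forall s', fits w n' (d.+1 :: rho) (j :: v) d.+3 s' ->
    eval w (j :: v) e2 <= Y /\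
    runs w (comp (d.+1 :: rho) d.+3 e2) s' Y (setr s' d.+3 (eval w (j :: v) e2)).
  move=> hj s' hf'; have [b1 b2] := IH2 _ _ _ _ _ _ hf'; split; first exact: leq_trans hY.
  by apply: runs_weaken b2 _ _.
pose S j := setr (setr (setr s d (x1 - j)) d.+1 j) d.+2 (acc j).
have hfS j : j < x1 -> fits w n' (d.+1 :: rho) (j :: v) d.+3 (setr (S j) d (x1 - j.+1)).
  move=> hj; split=> //=.
  - rewrite eqxx [d.+1 == d]gtn_eqF // [d.+1 == d.+2]ltn_eqF //; congr (_ :: _).
    rewrite hv; apply/eq_in_map => r /(allP hr) hrd.
    by do !case: eqP => // ?; lia.
  - apply/andP; split; first by lia.
    by apply: sub_all hr => r; lia.
  - by move=> r hr'; do !case: eqP => [?|_] //; rewrite ?hz; lia.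
  - split=> //=.
    + by do !case: eqP => [?|_] //; lia.
    + by rewrite /n'; lia.
    + apply/andP; split; first by rewrite /n'; lia.
      by apply: sub_all hn => r; rewrite /n'; lia.
have hacc j : j <= x1 -> acc j <= j * Y.
  elim: j => [|j IHj] hj; first by rewrite /acc big_ord0.
  rewrite /acc big_ord_recr /= -/(acc j) mulSn addnC.
    apply: leq_add; last by apply: IHj; apply: ltnW.
  by have [] := hb j hj _ (hfS j hj).
have haccS j : acc j.+1 = acc j + eval w (j :: v) e2 by rewrite /acc big_ord_recr.
have hval : acc x1 <= X * Y.
  by apply: leq_trans (hacc _ (leqnn _)) _; rewrite leq_mul2r hv1 orbT.
split; first by rewrite -/(acc x1); lia.
set body := CSeq (comp (_ :: _) _ _) _.
have l1 : runs w (CLoop d body) (S 0) (x1 * (Y * 4 + 2 + 2) + 1) (S x1).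
  apply: runs_loop => j hj; first by rewrite /S /= eqxx; do !case: eqP => // ?; lia.
  have [b1 b2] := hb j hj _ (hfS j hj).
  set s1 := setr _ d.+3 _ in b2.
  have m1 := @runs_move w d.+3 d.+2 s1 (ltac:(lia)).
  have m2 : runs w (CB (BInc d.+1)) (setr (setr s1 d.+3 0) d.+2 (regs s1 d.+2 + regs s1 d.+3)) 1 (S j.+1).
    apply: runs_basic => //=; rewrite /s1 /S haccS.
    by steq; rewrite hz //; lia.
  apply: runs_weaken (runs_seq b2 (runs_seq m1 m2)) _ _ => //.
  by rewrite /s1 /= eqxx; lia.
have e0 : setr s d x1 = S 0.
  by rewrite /S /acc big_ord0 subn0; steq; rewrite hz //; lia.
have l2 := @runs_clear w d.+1 d.+3 (S x1) (ltac:(lia)).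
have {}l2 : runs w (clear_reg d.+1 d.+3) (S x1) (x1 * 3 + 1) (setr (S x1) d.+1 0).
  apply: runs_weaken (l2 _) _ _ => //.
    by rewrite /S /=; do !case: eqP => // ?; rewrite ?hz; lia.
  by rewrite /S /= eqxx; do !case: eqP => // ?; lia.
have l3 := @runs_move w d.+2 d (setr (S x1) d.+1 0) (ltac:(lia)).
rewrite e0 in hrun1.
apply: runs_weaken (runs_seq hrun1 (runs_seq l1 (runs_seq l2 l3))) _ _.
  have -> : regs (setr (S x1) d.+1 0) d.+2 = acc x1.
    by rewrite /S /= eqxx; case: eqP => // ?; lia.
  have : x1 * (Y * 4 + 2 + 2) <= X * Y * 4 + X * 4.
    by rewrite -addnA mulnDr -mulnA leq_add // leq_mul2r hv1 ?orbT.
  by lia.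
by rewrite -/(acc x1) /S; steq; rewrite ?hz //; lia.
Qed.

Lemma compiles_let e1 e2 : compiles e1 -> compiles e2 -> compiles (ELet e1 e2).
Proof.
move=> [k1 IH1] [k2 IH2].
exists (20 + (k1 + (k1 + 2) * k2)) => w n rho v d s hf /=.
have [hv1 hrun1] := IH1 w n rho v d s hf.
set x1 := eval w v e1 in hv1 hrun1 *.
set n' := n + n.+2 ^ k1.
have hY := expX_comp n k1 k2; rewrite -/n' in hY.
have hX := expX_lin 20 n (k1 + (k1 + 2) * k2).
rewrite expnD in hX.
set X := n.+2 ^ k1 in hv1 hrun1 hX n' hY *.
set Y := n.+2 ^ _ in hX hY *.
have X1 : 0 < X by rewrite expn_gt0.
have Y1 : 0 < Y by rewrite expn_gt0.
have XP : X <= X * Y by rewrite leq_pmulr.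
have YP : Y <= X * Y by rewrite leq_pmull.
case: (hf) => hv hr hd hz [h0 hip hw hn].
have hf' : fits w n' (d :: rho) (x1 :: v) d.+1 (setr s d x1).
  split=> //=.
  - by rewrite eqxx map_setr // hv.
  - by rewrite leqnn; apply: sub_all hr => r; lia.
  - by move=> r hr'; rewrite gtn_eqF // hz // ltnW.
  - split=> //=; first by case: eqP => // ?; lia.
      by rewrite /n'; lia.
    apply/andP; split; first by rewrite /n'; lia.
    by apply: sub_all hn => r; rewrite /n'; lia.
have [hv2 hrun2] := IH2 _ _ _ _ _ _ hf'.
set x2 := eval _ _ e2 in hv2 hrun2 *.
split; first by lia.
have l2 := @runs_clear w d d.+2 (setr (setr s d x1) d.+1 x2) (ltac:(lia)).
have {}l2 : runs w (clear_reg d d.+2) (setr (setr s d x1) d.+1 x2) (x1 * 3 + 1) (setr s d.+1 x2).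
  apply: runs_weaken (l2 _) _ _ => //.
  - by rewrite /=; do !case: eqP => // ?; rewrite ?hz; lia.
  - by rewrite /= eqxx; do !case: eqP => // ?; lia.
  - by steq; rewrite hz //; lia.
have l3 := @runs_move w d.+1 d (setr s d.+1 x2) (ltac:(lia)).
apply: runs_weaken (runs_seq hrun1 (runs_seq hrun2 (runs_seq l2 l3))) _ _.
  by rewrite /= eqxx; lia.
by steq; rewrite ?hz //; lia.
Qed.

Lemma compiles_wk e : compiles e -> compiles (EWk e).
Proof.
move=> [k IH].
exists k => w n rho v d s [-> hr hd hz [h0 hip hw hn]] /=.
apply: IH; split=> //.
- by case: (rho).
- by case: (rho) hr => //= a l /andP[].
- by split=> //; case: (rho) hn => //= a l /andP[].
Qed.

Lemma comp_ok e : compiles e.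
Proof.
elim: e => [i|||e IH|e1 IH1 e2 IH2|e1 IH1 e2 IH2|e1 IH1 e2 IH2|e1 IH1 e2 IH2|e IH].
- exact: compiles_var.
- exact: compiles_one.
- exact: compiles_size.
- exact: compiles_bit.
- exact: compiles_add.
- exact: compiles_sub.
- exact: compiles_sum.
- exact: compiles_let.
- exact: compiles_wk.
Qed.

(* Register 0 holds the input size, 1 the number of bits written, 2 and 3 the
   counter and the index of the outer loop, 4 and 5 those of the inner loop, and
   6 the current bit. *)
Definition emit (M len bit : expr) : cmd :=
  CSeq (CScan 0) (CSeq (copy_reg 0 1) (CSeq (CLoop 1 (CB BInL))
  (CSeq (comp [::] 2 M)
  (CSeq (CLoop 2
    (CSeq (comp [:: 3] 4 len)
    (CSeq (CLoop 4 (CSeq (comp [:: 5; 3] 6 bit)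
       (CSeq (CB (BOut 6)) (CSeq (CB (BInc 1)) (CSeq (clear_reg 6 7) (CB (BInc 5)))))))
    (CSeq (clear_reg 5 7) (CB (BInc 3))))))
  (CLoop 1 (CB BOutL)))))).

Definition emitted (M len bit : expr) (w : seq bool) : seq bool :=
  flatten [seq [seq 0 < eval w [:: j; e] bit | j <- iota 0 (eval w [:: e] len)]
          | e <- iota 0 (eval w [::] M)].

Definition mkst (l : seq nat) (out : seq bool) : store :=
  Store (nth 0 l) 0%R out (size out).

Lemma mkst_eq s l out : (forall r, regs s r = nth 0 l r) -> ip s = 0%R ->
  outw s = out -> op s = size out -> s = mkst l out.
Proof. by move=> *; apply: store_eq. Qed.

Ltac msteq := apply: mkst_eq; [do 8?case=> //= | rewrite /=; try done; try lia
   | rewrite /=; try done | rewrite /=; try done; try lia].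

Lemma iota_rcons0 n : iota 0 n.+1 = rcons (iota 0 n) n.
Proof. by rewrite -addn1 iotaD cats1. Qed.

Ltac zr := let r := fresh "r" in let h := fresh "h" in
  move=> r h; rewrite /=; try (case: eqP => [?|_]; [lia|]); rewrite nth_default //=; lia.

(** [n1] bounds the variables of [len], where the row index is below [X], and [n2] those of [bit],
    where the column index is below [Y]. In the end everything is compared with powers of
    [n2.+2]. *)
Lemma emit_ok M len bit : exists k, forall w, exists s',
  [/\ runs w (emit M len bit) store0 ((size w).+2 ^ k) s',
      outw s' = emitted M len bit w & op s' = 0%R].
Proof.
have [kM HM] := comp_ok M; have [kl Hl] := comp_ok len; have [kb Hb] := comp_ok bit.
exists (60 + (kM + 2) * (kl + 2) * (kb + 2)) => w.
set n := size w; set X := n.+2 ^ kM; set n1 := n + X; set Y := n1.+2 ^ kl.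
set n2 := n1 + Y; set Z := n2.+2 ^ kb.
set m := eval w [::] M; pose ln e := eval w [:: e] len.
pose row e := [seq 0 < eval w [:: j; e] bit | j <- iota 0 (ln e)].
pose pref e := flatten [seq row i | i <- iota 0 e].
have l1 : runs w (CScan 0) store0 (n * 2 + 1)
    (Store (nth 0 [:: n]) n [::] 0%R).
  exists n.*2.+1; first by lia.
  have := @EvScan w 0 store0 erefl; congr (ev _ _ _ _ _).
  by apply: store_eq => //=; do 2?case=> //=.
have l2 := @runs_copy w 0 1 (Store (nth 0 [:: n]) n [::] 0%R) isT erefl.
have l3 : runs w (CLoop 1 (CB BInL)) (setr (Store (nth 0 [:: n]) n [::] 0%R) 1 n)
    (n * 3 + 1) (mkst [:: n] [::]).
  pose S j := Store (nth 0 [:: n; n - j]) (Posz n - Posz j)%R [::] 0%R.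
  have -> : setr (Store (nth 0 [:: n]) n [::] 0%R) 1 n = S 0.
    by apply: store_eq => //=; [do 3?case=> //=; rewrite subn0 | lia].
  have -> : mkst [:: n] [::] = S n.
    by apply: store_eq => //=; [do 3?case=> //=; rewrite subnn | lia].
  apply: (runs_loop (B := 1)) => j hj //.
  by apply: runs_basic => //; apply: store_eq => //=; [do 3?case=> //= | lia].
have [hM l4] : m <= X /\ runs w (comp [::] 2 M) (mkst [:: n] [::]) X (mkst [:: n; 0; m] [::]).
  have [|a b] := HM w n [::] [::] 2 (mkst [:: n] [::]).
    by split=> //=; zr.
  split=> //; apply: runs_weaken b _ _ => //; msteq.
pose S e := mkst [:: n; size (pref e); m - e; e] (pref e).
have hln e : e < m -> ln e <= Y.
  move=> he; have [|//] := Hl w n1 [:: 3] [:: e] 4 (S e).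
  split; rewrite //=; [by zr | split=> //=; rewrite /n1; lia].
have l5 : runs w (CLoop 2
    (CSeq (comp [:: 3] 4 len)
    (CSeq (CLoop 4 (CSeq (comp [:: 5; 3] 6 bit)
       (CSeq (CB (BOut 6)) (CSeq (CB (BInc 1)) (CSeq (clear_reg 6 7) (CB (BInc 5)))))))
    (CSeq (clear_reg 5 7) (CB (BInc 3)))))) (S 0)
    (m * ((Y * 4 + Y * (Z * 4 + 10) + 10) + 2) + 1) (S m).
  apply: runs_loop => e he //.
  have hl := hln e he.
  have a1 : runs w (comp [:: 3] 4 len) (setr (S e) 2 (m - e.+1)) Y
      (mkst [:: n; size (pref e); m - e.+1; e; ln e] (pref e)).
    have [|_ b] := Hl w n1 [:: 3] [:: e] 4 (setr (S e) 2 (m - e.+1)).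
      split; rewrite //=; [by zr | split=> //=; rewrite /n1; lia].
    by apply: runs_weaken b _ _ => //; msteq.
  pose ro j := pref e ++ [seq 0 < eval w [:: i; e] bit | i <- iota 0 j].
  pose S2 j := mkst [:: n; size (ro j); m - e.+1; e; ln e - j; j] (ro j).
  have a2 : runs w (CLoop 4 (CSeq (comp [:: 5; 3] 6 bit)
       (CSeq (CB (BOut 6)) (CSeq (CB (BInc 1)) (CSeq (clear_reg 6 7) (CB (BInc 5)))))))
       (S2 0) (ln e * ((Z * 4 + 8) + 2) + 1) (S2 (ln e)).
    apply: runs_loop => j hj //.
    set x := eval w [:: j; e] bit.
    have [hx b1] : x <= Z /\ runs w (comp [:: 5; 3] 6 bit) (setr (S2 j) 4 (ln e - j.+1)) Z
       (mkst [:: n; size (ro j); m - e.+1; e; ln e - j.+1; j; x] (ro j)).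
      have [|hx b] := Hb w n2 [:: 5; 3] [:: j; e] 6 (setr (S2 j) 4 (ln e - j.+1)).
        split; rewrite //=; [by zr | split=> //=; rewrite /n2 /n1; lia].
      by split=> //; apply: runs_weaken b _ _ => //; msteq.
    have b2 : runs w (CB (BOut 6))
       (mkst [:: n; size (ro j); m - e.+1; e; ln e - j.+1; j; x] (ro j)) 1
       (mkst [:: n; size (ro j); m - e.+1; e; ln e - j.+1; j; x] (ro j.+1)).
      apply: runs_basic => //=; apply: store_eq => //=.
        by rewrite /ro iota_rcons0 map_rcons rcons_cat.
      by rewrite /ro !size_cat !size_map !size_iota; lia.
    have b3 : runs w (CB (BInc 1))
       (mkst [:: n; size (ro j); m - e.+1; e; ln e - j.+1; j; x] (ro j.+1)) 1
       (mkst [:: n; size (ro j.+1); m - e.+1; e; ln e - j.+1; j; x] (ro j.+1)).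
      apply: runs_basic => //=; msteq.
      by rewrite /ro !size_cat !size_map !size_iota addnS.
    have b4 := @runs_clear w 6 7
       (mkst [:: n; size (ro j.+1); m - e.+1; e; ln e - j.+1; j; x] (ro j.+1)) isT erefl.
    have b5 : runs w (CB (BInc 5)) (setr
       (mkst [:: n; size (ro j.+1); m - e.+1; e; ln e - j.+1; j; x] (ro j.+1)) 6 0) 1 (S2 j.+1).
      by apply: runs_basic => //; msteq.
    apply: runs_weaken (runs_seq b1 (runs_seq b2 (runs_seq b3 (runs_seq b4 b5)))) _ _ => //=.
    by lia.
  have e2 : mkst [:: n; size (pref e); m - e.+1; e; ln e] (pref e) = S2 0.
    rewrite /S2 /ro /= cats0 subn0; msteq.
  have a3 := @runs_clear w 5 7 (S2 (ln e)) isT erefl.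
  have a4 : runs w (CB (BInc 3)) (setr (S2 (ln e)) 5 0) 1 (S e.+1).
    have ep : pref e.+1 = ro (ln e).
      by rewrite /pref iota_rcons0 map_rcons flatten_rcons.
    by apply: runs_basic => //; rewrite /S ep; msteq; rewrite subnn.
  rewrite e2 in a1.
  apply: runs_weaken (runs_seq a1 (runs_seq a2 (runs_seq a3 a4))) _ _ => //=.
  have : ln e * ((Z * 4 + 8) + 2) <= Y * (Z * 4 + 10) by rewrite -addnA leq_mul2r hl orbT.
  by lia.
set tot := size (pref m).
(* The output of a machine is read from the head rightwards, so the head returns to the first bit;
   register 1 has counted the bits. *)
have l6 : runs w (CLoop 1 (CB BOutL)) (S m) (tot * 3 + 1)
   (Store (nth 0 [:: n; 0; 0; m]) 0%R (pref m) 0%R).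
  pose S3 j := Store (nth 0 [:: n; tot - j; 0; m]) 0%R (pref m) (Posz tot - Posz j)%R.
  have -> : S m = S3 0.
    by apply: store_eq => //=; [do 4?case=> //=; rewrite ?subn0 ?subnn | rewrite /tot; lia].
  have -> : Store (nth 0 [:: n; 0; 0; m]) 0%R (pref m) 0%R = S3 tot.
    by apply: store_eq => //=; [do 4?case=> //=; rewrite ?subn0 ?subnn | rewrite /tot; lia].
  apply: (runs_loop (B := 1)) => j hj //.
  by apply: runs_basic => //; apply: store_eq => //=; [do 4?case=> //= | lia].
have htot : tot <= m * Y.
  rewrite /tot /pref size_flatten /shape -map_comp sumnE big_map.
  rewrite -[m in X in _ <= X]subn0 -sum_nat_const_nat /index_iota subn0.
  rewrite !big_seq; apply: leq_sum => e; rewrite mem_iota /= add0n => he.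
  by rewrite size_map size_iota hln.
have e0 : mkst [:: n; 0; m] [::] = S 0 by rewrite /S subn0; msteq.
rewrite e0 in l4.
exists (Store (nth 0 [:: n; 0; 0; m]) 0%R (pref m) 0%R); split=> //.
apply: runs_weaken (runs_seq l1 (runs_seq l2 (runs_seq l3 (runs_seq l4 (runs_seq l5 l6))))) _ _ => //=.
set P := n2.+2.
have hP : P ^ (kb + 2) <= n.+2 ^ ((kM + 2) * (kl + 2) * (kb + 2)).
  rewrite expnM leq_exp2r; last by lia.
  have := expX_comp n kM 1; have := expX_comp n1 kl 1.
  rewrite !expn1 !muln1 -/X -/n1 -/Y -/n2 -/P => h1 h2.
  by apply: leq_trans h1 _; rewrite expnM leq_exp2r ?addn_gt0 ?orbT.
have := expX_lin 60 n ((kM + 2) * (kl + 2) * (kb + 2)); apply: leq_trans.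
apply: leq_trans (_ : 60 * P ^ (kb + 2) <= _); last by rewrite leq_mul2l hP orbT.
rewrite expnD -/Z expnS expn1.
have Z1 : 0 < Z by rewrite expn_gt0.
have hXP : X <= P by rewrite /P /n2 /n1; lia.
have hYP : Y <= P by rewrite /P /n2; lia.
have hnP : n <= P by rewrite /P /n2 /n1; lia.
have P1 : 0 < P by [].
have hmP : m <= P by apply: leq_trans hM hXP.
have c1 : m * Y <= P * P by apply: leq_mul.
have c2 : m * (Y * Z) <= P * (P * Z) by apply: leq_mul => //; rewrite leq_mul2r hYP orbT.
have c3 : P * P <= Z * (P * P) by rewrite leq_pmull.
have c4 : P <= P * P by rewrite leq_pmull.
have -> : m * (Y * 4 + Y * (Z * 4 + 10) + 10 + 2) =
  14 * (m * Y) + 4 * (m * (Y * Z)) + 12 * m by nia.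
have c5 : P * (P * Z) = Z * (P * P) by nia.
lia.
Qed.

Lemma emitted_polytime M len bit : polytime (emitted M len bit).
Proof.
have [k H] := emit_ok M len bit.
apply: (@cmd_polytime (emit M len bit) _ k) => w.
by have [s' [[t ht hev] ho hop]] := H w; exists t, s'.
Qed.

(** * Functions given by arithmetic expressions, and their closure properties *)

Definition Ex (F : seq bool -> seq nat -> nat) : Prop :=
  exists e, forall w v, eval w v e = F w v.

Lemma Ex_ext F G : (forall w v, F w v = G w v) -> Ex F -> Ex G.
Proof. by move=> h [e he]; exists e => w v; rewrite he h. Qed.

Lemma Ex_var i : Ex (fun _ v => nth 0 v i).
Proof. by exists (EVar i). Qed.

Lemma Ex_wk F : Ex F -> Ex (fun w v => F w (behead v)).
Proof. by move=> [e he]; exists (EWk e) => w v /=; rewrite he. Qed.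

Lemma Ex_let F G : Ex F -> Ex G -> Ex (fun w v => G w (F w v :: v)).
Proof.
by move=> [e he] [f hf]; exists (ELet e f) => w v /=; rewrite hf he.
Qed.

Lemma Ex_add F G : Ex F -> Ex G -> Ex (fun w v => F w v + G w v).
Proof. by move=> [e he] [f hf]; exists (EAdd e f) => w v /=; rewrite he hf. Qed.

Lemma Ex_sub F G : Ex F -> Ex G -> Ex (fun w v => F w v - G w v).
Proof. by move=> [e he] [f hf]; exists (ESub e f) => w v /=; rewrite he hf. Qed.

Lemma Ex_const n : Ex (fun _ _ => n).
Proof.
elim: n => [|n [e he]]; first by exists (ESub EOne EOne).
by exists (EAdd EOne e) => w v /=; rewrite he.
Qed.

Lemma Ex_size : Ex (fun w _ => size w).
Proof. by exists ESize. Qed.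

Lemma Ex_bit F : Ex F -> Ex (fun w v => nth false w (F w v)).
Proof. by move=> [e he]; exists (EBit e) => w v /=; rewrite he. Qed.

Lemma Ex_sum F (G : seq bool -> seq nat -> nat -> nat) : Ex F ->
  Ex (fun w v => G w (behead v) (head 0 v)) ->
  Ex (fun w v => \sum_(i < F w v) G w v i).
Proof.
move=> [e he] [f hf]; exists (ESum e f) => w v /=; rewrite he.
by apply: eq_bigr => i _; rewrite hf.
Qed.

Lemma Ex_mul F G : Ex F -> Ex G -> Ex (fun w v => F w v * G w v).
Proof.
move=> hF hG.
have := @Ex_sum F (fun w v _ => G w v) hF (Ex_wk hG); apply: Ex_ext => w v.
by rewrite sum_nat_const card_ord.
Qed.

Lemma Ex_leq F G : Ex F -> Ex G -> Ex (fun w v => F w v <= G w v).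
Proof.
move=> hF hG.
have := Ex_sub (Ex_const 1) (Ex_sub hF hG); apply: Ex_ext => w v.
by rewrite /leq; case: (F w v - G w v) => // n; rewrite subn_eq0.
Qed.

Lemma Ex_and (P Q : seq bool -> seq nat -> bool) :
  Ex (fun w v => P w v) -> Ex (fun w v => Q w v) -> Ex (fun w v => P w v && Q w v).
Proof.
move=> hP hQ; have := Ex_mul hP hQ; apply: Ex_ext => w v.
by rewrite mulnb.
Qed.

Lemma Ex_neg (P : seq bool -> seq nat -> bool) :
  Ex (fun w v => P w v) -> Ex (fun w v => ~~ P w v).
Proof.
by move=> hP; have := Ex_sub (Ex_const 1) hP; apply: Ex_ext => w v; case: (P w v).
Qed.

Lemma Ex_or (P Q : seq bool -> seq nat -> bool) :
  Ex (fun w v => P w v) -> Ex (fun w v => Q w v) -> Ex (fun w v => P w v || Q w v).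
Proof.
move=> hP hQ; have := Ex_neg (Ex_and (Ex_neg hP) (Ex_neg hQ)); apply: Ex_ext => w v.
by rewrite negb_and !negbK.
Qed.

Lemma Ex_eq F G : Ex F -> Ex G -> Ex (fun w v => F w v == G w v).
Proof.
move=> hF hG; have := Ex_and (Ex_leq hF hG) (Ex_leq hG hF); apply: Ex_ext => w v.
by rewrite eqn_leq.
Qed.

Lemma Ex_if (P : seq bool -> seq nat -> bool) F G :
  Ex (fun w v => P w v) -> Ex F -> Ex G ->
  Ex (fun w v => if P w v then F w v else G w v).
Proof.
move=> hP hF hG; have := Ex_add (Ex_mul hP hF) (Ex_mul (Ex_neg hP) hG).
by apply: Ex_ext => w v; case: (P w v); rewrite /= ?mul1n ?mul0n ?addn0.
Qed.

Lemma Ex_ifb (P Q R : seq bool -> seq nat -> bool) :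
  Ex (fun w v => P w v) -> Ex (fun w v => Q w v) -> Ex (fun w v => R w v) ->
  Ex (fun w v => if P w v then Q w v else R w v).
Proof.
by move=> hP hF hG; have := Ex_if hP hF hG; apply: Ex_ext => w v; case: (P w v).
Qed.

Lemma Ex_all F (P : seq bool -> seq nat -> nat -> bool) : Ex F ->
  Ex (fun w v => P w (behead v) (head 0 v)) ->
  Ex (fun w v => all (P w v) (iota 0 (F w v))).
Proof.
move=> hF hP.
have := @Ex_sum F (fun w v i => ~~ P w v i) hF (Ex_neg hP) => h.
have := Ex_eq h (Ex_const 0); apply: Ex_ext => w v; congr nat_of_bool.
rewrite sum_nat_eq0; apply/forallP/allP => [H i|H i].
  rewrite mem_iota add0n => /= hi.
  by have := H (Ordinal hi); rewrite /= eqb0 negbK.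
by rewrite /= eqb0 negbK; apply: H; rewrite mem_iota /=.
Qed.

Lemma sum_ltn n m : \sum_(i < n) (i < m) = minn n m.
Proof.
elim: n => [|n IH]; first by rewrite big_ord0 min0n.
by rewrite big_ord_recr /= IH; case: ltnP; lia.
Qed.

(** The quotient is the number of [i] with [i.+1 * G <= F]; the second condition makes it 0 for a
    zero divisor. *)
Lemma Ex_div F G : Ex F -> Ex G -> Ex (fun w v => F w v %/ G w v).
Proof.
move=> hF hG.
have h : Ex (fun w v => \sum_(i < F w v) ((i.+1 * G w v <= F w v) && (0 < G w v))).
  apply: (@Ex_sum F (fun w v i => (i.+1 * G w v <= F w v) && (0 < G w v))) => //.
  apply: Ex_and; last by apply: Ex_leq (Ex_const 1) (Ex_wk hG).
  apply: Ex_leq (Ex_wk hF); apply: Ex_mul (Ex_wk hG).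
  apply: Ex_ext (Ex_add (Ex_var 0) (Ex_const 1)) => w v.
  by rewrite addn1 nth0.
apply: Ex_ext h => w v; case: (posnP (G w v)) => [->|hp].
  by rewrite divn0 big1 // => i _; rewrite andbF.
rewrite -[RHS](minn_idPr (leq_div (F w v) (G w v))) -sum_ltn.
by apply: eq_bigr => i _; rewrite andbT leq_divRL.
Qed.

Lemma Ex_mod F G : Ex F -> Ex G -> Ex (fun w v => F w v %% G w v).
Proof.
move=> hF hG; have := Ex_sub hF (Ex_mul (Ex_div hF hG) hG); apply: Ex_ext => w v.
by rewrite {1}(divn_eq (F w v) (G w v)) addKn.
Qed.

Lemma Ex_odd F : Ex F -> Ex (fun w v => odd (F w v)).
Proof.
by move=> hF; have := Ex_mod hF (Ex_const 2); apply: Ex_ext => w v; rewrite modn2.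
Qed.

Lemma Ex_S F : Ex F -> Ex (fun w v => (F w v).+1).
Proof. by move=> hF; apply: Ex_ext (Ex_add hF (Ex_const 1)) => w v; rewrite addn1. Qed.

Lemma Ex_pred F : Ex F -> Ex (fun w v => (F w v).-1).
Proof. by move=> hF; apply: Ex_ext (Ex_sub hF (Ex_const 1)) => w v; rewrite subn1. Qed.

Lemma Ex_head : Ex (fun _ v => head 0 v).
Proof. by apply: Ex_ext (Ex_var 0) => w v; rewrite nth0. Qed.

Lemma Ex_comp1 (g : nat -> nat) F : Ex (fun _ v => g (head 0 v)) -> Ex F ->
  Ex (fun w v => g (F w v)).
Proof. by move=> hg hF; have := Ex_let hF hg. Qed.

Lemma Ex_comp2 (g : nat -> nat -> nat) F1 F2 :
  Ex (fun _ v => g (head 0 v) (head 0 (behead v))) -> Ex F1 -> Ex F2 ->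
  Ex (fun w v => g (F1 w v) (F2 w v)).
Proof. by move=> hg h1 h2; have := Ex_let h2 (Ex_let (Ex_wk h1) hg). Qed.

Lemma Ex_table (g : nat -> nat) m F : Ex F ->
  Ex (fun w v => if F w v < m then g (F w v) else 0).
Proof.
move=> hF; elim: m => [|m IH]; first exact: Ex_const.
apply: Ex_ext (Ex_if (Ex_eq hF (Ex_const m)) (Ex_const (g m)) IH) => w v.
by case: ltngtP => h; rewrite ltnS ?(ltnW h) // ?h ?leqnn // leqNgt h.
Qed.

Lemma Ex_poly (p : {poly nat}) F : Ex F -> Ex (fun w v => p.[F w v]%R).
Proof.
move=> hF; rewrite /horner; elim: (polyseq p) => [|a s IH] /=; first exact: Ex_const.
exact: Ex_add (Ex_mul IH hF) (Ex_const a).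
Qed.

(** * Binary numerals *)

(** Expressions have polynomially bounded values, so powers cannot be formed, only recognised: a
    power of two is a positive number without odd divisors other than 1. The logarithm of [v] then
    counts the powers of two in the interval from 2 to [v]. *)
Definition pow2 (x : nat) : bool :=
  (0 < x) && all (fun d => (x %% d == 0) ==> (d == 1) || ~~ odd d) (iota 0 x.+1).

Lemma pow2P x : reflect (exists k, x = 2 ^ k) (pow2 x).
Proof.
apply: (iffP andP) => [[x0 /allP h]|[k ->]].
  have : 2.-nat x.
    apply/pnatP => // p pp px.
    have := h p; rewrite mem_iota /= ltnS dvdn_leq // => /(_ isT).
    rewrite (eqnP px) /=; case/orP => [/eqP p1|]; first by rewrite p1 in pp.
    by case: (even_prime pp) => [->|->].
  by case/p_natP => k ->; exists k.
split; first by rewrite expn_gt0.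
apply/allP => d _; apply/implyP => hd; have {}hd : d %| 2 ^ k by [].
have /(dvdn_pfactor _ _ (isT : prime 2))[k' _ ->] := hd.
by case: k' => // k'; rewrite oddX orbT.
Qed.

Lemma Ex_pow2 : Ex (fun _ v => pow2 (head 0 v)).
Proof.
apply: Ex_and; first exact: Ex_leq (Ex_const 1) Ex_head.
apply: (@Ex_all (fun _ v => (head 0 v).+1)
  (fun _ v d => (head 0 v %% d == 0) ==> (d == 1) || ~~ odd d)).
  exact: Ex_S Ex_head.
have h := Ex_wk Ex_head.
apply: Ex_ext (Ex_or (Ex_neg (Ex_eq (Ex_mod h Ex_head) (Ex_const 0)))
  (Ex_or (Ex_eq Ex_head (Ex_const 1)) (Ex_neg (Ex_odd Ex_head)))) => w v.
by rewrite implybE.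
Qed.

Lemma trunc_log_sum v : trunc_log 2 v = \sum_(x < v.+1) (pow2 x && (1 < x)).
Proof.
elim: v => [|v IH]; first by rewrite big_ord_recr big_ord0 trunc_log0.
rewrite big_ord_recr /= -IH; case: v {IH} => [|v]; first by rewrite andbF !trunc_log1.
set t := trunc_log 2 v.+1.
have /andP[h1 h2] := trunc_log_bounds (isT : 1 < 2) (isT : 0 < v.+1).
rewrite -/t in h1 h2; rewrite /= andbT.
case: pow2P => [[k hk]|hn].
  have lt : t < k by rewrite -(ltn_exp2l _ _ (isT : 1 < 2)) -hk.
  rewrite hk trunc_expnK //; apply/eqP; rewrite eqn_leq addn1 lt andbT.
  by rewrite -(leq_exp2l _ _ (isT : 1 < 2)) -hk.
rewrite addn0; apply: trunc_log_eq => //; apply/andP; split; first exact: leqW.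
by rewrite ltn_neqAle h2 andbT; apply/eqP => e; apply: hn; exists t.+1.
Qed.

Lemma Ex_trunc_log : Ex (fun _ v => trunc_log 2 (head 0 v)).
Proof.
have h : Ex (fun _ v => \sum_(x < (head 0 v).+1) (pow2 x && (1 < x))).
  apply: (@Ex_sum (fun _ v => (head 0 v).+1) (fun _ _ x => pow2 x && (1 < x))).
    exact: Ex_S Ex_head.
  exact: Ex_and Ex_pow2 (Ex_leq (Ex_const 2) Ex_head).
by apply: Ex_ext h => w v; rewrite trunc_log_sum.
Qed.

(** At most one [x] up to [v] is the power of two with exponent [i], so the sum has at most one
    nonzero term, the bit of [v] at [i]. *)
Definition binbit (v i : nat) : bool :=
  0 < \sum_(x < v.+1) (pow2 x && (trunc_log 2 x == i)) * odd (v %/ x).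

Lemma binbitE v i : i <= trunc_log 2 v -> binbit v i = odd (v %/ 2 ^ i).
Proof.
rewrite /binbit; case: v => [|v] hi.
  by rewrite div0n big_ord_recr big_ord0.
have hv : 2 ^ i < v.+2.
  rewrite ltnS; apply: leq_trans (_ : 2 ^ trunc_log 2 v.+1 <= _); last exact: trunc_logP.
  by rewrite leq_exp2l.
rewrite (bigD1 (Ordinal hv)) //= trunc_expnK // eqxx.
have -> /= : pow2 (2 ^ i) by apply/pow2P; exists i.
rewrite big1 ?addn0 ?mul1n; first by case: odd.
move=> x /eqP hx; case: pow2P => //= -[k hk]; case: eqP => // e; case: hx.
by apply: val_inj => /=; rewrite hk; move: e; rewrite hk trunc_expnK // => ->.
Qed.

Lemma Ex_binbit : Ex (fun _ v => binbit (head 0 v) (head 0 (behead v))).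
Proof.
apply: Ex_leq (Ex_const 1) _.
apply: (@Ex_sum (fun _ v => (head 0 v).+1) (fun _ v x =>
  (pow2 x && (trunc_log 2 x == head 0 (behead v))) * odd (head 0 v %/ x))).
  exact: Ex_S Ex_head.
apply: Ex_mul.
  apply: Ex_and; first exact: Ex_pow2.
  exact: Ex_eq Ex_trunc_log (Ex_wk (Ex_wk Ex_head)).
exact: Ex_odd (Ex_div (Ex_wk Ex_head) Ex_head).
Qed.

Definition numlen (m : nat) : nat := (trunc_log 2 m).+1 * 2 + 1.

Definition numbit (m j : nat) : bool :=
  if j == (trunc_log 2 m).+1 * 2 then false
  else if odd j then binbit m (j %/ 2) else true.

Lemma delimitE w : delimit w = [seq if j == size w * 2 then false
  else if odd j then nth false w (j %/ 2) else true | j <- iota 0 (size w * 2 + 1)].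
Proof.
rewrite /delimit; elim: w => [|b w IH] //=.
rewrite IH; congr [:: _, _ & _].
have -> : iota 2 (size w * 2 + 1) = [seq 2 + j | j <- iota 0 (size w * 2 + 1)].
  by rewrite -iotaDl.
rewrite -map_comp; apply: eq_map => j /=.
have -> : (2 + j == (size w).+1 * 2) = (j == size w * 2) by lia.
by rewrite /= negbK divnDl // divnn.
Qed.

Lemma delimit_binary m :
  delimit (binary m) = [seq numbit m j | j <- iota 0 (numlen m)].
Proof.
rewrite delimitE size_mkseq /numlen; apply/eq_in_map => j.
rewrite mem_iota /= add0n addn1 ltnS /numbit => hj; case: eqP => // hne.
case: ifP => // ho.
have hd : j %/ 2 < (trunc_log 2 m).+1 by rewrite ltn_divLR //; lia.
by rewrite nth_mkseq // binbitE.
Qed.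

Lemma Ex_numlen : Ex (fun _ v => numlen (head 0 v)).
Proof.
exact: Ex_add (Ex_mul (Ex_S Ex_trunc_log) (Ex_const 2)) (Ex_const 1).
Qed.

Lemma Ex_numbit : Ex (fun _ v => numbit (head 0 v) (head 0 (behead v))).
Proof.
have h1 := Ex_wk Ex_head.
apply: Ex_ifb; first exact: Ex_eq h1 (Ex_mul (Ex_S Ex_trunc_log) (Ex_const 2)).
  exact: Ex_const 0.
apply: Ex_ifb; [exact: Ex_odd | | exact: Ex_const 1].
apply: (Ex_comp2 (g := fun a b => binbit a b)) => //.
- exact: Ex_binbit.
- exact: Ex_head.
- exact: Ex_div h1 (Ex_const 2).
Qed.

Lemma polytime_ext f g : f =1 g -> polytime f -> polytime g.
Proof. by move=> h [M [p H]]; exists M, p => w; rewrite -h. Qed.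

Definition encode_numbers (s : seq nat) : seq bool :=
  flatten [seq delimit (binary m) | m <- s].

Lemma numbers_polytime (cnt : seq bool -> nat) (ent : seq bool -> nat -> nat) :
  Ex (fun w _ => cnt w) -> Ex (fun w v => ent w (head 0 v)) ->
  polytime (fun w => encode_numbers [seq ent w e | e <- iota 0 (cnt w)]).
Proof.
move=> [M hM] he.
have [len hl] : Ex (fun w v => numlen (ent w (head 0 v))).
  exact: (Ex_comp1 (g := numlen) Ex_numlen).
have [bit hb] : Ex (fun w v => numbit (ent w (head 0 (behead v))) (head 0 v)).
  exact: (Ex_comp2 (g := fun a b => numbit a b) Ex_numbit (Ex_wk he) Ex_head).
apply: polytime_ext (emitted_polytime M len bit) => w.
rewrite /emitted hM /encode_numbers -map_comp; congr flatten.
apply: eq_map => e; rewrite [RHS]delimit_binary hl [head _ _]/=; apply: eq_map => j.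
by rewrite hb /=; case: numbit.
Qed.

Lemma decision_polytime (P : seq bool -> bool) :
  Ex (fun w _ => P w) -> polytime (fun w => [:: P w]).
Proof.
(* The output is one row of one bit; the two weakenings discard the indices of the bit and of the
   row. *)
move=> [e he]; apply: polytime_ext (emitted_polytime EOne EOne (EWk (EWk e))) => w.
by rewrite /emitted /= he; case: (P w).
Qed.

(** * Dominoes and pairs of disjoint 0-1 matrices *)

Definition covers (i j k a b : nat) : bool :=
  if k == 0 then (a == i) && ((b == j) || (b == j.+1))
  else (b == j) && ((a == i) || (a == i.+1)).

Lemma placedP n (x : 'I_n * 'I_n * 'I_2) (z : cell) :
  z \in placed dominoes x <->
  exists a b : nat, z = (Posz a, Posz b) /\ covers x.1.1 x.1.2 x.2 a b.
Proof.
case: x => -[i j] k; rewrite /placed /translate /covers /=.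
have -> : tnth dominoes k = if k == 0 :> nat then horizontal_domino else vertical_domino.
  by case: k => -[|[|k]] hk; rewrite (tnth_nth horizontal_domino).
case: ifP => _; split.
- move=> /imfsetP[/= y]; rewrite !inE => /orP[] /eqP -> -> /=.
    by exists i, j; rewrite !addr0 !eqxx.
  by exists i, j.+1; rewrite addr0 !eqxx orbT; split=> //; congr (_, _); lia.
- move=> [a [b [-> /andP[/eqP -> /orP[] /eqP ->]]]]; apply/imfsetP => /=.
    by exists (0, 0)%R; rewrite ?inE ?eqxx //= !addr0.
  by exists (0, 1)%R; rewrite ?inE ?eqxx ?orbT //= !addr0; congr (_, _); lia.
- move=> /imfsetP[/= y]; rewrite !inE => /orP[] /eqP -> -> /=.
    by exists i, j; rewrite !addr0 !eqxx.
  by exists i.+1, j; rewrite addr0 !eqxx orbT; split=> //; congr (_, _); lia.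
- move=> [a [b [-> /andP[/eqP -> /orP[] /eqP ->]]]]; apply/imfsetP => /=.
    by exists (0, 0)%R; rewrite ?inE ?eqxx //= !addr0.
  by exists (1, 0)%R; rewrite ?inE ?eqxx ?orbT //= !addr0; congr (_, _); lia.
Qed.

Lemma tilingP n (T : {set 'I_n * 'I_n * 'I_2}) :
  is_tiling dominoes T <->
  (forall x a b, x \in T -> covers x.1.1 x.1.2 x.2 a b -> (a < n) && (b < n)) /\
  (forall x y a b, x \in T -> y \in T -> covers x.1.1 x.1.2 x.2 a b ->
     covers y.1.1 y.1.2 y.2 a b -> x = y).
Proof.
split=> -[h1 h2]; split.
- move=> x a b xT hc.
  have /(h1 x xT)[/= ha hb] : (Posz a, Posz b) \in placed dominoes x.
    by apply/placedP; exists a, b.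
  by lia.
- move=> x y a b xT yT hx hy; case: (eqVneq x y) => // /eqP ne.
  have /fdisjointP/(_ (Posz a, Posz b)) := h2 x y xT yT ne.
  have -> : (Posz a, Posz b) \in placed dominoes x by apply/placedP; exists a, b.
  have -> : (Posz a, Posz b) \in placed dominoes y by apply/placedP; exists a, b.
  by move=> /(_ isT).
- move=> x xT z /placedP[a [b [-> hc]]].
  by have := h1 x a b xT hc; rewrite /in_grid /=; lia.
- move=> x y xT yT ne; apply/fdisjointP => z /placedP[a [b [-> hx]]].
  apply/negP => /placedP[a' [b' [[<- <-] hy]]].
  exact: ne (h2 x y a b xT yT hx hy).
Qed.

(** Disjointness is tested cell by cell: a cell can be covered by the two dominoes centred there, by
    the horizontal one centred on its left and by the vertical one centred above. This local form is
    what a verifier evaluates. *)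
Definition valid_tiling (n : nat) (B : nat -> nat -> nat -> bool) : Prop :=
  forall i j, i < n -> j < n ->
  [/\ B i j 0 -> j.+1 < n, B i j 1 -> i.+1 < n &
     B i j 0 + B i j 1 + ((0 < j) && B i j.-1 0) + ((0 < i) && B i.-1 j 1) <= 1].

Definition memT n (T : {set 'I_n * 'I_n * 'I_2}) (i j k : nat) : bool :=
  [exists x in T, [&& x.1.1 == i :> nat, x.1.2 == j :> nat & x.2 == k :> nat]].

Lemma memTE n (T : {set 'I_n * 'I_n * 'I_2}) (i j : 'I_n) (k : 'I_2) :
  memT T i j k = ((i, j, k) \in T).
Proof.
apply/exists_inP/idP => [[[[i' j'] k'] h /= /and3P[]]|h].
  by move=> /eqP/val_inj <- /eqP/val_inj <- /eqP/val_inj <-.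
by exists (i, j, k); rewrite //= !eqxx.
Qed.

Lemma memT_ex n (T : {set 'I_n * 'I_n * 'I_2}) i j k : memT T i j k ->
  exists2 x, x \in T & [/\ x.1.1 = i :> nat, x.1.2 = j :> nat & x.2 = k :> nat].
Proof.
by move=> /exists_inP[x xT /and3P[/eqP h1 /eqP h2 /eqP h3]]; exists x.
Qed.

Lemma valid_memT n (T : {set 'I_n * 'I_n * 'I_2}) :
  is_tiling dominoes T -> valid_tiling n (memT T).
Proof.
move=> /tilingP[h1 h2] i j hi hj; split.
- move=> /memT_ex[x xT [e1 e2 e3]].
  have := h1 x i j.+1 xT; rewrite /covers e1 e2 e3 /= !eqxx orbT => /(_ isT).
  by case/andP.
- move=> /memT_ex[x xT [e1 e2 e3]].
  have := h1 x i.+1 j xT; rewrite /covers e1 e2 e3 /= !eqxx orbT => /(_ isT).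
  by case/andP.
have key p q : memT T p.1.1 p.1.2 p.2 -> memT T q.1.1 q.1.2 q.2 ->
    covers p.1.1 p.1.2 p.2 i j -> covers q.1.1 q.1.2 q.2 i j -> p = q.
  move=> /memT_ex[x xT [e1 e2 e3]] /memT_ex[y yT [f1 f2 f3]] hp hq.
  have exy : x = y by apply: (h2 x y i j) => //; rewrite ?e1 ?e2 ?e3 ?f1 ?f2 ?f3.
  move: e1 e2 e3; rewrite exy f1 f2 f3.
  by case: (p) => -[a b] c; case: (q) => -[a' b'] c' /= -> -> ->.
have c1 : covers i j 0 i j by rewrite /covers /= !eqxx.
have c2 : covers i j 1 i j by rewrite /covers /= !eqxx.
have c3 : 0 < j -> covers i j.-1 0 i j by move=> j0; rewrite /covers /= prednK // !eqxx orbT.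
have c4 : 0 < i -> covers i.-1 j 1 i j by move=> i0; rewrite /covers /= prednK // !eqxx orbT.
case b1: (memT T i j 0); case b2: (memT T i j 1);
  case b3: ((0 < j) && memT T i j.-1 0); case b4: ((0 < i) && memT T i.-1 j 1) => //;
  exfalso; try move/andP: b3 => [j0 b3]; try move/andP: b4 => [i0 b4].
all: try (by have := key (i, j, 0) (i, j, 1) b1 b2 c1 c2).
all: try (have [] := key (i, j, 0) (i, j.-1, 0) b1 b3 c1 (c3 j0); lia).
all: try (by have := key (i, j, 0) (i.-1, j, 1) b1 b4 c1 (c4 i0)).
all: try (by have := key (i, j, 1) (i, j.-1, 0) b2 b3 c2 (c3 j0)).
all: try (have [] := key (i, j, 1) (i.-1, j, 1) b2 b4 c2 (c4 i0); lia).
all: try (by have := key (i, j.-1, 0) (i.-1, j, 1) b3 b4 (c3 j0) (c4 i0)).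
Qed.

Definition setB n (B : nat -> nat -> nat -> bool) : {set 'I_n * 'I_n * 'I_2} :=
  [set x : 'I_n * 'I_n * 'I_2 | B x.1.1 x.1.2 x.2].

Lemma tiling_setB n B : valid_tiling n B -> is_tiling dominoes (setB n B).
Proof.
move=> hB; apply/tilingP.
have bnd (x : 'I_n * 'I_n * 'I_2) a b : x \in setB n B ->
    covers x.1.1 x.1.2 x.2 a b -> (a < n) && (b < n).
  case: x => -[i j] k; rewrite inE /covers /= => hb.
  have [q1 q2 _] := hB i j (ltn_ord i) (ltn_ord j).
  case: k hb => -[|[|k]] //= _ hb /andP[/eqP-> /orP[]/eqP->]; rewrite !ltn_ord //=.
  - exact: q1.
  - by rewrite andbT; exact: q2.
split=> // x y a b xT yT hx hy.
have /andP[ha hb] := bnd x a b xT hx.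
have [_ _] := hB a b ha hb.
have pos (z : 'I_n * 'I_n * 'I_2) : z \in setB n B -> covers z.1.1 z.1.2 z.2 a b ->
   [\/ [/\ (z.1.1 : nat) = a, (z.1.2 : nat) = b, (z.2 : nat) = 0 & B a b 0],
       [/\ (z.1.1 : nat) = a, (z.1.2 : nat) = b, (z.2 : nat) = 1 & B a b 1],
       [/\ (z.1.1 : nat) = a, (z.1.2 : nat) = b.-1, (z.2 : nat) = 0 & (0 < b) && B a b.-1 0] |
       [/\ (z.1.1 : nat) = a.-1, (z.1.2 : nat) = b, (z.2 : nat) = 1 & (0 < a) && B a.-1 b 1]].
  case: z => -[i j] k; rewrite inE /covers /=.
  case: k => -[|[|k]] //= _ hbb /andP[/eqP ea /orP[]/eqP eb]; subst a b.
  + by constructor 1.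
  + by constructor 3.
  + by constructor 2.
  + by constructor 4.
have ext (z z' : 'I_n * 'I_n * 'I_2) : (z.1.1 : nat) = z'.1.1 ->
   (z.1.2 : nat) = z'.1.2 -> (z.2 : nat) = z'.2 -> z = z'.
  by case: z => -[i j] k; case: z' => -[i' j'] k' /= /val_inj -> /val_inj -> /val_inj ->.
case: (pos x xT hx) => -[a1 a2 a3 a4]; case: (pos y yT hy) => -[b1 b2 b3 b4];
 move=> hh; try (by apply: ext; rewrite ?a1 ?a2 ?a3 ?b1 ?b2 ?b3);
 exfalso; move: hh a4 b4; clear; case: (B a b 0); case: (B a b 1);
 case: (_ && _); by case: (_ && _).
Qed.

Lemma row_projectionE n (T : {set 'I_n * 'I_n * 'I_2}) i k :
  row_projection T i k = \sum_(j < n) memT T i j k.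
Proof.
rewrite mxE -sum1_card big_mkcond /=; apply: eq_bigr => j _.
by rewrite inE memTE; case: (_ \in T).
Qed.

Lemma col_projectionE n (T : {set 'I_n * 'I_n * 'I_2}) j k :
  col_projection T j k = \sum_(i < n) memT T i j k.
Proof.
rewrite mxE -sum1_card big_mkcond /=; apply: eq_bigr => i _.
by rewrite inE memTE; case: (_ \in T).
Qed.

Lemma consistentP n (r c : 'M[nat]_(n, 2)) :
  consistent dominoes (Instance r c) <->
  exists B, [/\ valid_tiling n B,
    forall (i : 'I_n) (k : 'I_2), \sum_(j < n) B i j k = r i k &
    forall (j : 'I_n) (k : 'I_2), \sum_(i < n) B i j k = c j k].
Proof.
split=> [[T /= [hT hr hc]]|[B [hB hr hc]]].
  exists (memT T); split; first exact: valid_memT.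
    by move=> i k; rewrite -hr row_projectionE.
  by move=> j k; rewrite -hc col_projectionE.
have mE (i j : 'I_n) (k : 'I_2) : memT (setB n B) i j k = B i j k.
  by rewrite memTE inE.
exists (setB n B); split; first exact: tiling_setB.
- apply/matrixP => i k; rewrite row_projectionE -hr.
  by apply: eq_bigr => j _; rewrite mE.
- apply/matrixP => j k; rewrite col_projectionE -hc.
  by apply: eq_bigr => i _; rewrite mE.
Qed.

Definition block_margin (f g : nat -> nat) (i k : nat) : nat :=
  if odd i then 0 else if k == 0 then f i./2 else g i./2.

Lemma sum_even (F : nat -> nat) m : (forall j, odd j -> F j = 0) ->
  \sum_(j < m.*2) F j = \sum_(j < m) F j.*2.
Proof.
move=> h; elim: m => [|m IH]; first by rewrite !big_ord0.
by rewrite doubleS !big_ord_recr /= IH (h m.*2.+1) /= ?odd_double // addn0.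
Qed.

Lemma sum_nat_eq0_lt (F : nat -> bool) n j :
  \sum_(i < n) F i = 0 -> j < n -> F j = false.
Proof.
move=> /eqP; rewrite sum_nat_eq0 => /forallP h hj.
by have := h (Ordinal hj); rewrite /= eqb0 => /negbTE.
Qed.

Definition two_matrices (m : nat) (RH RV CH CV : nat -> nat) : Prop :=
  exists h v : nat -> nat -> bool,
  [/\ forall i j, i < m -> j < m -> ~~ (h i j && v i j),
      forall i, i < m -> \sum_(j < m) h i j = RH i,
      forall i, i < m -> \sum_(j < m) v i j = RV i,
      forall j, j < m -> \sum_(i < m) h i j = CH j &
      forall j, j < m -> \sum_(i < m) v i j = CV j].

(* Horizontal and vertical dominoes are only allowed at even rows and columns,
   hence each of them stays inside its aligned 2x2 block. *)
Lemma block_consistent m RH RV CH CV :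
  consistent dominoes
    (Instance (\matrix_(i < m.*2, k < 2) block_margin RH RV i k)
              (\matrix_(j < m.*2, k < 2) block_margin CH CV j k)) <->
  two_matrices m RH RV CH CV.
Proof.
have lt2 i : i < m -> i.*2 < m.*2 by lia.
split=> [/consistentP[B [hB hr hc]]|[h [v [hd h1 h2 h3 h4]]]].
  have er i k : i < m.*2 -> k < 2 -> \sum_(j < m.*2) B i j k = block_margin RH RV i k.
    by move=> hi hk; have := hr (Ordinal hi) (Ordinal hk); rewrite mxE.
  have ec j k : j < m.*2 -> k < 2 -> \sum_(i < m.*2) B i j k = block_margin CH CV j k.
    by move=> hi hk; have := hc (Ordinal hi) (Ordinal hk); rewrite mxE.
  have zc i j k : i < m.*2 -> j < m.*2 -> k < 2 -> odd j -> B i j k = false.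
    move=> hi hj hk ho; apply: (@sum_nat_eq0_lt (fun i => B i j k) m.*2) => //.
    by rewrite ec // /block_margin ho.
  have zr i j k : i < m.*2 -> j < m.*2 -> k < 2 -> odd i -> B i j k = false.
    move=> hi hj hk ho; apply: (@sum_nat_eq0_lt (fun j => B i j k) m.*2) => //.
    by rewrite er // /block_margin ho.
  have sr i k : i < m -> k < 2 -> \sum_(j < m) B i.*2 j.*2 k =
      if k == 0 then RH i else RV i.
    move=> hi hk; have := er i.*2 k (lt2 _ hi) hk.
    rewrite /block_margin odd_double doubleK => <-.
    (* [B] is known to vanish at odd columns inside the grid only; the guard extends this to all
       numbers, as [sum_even] requires. *)
    transitivity (\sum_(j < m) ((j.*2 < m.*2) && B i.*2 j.*2 k)).
      by apply: eq_bigr => j _; rewrite lt2.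
    rewrite -(@sum_even (fun j => (j < m.*2) && B i.*2 j k) m).
      by apply: eq_bigr => j _; rewrite ltn_ord.
    by move=> j ho; case: ltnP => //= hj; rewrite zc // lt2.
  have sc j k : j < m -> k < 2 -> \sum_(i < m) B i.*2 j.*2 k =
      if k == 0 then CH j else CV j.
    move=> hi hk; have := ec j.*2 k (lt2 _ hi) hk.
    rewrite /block_margin odd_double doubleK => <-.
    transitivity (\sum_(i < m) ((i.*2 < m.*2) && B i.*2 j.*2 k)).
      by apply: eq_bigr => i _; rewrite lt2.
    rewrite -(@sum_even (fun i => (i < m.*2) && B i j.*2 k) m).
      by apply: eq_bigr => i _; rewrite ltn_ord.
    by move=> i ho; case: ltnP => //= hj; rewrite zr // lt2.
  exists (fun i j => B i.*2 j.*2 0), (fun i j => B i.*2 j.*2 1); split.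
  - move=> i j hi hj; have [_ _] := hB i.*2 j.*2 (lt2 _ hi) (lt2 _ hj).
    by case: (B _ _ 0); case: (B _ _ 1).
  - by move=> i hi; rewrite sr.
  - by move=> i hi; rewrite sr.
  - by move=> i hi; rewrite sc.
  - by move=> i hi; rewrite sc.
apply/consistentP.
pose g k := if k == 0 then h else v.
pose B i j k := [&& ~~ odd i, ~~ odd j & g k i./2 j./2].
exists B; split.
- move=> i j hi hj; split; rewrite /B.
  + by move=> /and3P[_ /even_halfK <- _]; lia.
  + by move=> /and3P[/even_halfK <- _ _]; lia.
  + have := hd i./2 j./2; rewrite /g /=.
    have -> : i./2 < m by lia. have -> : j./2 < m by lia.
    move=> /(_ isT isT).
    case: i hi => [|i] hi; case: j hj => [|j] hj /=; rewrite ?negbK ?andbF ?addn0 //=.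
    * by case: (h _ _); case: (v _ _).
    * by move: (h 0 (uphalf j)) (v 0 (uphalf j)) (h 0 j./2) (odd j) => [] [] [] [].
    * by move: (h (uphalf i) 0) (v (uphalf i) 0) (v i./2 0) (odd i) => [] [] [] [].
    * by move: (h (uphalf i) (uphalf j)) (v (uphalf i) (uphalf j)) (h (uphalf i) j./2)
        (v i./2 (uphalf j)) (odd i) (odd j) => [] [] [] [] [] [].
- move=> i k; rewrite mxE /block_margin; case: ifP => ho.
    by rewrite big1 // => j _; rewrite /B ho.
  rewrite (@sum_even (fun j => B i j k)); last by move=> j hj; rewrite /B hj andbF.
  have hi : i./2 < m by have := ltn_ord i; lia.
  rewrite /B ho /= /g; under eq_bigr do rewrite odd_double doubleK /=.
  by case: eqP => _; rewrite ?h1 ?h2.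
- move=> i k; rewrite mxE /block_margin; case: ifP => ho.
    by rewrite big1 // => j _; rewrite /B ho andbF.
  rewrite (@sum_even (fun j => B j i k)); last by move=> j hj; rewrite /B hj.
  have hi : i./2 < m by have := ltn_ord i; lia.
  rewrite /B ho /= /g; under eq_bigr do rewrite odd_double doubleK /=.
  by case: eqP => _; rewrite ?h3 ?h4.
Qed.

(** * Points with prescribed line sums *)

Lemma sum_ord_split (F : nat -> nat) a b :
  \sum_(i < a + b) F i = \sum_(i < a) F i + \sum_(i < b) F (a + i).
Proof. by rewrite big_split_ord. Qed.

(** The columns of both matrices consist of such threshold patterns, whose only free entry is the
    one at the label [L]. *)
Lemma sum_above N L (x : bool) : L < N ->
  \sum_(a < N) ((L < a) || ((L == a) && x)) = N - L.+1 + x.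
Proof.
elim: N => // N IH; rewrite ltnS leq_eqVlt => /orP[/eqP->|hL].
  rewrite big_ord_recr /= ltnn eqxx /= big1 ?subnn // => i _.
  by rewrite ltnNge ltnW //= gtn_eqF.
by rewrite big_ord_recr /= IH // hL; lia.
Qed.

Lemma sum_below N L (x : bool) : L < N ->
  \sum_(a < N) ((a < L) || ((L == a) && x)) = L + x.
Proof.
elim: N => // N IH; rewrite ltnS leq_eqVlt => /orP[/eqP->|hL].
  rewrite big_ord_recr /= ltnn eqxx /= (eq_bigr (fun=> 1)).
    by rewrite sum_nat_const card_ord muln1.
  by move=> i _; rewrite ltn_ord.
by rewrite big_ord_recr /= IH // ltnNge ltnW //= ltn_eqF // addn0.
Qed.

Lemma sum_above0 N L : L < N -> \sum_(a < N) (L < a) = N - L.+1.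
Proof.
move=> /(sum_above false); rewrite addn0 => <-.
by apply: eq_bigr => i _; rewrite andbF orbF.
Qed.

Lemma sum_below0 N L : L < N -> \sum_(a < N) (a < L) = L.
Proof.
move=> /(sum_below false); rewrite addn0 => {2}<-.
by apply: eq_bigr => i _; rewrite andbF orbF.
Qed.

Lemma Posz_sum C (F : nat -> nat) :
  Posz (\sum_(c < C) F c) = (\sum_(c < C) Posz (F c))%R.
Proof. by rewrite (big_morph Posz PoszD (erefl _)). Qed.

(** The weight of an entry is a row term minus a column term, so the total weight depends only on
    the row sums and the column sums. *)
Lemma potential_sum C N (X : nat -> nat -> int) (L : nat -> nat) :
  (\sum_(c < C) \sum_(a < N) X a c * (Posz a - Posz (L c)) =
   \sum_(a < N) Posz a * (\sum_(c < C) X a c) -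
   \sum_(c < C) Posz (L c) * (\sum_(a < N) X a c))%R.
Proof.
have -> : (\sum_(a < N) Posz a * (\sum_(c < C) X a c) =
    \sum_(c < C) \sum_(a < N) Posz a * X a c)%R.
  by rewrite exchange_big; apply: eq_bigr => a _; rewrite mulr_sumr.
rewrite -sumrB; apply: eq_bigr => c _; rewrite mulr_sumr -sumrB.
by apply: eq_bigr => a _; rewrite mulrBr ![(X a c * _)%R]mulrC.
Qed.

Lemma double_sum_eq0 (C N : nat) (X : nat -> nat -> int) :
  (forall a c, a < N -> c < C -> (0 <= X a c)%R) ->
  (\sum_(c < C) \sum_(a < N) X a c = 0)%R ->
  forall a c, a < N -> c < C -> X a c = 0%R.
Proof.
move=> h0 hs a c ha hc.
have h1 (i : 'I_C) : (0 <= \sum_(a < N) X a i)%R by apply: sumr_ge0 => j _; apply: h0.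
have := psumr_eq0P (fun i _ => h1 i) hs (i := Ordinal hc) isT => /= h2.
have := psumr_eq0P _ h2 (i := Ordinal ha) isT => /=; apply=> j _; exact: h0.
Qed.

Lemma sum3_eq0 (x y z : int) : (x + y + z = 0)%R -> (0 <= x)%R -> (0 <= y)%R ->
  (0 <= z)%R -> [/\ x = 0%R, y = 0%R & z = 0%R].
Proof. by move=> *; split; lia. Qed.

Section Points.
Variables (C NA NB ND : nat) (act : nat -> bool) (A B D s t u : nat -> nat).

Definition npoints (P : nat -> bool) : nat := \sum_(c < C) (act c && P c).

(* The columns of the two matrices are the points [c], with labels [A c], [B c]
   and [D c = A c + B c]; their rows are the lines of the three directions. *)
Definition pRH (i : nat) : nat :=
  if i < NA then npoints (fun c => A c < i) + s i
  else if i < NA + NB then 0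
  else if i < NA + NB + ND then
    npoints (fun c => D c < i - (NA + NB)) + u (i - (NA + NB))
  else 0.

Definition pRV (i : nat) : nat :=
  if i < NA then 0
  else if i < NA + NB then npoints (fun c => i - NA < B c) + t (i - NA)
  else if i < NA + NB + ND then
    npoints (fun=> true) -
    (npoints (fun c => D c < i - (NA + NB)) + u (i - (NA + NB)))
  else 0.

(** Besides the forced entries, the column of a point contains exactly one of its two entries on
    lines: in the first matrix the one in row [A c] if the point is selected and the one in row
    [D c] otherwise. Likewise for the second matrix with the rows [D c] and [B c]. *)
Definition pCH (c : nat) : nat :=
  if (c < C) && act c then (NA - (A c).+1) + (ND - (D c).+1) + 1 else 0.

Definition pCV (c : nat) : nat :=
  if (c < C) && act c then B c + D c + 1 else 0.

(* Subsets of a set of points with prescribed numbers of elements on the lines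
   of three directions; [t] and [u] count the points that are not selected. *)
Definition line_sums (x : nat -> bool) : Prop :=
  [/\ forall a, a < NA -> \sum_(c < C) [&& act c, A c == a & x c] = s a,
      forall b, b < NB -> \sum_(c < C) [&& act c, B c == b & ~~ x c] = t b &
      forall d, d < ND -> \sum_(c < C) [&& act c, D c == d & ~~ x c] = u d].

Hypothesis labels : forall c, c < C -> act c ->
  [/\ A c < NA, B c < NB, D c < ND & D c = A c + B c].

(** The matrices have to be square; the last [C] rows and the columns from [C] on have margin 0. *)
Let m := NA + NB + ND + C.

(** Off the lines the entries follow the thresholds, and on them they are given by [x] or its
    negation. In the rows of the third direction the two matrices are complementary, in the other
    rows one of them is zero. *)
Lemma matrices_of_lines x : line_sums x -> two_matrices m pRH pRV pCH pCV.
Proof.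
move=> [hs ht hu].
pose hF i c := if i < NA then (A c < i) || ((A c == i) && x c)
  else if i < NA + NB then false else if i < NA + NB + ND then
   (D c < i - (NA + NB)) || ((D c == i - (NA + NB)) && ~~ x c) else false.
pose vF i c := if i < NA then false
  else if i < NA + NB then (i - NA < B c) || ((B c == i - NA) && ~~ x c)
  else if i < NA + NB + ND then
   ~~ ((D c < i - (NA + NB)) || ((D c == i - (NA + NB)) && ~~ x c)) else false.
have rowsum (f : nat -> bool) : \sum_(j < m) [&& j < C, act j & f j] = npoints f.
  rewrite /m addnC (sum_ord_split (fun j => [&& j < C, act j & f j])) [X in _ + X]big1 ?addn0.
    by apply: eq_bigr => j _; rewrite ltn_ord.
  by move=> j _; rewrite ltnNge leq_addr.
have colsum (g : nat -> bool) j : \sum_(i < m) [&& j < C, act j & g i] =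
    if (j < C) && act j then \sum_(i < NA) g i + \sum_(i < NB) g (NA + i) +
      \sum_(i < ND) g (NA + NB + i) + \sum_(i < C) g (NA + NB + ND + i) else 0.
  case: (j < C) => /=; last by rewrite big1.
  case: (act j) => /=; last by rewrite big1.
  by rewrite /m !(sum_ord_split (fun i => g i)).
have nps (P Q R : nat -> bool) : (forall c, R c = P c || Q c) ->
    (forall c, ~~ (P c && Q c)) -> npoints R = npoints P + npoints Q.
  move=> hR hPQ; rewrite /npoints -big_split; apply: eq_bigr => c _ /=.
  by rewrite hR; have := hPQ c; case: (act c); case: (P c); case: (Q c).
exists (fun i c => [&& c < C, act c & hF i c]), (fun i c => [&& c < C, act c & vF i c]).
split.
- move=> i j _ _; rewrite /hF /vF; case: (j < C) => //; case: (act j) => //=.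
  by case: (i < NA); rewrite ?andbF //=; case: (i < NA + NB); rewrite ?andbF //=;
    case: (i < NA + NB + ND); rewrite ?andbN.
- move=> i _; rewrite rowsum /hF /pRH; case: ifP => [hi|_].
    rewrite -hs //; apply: (nps _ (fun c => (A c == i) && x c)) => // c.
    by case: ltngtP.
  case: ifP => [_|h1]; first by rewrite /npoints big1 // => c _; rewrite andbF.
  case: ifP => [h2|_]; last by rewrite /npoints big1 // => c _; rewrite andbF.
  rewrite -hu; last by lia.
  apply: (nps _ (fun c => (D c == i - (NA + NB)) && ~~ x c)) => // c.
  by case: ltngtP.
- move=> i _; rewrite rowsum /vF /pRV; case: ifP => [hi|h0].
    by rewrite /npoints big1 // => c _; rewrite andbF.
  case: ifP => [h1|h1].
    rewrite -ht; last by lia.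
    apply: (nps _ (fun c => (B c == i - NA) && ~~ x c)) => // c.
    by rewrite eq_sym; case: ltngtP.
  case: ifP => [h2|_]; last by rewrite /npoints big1 // => c _; rewrite andbF.
  rewrite -hu; last by lia.
  have e : npoints (fun c => (D c < i - (NA + NB)) || ((D c == i - (NA + NB)) && ~~ x c)) =
     npoints (fun c => D c < i - (NA + NB)) + npoints (fun c => (D c == i - (NA + NB)) && ~~ x c).
    by apply: nps => // c; case: ltngtP.
  rewrite -[X in _ = _ - X]e.
  set f := (fun c => (D c < _) || _).
  rewrite (nps f (fun c => ~~ f c) (fun=> true)) ?addKn // => c; by case: (f c).
- move=> j _; have /= -> := colsum (fun i => hF i j) j; rewrite /pCH; case: ifP => // /andP[jC ja].
  have [lA lB lD _] := labels jC ja.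
  rewrite (eq_bigr (fun i : 'I_NA => nat_of_bool ((A j < i) || ((A j == i) && x j)))); last first.
    by move=> i _; rewrite /hF ltn_ord.
  rewrite sum_above // big1; last first.
    by move=> i _; rewrite /hF ltnNge leq_addr /= ltn_add2l ltn_ord.
  rewrite addn0 (eq_bigr (fun i : 'I_ND => nat_of_bool ((D j < i) || ((D j == i) && ~~ x j)))); last first.
    move=> i _; rewrite /hF -addnA ltnNge leq_addr /= addnA ltnNge leq_addr /=.
    by rewrite ltn_add2l ltn_ord addKn.
  rewrite sum_above // [X in _ + _ + X = _]big1; last first.
    by move=> i _; rewrite /hF !ifF //; lia.
  by case: (x j) => /=; lia.
- move=> j _; have /= -> := colsum (fun i => vF i j) j; rewrite /pCV; case: ifP => // /andP[jC ja].
  have [lA lB lD _] := labels jC ja.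
  rewrite [X in X + _ + _ + _ = _]big1; last by move=> i _; rewrite /vF ltn_ord.
  rewrite add0n (eq_bigr (fun i : 'I_NB => nat_of_bool ((i < B j) || ((B j == i) && ~~ x j)))); last first.
    by move=> i _; rewrite /vF ltnNge leq_addr /= ltn_add2l ltn_ord addKn.
  rewrite sum_below // (eq_bigr (fun i : 'I_ND => nat_of_bool ((i < D j) || ((D j == i) && x j)))); last first.
    move=> i _; rewrite /vF -addnA ltnNge leq_addr /= addnA ltnNge leq_addr /=.
    rewrite ltn_add2l ltn_ord addKn.
    by case: ltngtP => //= _; rewrite negbK.
  rewrite sum_below // [X in _ + _ + X = _]big1; last first.
    by move=> i _; rewrite /vF !ifF //; lia.
  by case: (x j) => /=; lia.
Qed.

(** Every solution of [line_sums] satisfies this identity: a selected point contributes its label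
    [A] on both sides, and an unselected one [D] on the left and [A + B] on the right. *)
Hypothesis balance : \sum_(a < NA) a * s a + \sum_(d < ND) d * u d =
  \sum_(c < C) act c * A c + \sum_(b < NB) b * t b.

(* In row [a] the weight of an entry is [a - A c], in row [b] it is [B c - b] and
   in row [d] it is [d - D c].  The column sums and [balance] determine the total
   weight, which is extremal; hence in each row the entries that are not on the
   line are forced, and the entries on the three lines through a point are tied
   by its column sums. *)
Lemma lines_of_matrices : two_matrices m pRH pRV pCH pCV -> exists x, line_sums x.
Proof.
move=> [h [v [hd hRH hRV hCH hCV]]].
have lm : [/\ NA <= m, NA + NB <= m, NA + NB + ND <= m & C <= m] by rewrite /m; split; lia.
case: lm => mA mB mD mC.
have cz i j : i < m -> j < m -> ~~ ((j < C) && act j) -> h i j = false /\ v i j = false.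
  move=> hi hj hn; split.
    apply: (@sum_nat_eq0_lt (fun i => h i j) m) => //.
    by rewrite hCH // /pCH (negbTE hn).
  apply: (@sum_nat_eq0_lt (fun i => v i j) m) => //.
  by rewrite hCV // /pCV (negbTE hn).
have rs (f : nat -> bool) : (forall j, j < m -> ~~ ((j < C) && act j) -> f j = false) ->
    \sum_(j < m) f j = npoints f.
  move=> hf; have e : m = C + (NA + NB + ND) by rewrite /m addnC.
  rewrite e (sum_ord_split (fun j => f j)) [X in _ + X]big1 ?addn0.
    apply: eq_bigr => j _; case aj: (act j) => //=.
    by rewrite hf // ?aj ?andbF //; apply: leq_trans mC.
  move=> j _; rewrite hf //; first by rewrite e ltn_add2l.
  by rewrite ltnNge leq_addr.
have rH i : i < m -> npoints (h i) = pRH i.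
  by move=> hi; rewrite -hRH // rs // => j hj hn; case: (cz i j hi hj hn).
have rV i : i < m -> npoints (v i) = pRV i.
  by move=> hi; rewrite -hRV // rs // => j hj hn; case: (cz i j hi hj hn).
have np0 f c : npoints f = 0 -> c < C -> act c -> f c = false.
  move=> h0 hc ac; have := @sum_nat_eq0_lt (fun c => act c && f c) C c h0 hc.
  by rewrite ac.
pose G b c := v (NA + b) c; pose K d c := h (NA + NB + d) c.
pose V d c := v (NA + NB + d) c.
have rA a : a < NA -> npoints (h a) = npoints (fun c => A c < a) + s a.
  by move=> ha; rewrite rH ?(leq_trans ha) // /pRH ha.
have rB b : b < NB -> npoints (G b) = npoints (fun c => b < B c) + t b.
  move=> hb; rewrite rV; last by lia.
  by rewrite /pRV ltnNge leq_addr /= ltn_add2l hb addKn.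
have rD d : d < ND -> npoints (K d) = npoints (fun c => D c < d) + u d.
  move=> hb; rewrite rH; last by lia.
  have -> : pRH (NA + NB + d) = npoints (fun c => D c < d) + u d.
    rewrite /pRH ltn_add2l hb addKn.
    have -> : (NA + NB + d < NA) = false by lia.
    by have -> : (NA + NB + d < NA + NB) = false by lia.
  by [].
have rD' d : d < ND -> npoints (V d) = npoints (fun=> true) - npoints (K d).
  move=> hb; rewrite rD // rV; last by lia.
  have -> : pRV (NA + NB + d) = npoints (fun=> true) - (npoints (fun c => D c < d) + u d).
    rewrite /pRV ltn_add2l hb addKn.
    have -> : (NA + NB + d < NA) = false by lia.
    by have -> : (NA + NB + d < NA + NB) = false by lia.
  by [].
(* The margins of the two matrices in such a row add up to the number of points, so the two disjoint
   rows fill it completely. *)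
have VK d c : d < ND -> c < C -> act c -> V d c = ~~ K d c.
  move=> hb hc ac.
  have hdis c' : c' < C -> ~~ (K d c' && V d c').
    by move=> hc'; apply: hd; lia.
  have h1 : npoints (K d) + npoints (V d) = npoints (fun=> true).
    rewrite rD' // subnKC //; apply: leq_sum => i _.
    by case: (act i) => //=; case: (K d i).
  have h2 : npoints (fun c => ~~ (K d c || V d c)) = 0.
    have : npoints (fun c => ~~ (K d c || V d c)) + (npoints (K d) + npoints (V d)) = npoints (fun=> true).
      rewrite /npoints -!big_split; apply: eq_bigr => i _ /=.
      by have := hdis i (ltn_ord i); case: (act i) => //=; case: (K d i); case: (V d i).
    by rewrite h1; lia.
  have := np0 _ c h2 hc ac; have := hdis c hc.
  by case: (K d c); case: (V d c).
have colA c : c < C -> act c -> \sum_(a < NA) h a c + \sum_(d < ND) K d c =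
    (NA - (A c).+1) + (ND - (D c).+1) + 1.
  move=> hc ac; have hcm : c < m by lia.
  have := hCH c hcm; rewrite /pCH hc ac /= => <-.
  rewrite /m !(sum_ord_split (fun i => h i c)) [X in _ + X + _ + _]big1 ?addn0.
    rewrite [X in _ + _ + X]big1 ?addn0 // => i _.
    rewrite (np0 (h (NA + NB + ND + i))) //.
    rewrite rH; last by have := ltn_ord i; rewrite /m; lia.
    by rewrite /pRH !ifF //; lia.
  move=> b _; rewrite (np0 (h (NA + b))) //.
  have hb := ltn_ord b; rewrite rH; last by lia.
  by rewrite /pRH ifF ?ifT //; lia.
have colB c : c < C -> act c -> \sum_(b < NB) G b c + \sum_(d < ND) V d c =
    B c + D c + 1.
  move=> hc ac; have hcm : c < m by lia.
  have := hCV c hcm; rewrite /pCV hc ac /= => <-.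
  rewrite /m !(sum_ord_split (fun i => v i c)) [X in X + _ + _ + _]big1 ?add0n.
    rewrite [X in _ + _ + X]big1 ?addn0 // => i _.
    rewrite (np0 (v (NA + NB + ND + i))) //.
    rewrite rV; last by have := ltn_ord i; rewrite /m; lia.
    by rewrite /pRV !ifF //; lia.
  move=> a _; rewrite (np0 (v a)) //.
  have ha := ltn_ord a; rewrite rV; last by lia.
  by rewrite /pRV ha.
have sumVK c : c < C -> act c -> \sum_(d < ND) K d c + \sum_(d < ND) V d c = ND.
  move=> hc ac; rewrite -big_split (eq_bigr (fun=> 1)) ?sum_nat_const ?card_ord ?muln1 //.
  by move=> d _; rewrite VK //; case: (K d c).
(* Deviations from the strict threshold patterns. Their row sums are the prescribed line counts up
   to sign, since the rest of each row margin is the size of the pattern. *)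
pose XA a c : int := (Posz (act c && (A c < a)%N) - Posz (act c && h a c))%R.
pose XB b c : int := (Posz (act c && G b c) - Posz (act c && (b < B c)%N))%R.
pose XD d c : int := (Posz (act c && (D c < d)%N) - Posz (act c && K d c))%R.
have sA a : a < NA -> (\sum_(c < C) XA a c = - Posz (s a))%R.
  move=> ha; rewrite /XA sumrB -(Posz_sum C (fun c => act c && (A c < a))).
  rewrite -(Posz_sum C (fun c => act c && h a c)).
  by have := rA a ha; rewrite /npoints => ->; lia.
have sB b : b < NB -> (\sum_(c < C) XB b c = Posz (t b))%R.
  move=> ha; rewrite /XB sumrB -(Posz_sum C (fun c => act c && (b < B c))).
  rewrite -(Posz_sum C (fun c => act c && G b c)).
  by have := rB b ha; rewrite /npoints => ->; lia.
have sD d : d < ND -> (\sum_(c < C) XD d c = - Posz (u d))%R.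
  move=> ha; rewrite /XD sumrB -(Posz_sum C (fun c => act c && (D c < d))).
  rewrite -(Posz_sum C (fun c => act c && K d c)).
  by have := rD d ha; rewrite /npoints => ->; lia.
(* With e for the sum of [XD] over the column, the column margins give the sums [-1 - e] for [XA]
   and [-e] for [XB]. The unknown e cancels because [D c = A c + B c], and [A c] remains. *)
have colX c : c < C ->
  (- (Posz (A c) * \sum_(a < NA) XA a c) - Posz (B c) * (\sum_(b < NB) XB b c)
   - Posz (D c) * (\sum_(d < ND) XD d c) = Posz (act c * A c))%R.
  move=> hc; case ac: (act c); last first.
    rewrite !big1 ?mulr0; first by lia.
    - by move=> i _; rewrite /XD ac.
    - by move=> i _; rewrite /XB ac.
    - by move=> i _; rewrite /XA ac.
  have [lA lB lD eD] := labels hc ac.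
  have := colA c hc ac; have := colB c hc ac; have := sumVK c hc ac.
  have := sum_above0 lA; have := sum_below0 lB; have := sum_above0 lD.
  rewrite /XA /XB /XD !sumrB ac /=.
  rewrite -(Posz_sum NA (fun a => A c < a)) -(Posz_sum NA (fun a => h a c)).
  rewrite -(Posz_sum NB (fun b => b < B c)) -(Posz_sum NB (fun b => G b c)).
  rewrite -(Posz_sum ND (fun d => D c < d)) -(Posz_sum ND (fun d => K d c)).
  move: (\sum_(a < NA) (A c < a)) (\sum_(a < NA) h a c) (\sum_(b < NB) (b < B c))
     (\sum_(b < NB) G b c) (\sum_(d < ND) (D c < d)) (\sum_(d < ND) K d c) (\sum_(d < ND) V d c).
  move=> a1 a2 a3 a4 a5 a6 a7; rewrite eD => q1 q2 q3 q4 q5 q6.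
  have e1 : (Posz a1 - Posz a2 = - 1 - (Posz a5 - Posz a6))%R by lia.
  have e2 : (Posz a4 - Posz a3 = - (Posz a5 - Posz a6))%R by lia.
  rewrite e1 e2 mul1n PoszD; ring.
(* The row parts of the weight give the line counts of [balance] and the column parts give [colX];
   [balance] says that they cancel. *)
have P0 : (\sum_(c < C) \sum_(a < NA) XA a c * (Posz a - Posz (A c)) +
     \sum_(c < C) \sum_(b < NB) XB b c * (Posz b - Posz (B c)) +
     \sum_(c < C) \sum_(d < ND) XD d c * (Posz d - Posz (D c)) = 0)%R.
  rewrite !potential_sum.
  have E1 : (\sum_(a < NA) Posz a * (\sum_(c < C) XA a c) = - Posz (\sum_(a < NA) a * s a))%R.
    rewrite (Posz_sum NA (fun a => a * s a)) -sumrN; apply: eq_bigr => a _.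
    by rewrite sA // PoszM mulrN.
  have E2 : (\sum_(b < NB) Posz b * (\sum_(c < C) XB b c) = Posz (\sum_(b < NB) b * t b))%R.
    rewrite (Posz_sum NB (fun b => b * t b)); apply: eq_bigr => a _.
    by rewrite sB // PoszM.
  have E3 : (\sum_(d < ND) Posz d * (\sum_(c < C) XD d c) = - Posz (\sum_(d < ND) d * u d))%R.
    rewrite (Posz_sum ND (fun d => d * u d)) -sumrN; apply: eq_bigr => a _.
    by rewrite sD // PoszM mulrN.
  have E4 : (- (\sum_(c < C) Posz (A c) * (\sum_(a < NA) XA a c)) -
     (\sum_(c < C) Posz (B c) * (\sum_(b < NB) XB b c)) -
     (\sum_(c < C) Posz (D c) * (\sum_(d < ND) XD d c)) = Posz (\sum_(c < C) act c * A c))%R.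
    rewrite (Posz_sum C (fun c => act c * A c)) -sumrN -!sumrB.
    by apply: eq_bigr => c _; rewrite colX.
  rewrite E1 E2 E3.
  move: E4 balance; move: (\sum_(c < C) Posz (A c) * _)%R (\sum_(c < C) Posz (B c) * _)%R
    (\sum_(c < C) Posz (D c) * _)%R => z1 z2 z3.
  move: (\sum_(c < C) act c * A c) (\sum_(a < NA) a * s a) (\sum_(d < ND) d * u d)
    (\sum_(b < NB) b * t b) => n1 n2 n3 n4; lia.
(* Entries are 0 or 1, so a deviation can only have the sign of its weight. A vanishing total
   therefore makes every deviation off the lines vanish. *)
have gA a c : a < NA -> c < C -> (0 <= XA a c * (Posz a - Posz (A c)))%R.
  move=> _ _; rewrite /XA; case: (act c) => //=; case: (ltnP (A c) a) => hh; case: (h a c) => /=; lia.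
have gB b c : b < NB -> c < C -> (0 <= XB b c * (Posz b - Posz (B c)))%R.
  move=> _ _; rewrite /XB; case: (act c) => //=; case: (ltnP b (B c)) => hh; case: (G b c) => /=; lia.
have gD d c : d < ND -> c < C -> (0 <= XD d c * (Posz d - Posz (D c)))%R.
  move=> _ _; rewrite /XD; case: (act c) => //=; case: (ltnP (D c) d) => hh; case: (K d c) => /=; lia.
have pA : (0 <= \sum_(c < C) \sum_(a < NA) XA a c * (Posz a - Posz (A c)))%R.
  by do 2!(apply: sumr_ge0 => ? _); apply: gA.
have pB : (0 <= \sum_(c < C) \sum_(b < NB) XB b c * (Posz b - Posz (B c)))%R.
  by do 2!(apply: sumr_ge0 => ? _); apply: gB.
have pD : (0 <= \sum_(c < C) \sum_(d < ND) XD d c * (Posz d - Posz (D c)))%R.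
  by do 2!(apply: sumr_ge0 => ? _); apply: gD.
have [qA qB qD] := sum3_eq0 P0 pA pB pD.
have zA := @double_sum_eq0 C NA (fun a c => XA a c * (Posz a - Posz (A c)))%R gA qA.
have zB := @double_sum_eq0 C NB (fun b c => XB b c * (Posz b - Posz (B c)))%R gB qB.
have zD := @double_sum_eq0 C ND (fun d c => XD d c * (Posz d - Posz (D c)))%R gD qD.
pose x c := h (A c) c.
have fA a c : a < NA -> c < C -> act c -> h a c = (A c < a) || ((A c == a) && x c).
  move=> ha hc ac; have := zA a c ha hc; rewrite /XA /x ac /=.
  by case: (ltngtP (A c) a) => [l|l|<-] //=; case: (h a c) => //; lia.
have fB b c : b < NB -> c < C -> act c -> G b c = (b < B c) || ((B c == b) && G (B c) c).
  move=> ha hc ac; have := zB b c ha hc; rewrite /XB ac /=.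
  by case: (ltngtP (B c) b) => [l|l|<-] //=; case: (G b c) => //; lia.
have fD d c : d < ND -> c < C -> act c -> K d c = (D c < d) || ((D c == d) && K (D c) c).
  move=> ha hc ac; have := zD d c ha hc; rewrite /XD ac /=.
  by case: (ltngtP (D c) d) => [l|l|<-] //=; case: (K d c) => //; lia.
(* Once the other entries are known, the column sums leave exactly one entry of each matrix to the
   lines through the point. *)
have tie c : c < C -> act c -> K (D c) c = ~~ x c /\ G (B c) c = ~~ x c.
  move=> hc ac; have [lA lB lD eD] := labels hc ac.
  have := colA c hc ac; have := colB c hc ac; have := sumVK c hc ac.
  rewrite (eq_bigr (fun d : 'I_ND => nat_of_bool ((D c < d) || ((D c == d) && K (D c) c)))); last first.
    by move=> d _; rewrite fD.
  rewrite (eq_bigr (fun d : 'I_NB => nat_of_bool ((d < B c) || ((B c == d) && G (B c) c)))); last first.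
    by move=> d _; rewrite fB.
  rewrite (eq_bigr (fun d : 'I_NA => nat_of_bool ((A c < d) || ((A c == d) && x c)))); last first.
    by move=> d _; rewrite fA.
  rewrite !sum_above // sum_below //.
  move: (\sum_(d < ND) V d c) => a7.
  by case: (K (D c) c); case: (G (B c) c); case: (x c) => /=; lia.
have np_split f g P : (forall c, c < C -> act c -> f c = P c || g c) ->
    (forall c, ~~ (P c && g c)) -> npoints f = npoints P + npoints g.
  move=> hf hPg; rewrite /npoints -big_split; apply: eq_bigr => c _ /=.
  case ac: (act c) => //=; rewrite hf //; have := hPg c.
  by case: (P c); case: (g c).
exists x; split.
- move=> a ha; have := rA a ha.
  rewrite (np_split _ (fun c => (A c == a) && x c) (fun c => A c < a)); first by move/addnI.
    by move=> c hc ac; rewrite fA.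
  by move=> c; case: ltngtP.
- move=> b hb; have := rB b hb.
  rewrite (np_split _ (fun c => (B c == b) && ~~ x c) (fun c => b < B c)); first by move/addnI.
    by move=> c hc ac; rewrite fB // (tie c hc ac).2.
  by move=> c; case: ltngtP.
- move=> d hb; have := rD d hb.
  rewrite (np_split _ (fun c => (D c == d) && ~~ x c) (fun c => D c < d)); first by move/addnI.
    by move=> c hc ac; rewrite fD // (tie c hc ac).1.
  by move=> c; case: ltngtP.
Qed.

End Points.

(** * Common flows of two graphs *)

Lemma sum_group (F : nat -> nat) N M :
  \sum_(v < N * M) F v = \sum_(p < N) \sum_(r < M) F (p * M + r).
Proof.
elim: N => [|N IH]; first by rewrite !big_ord0.
by rewrite mulSnr (sum_ord_split F) IH [RHS]big_ord_recr.
Qed.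

Lemma sum8 (F : nat -> nat) :
  \sum_(r < 8) F r = F 0 + F 1 + F 2 + F 3 + F 4 + F 5 + F 6 + F 7.
Proof. by rewrite !big_ord_recr big_ord0. Qed.

Lemma sum_two (P : nat -> bool) C c1 c2 : c1 < C -> c2 < C -> c1 != c2 ->
  (forall c, c < C -> P c -> (c == c1) || (c == c2)) ->
  \sum_(c < C) P c = P c1 + P c2.
Proof.
move=> h1 h2 ne h; rewrite (bigD1 (Ordinal h1)) //= (bigD1 (Ordinal h2)) /=; last first.
  by rewrite -val_eqE /= eq_sym.
rewrite big1 ?addn0 // => c /andP[n1 n2].
case e: (P c) => //; have := h c (ltn_ord c) e.
by move: n1 n2; rewrite -!val_eqE /= => /negbTE -> /negbTE ->.
Qed.

Lemma sum_weighted (P : nat -> bool) (L : nat -> nat) C N :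
  (forall c, c < C -> P c -> L c < N) ->
  \sum_(a < N) a * \sum_(c < C) (P c && (L c == a)) = \sum_(c < C) P c * L c.
Proof.
move=> h; under eq_bigr do rewrite big_distrr /=.
rewrite exchange_big /=; apply: eq_bigr => c _.
case e: (P c) => /=; last by rewrite big1 // => a _; rewrite muln0.
have hL := h c (ltn_ord c) e.
rewrite (bigD1 (Ordinal hL)) //= eqxx muln1 mul1n big1 ?addn0 // => a.
by rewrite -val_eqE /= eq_sym => /negbTE ->; rewrite muln0.
Qed.

Lemma sum_at N a : a < N -> \sum_(i < N) i * (i == a :> nat) = a.
Proof.
move=> h; rewrite (bigD1 (Ordinal h)) //= eqxx muln1 big1 ?addn0 // => i.
by rewrite -val_eqE /= => /negbTE ->; rewrite muln0.
Qed.

Section Flow.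
Variables (V NL : nat) (act : nat -> bool) (l0 l1 l2 l3 : nat -> nat).
Variables (src dst : nat).

(* A set of arcs that is at the same time a unit flow from [src] to [dst] in one
   graph, where the arc [v] goes from [l2 v] to [l0 v], and a circulation in
   another one, where it goes from [l3 v] to [l1 v]. *)
Definition common_flow (x : nat -> bool) : Prop := forall l, l < NL ->
  \sum_(v < V) [&& act v, l0 v == l & x v] + (l == src) =
  \sum_(v < V) [&& act v, l2 v == l & x v] + (l == dst) /\
  \sum_(v < V) [&& act v, l1 v == l & x v] =
  \sum_(v < V) [&& act v, l3 v == l & x v].

(* The arc [v] yields the eight points [v * 8 + r]; their labels are such that
   the lines of the second direction contain the points [2 i] and [2 i + 1] of an
   arc, those of the third direction the points [2 i + 1] and [2 i + 2 mod 8],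
   and those of the first direction express the conservation laws. *)
Definition ell (r v : nat) : nat :=
  nth 0 [:: l0 v; l0 v; l1 v; l1 v; l2 v; l2 v; l3 v; l3 v] r.

(** Residues modulo 8. In [offA], 0 and 1 belong to the first graph, 4 and 6 to the second; the even
    points of heads share their lines with the odd points of tails, and conversely. [offD - offA] is
    constant on the pairs of points [2 i] and [2 i + 1], with the values 0, -3, 2 and -4, which are
    distinct modulo 8. *)
Definition offA := [:: 0; 1; 4; 6; 1; 0; 6; 4].
Definition offD := [:: 0; 1; 1; 3; 3; 2; 2; 0].
Definition fA (c : nat) : nat :=
  8 * ell (c %% 8) (c %/ 8) + nth 0 offA (c %% 8).
(** Labels [fA] are below [8 * NL]. The step [8 * NL.+1] between arcs therefore keeps their lines
    apart in the second direction as well, and starting with [v.+1] makes [fD] at least [fA]. *)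
Definition fD (c : nat) : nat :=
  8 * (NL.+1 * (c %/ 8).+1) + nth 0 offD (c %% 8).
Definition fB (c : nat) : nat := fD c - fA c.
Definition fact (c : nat) : bool := act (c %/ 8).
(** The counts are those of the empty set of arcs, for which exactly the odd points are selected and
    the even ones are not. *)
Definition ft (b : nat) : nat := \sum_(c < V * 8) [&& fact c, ~~ odd c & fB c == b].
Definition fu (d : nat) : nat := \sum_(c < V * 8) [&& fact c, ~~ odd c & fD c == d].
(** On the line [8 * l] the arcs entering [l] count if they are chosen and the arcs leaving [l] if
    they are not, so adding 1 at [dst] and subtracting 1 at [src] prescribes a unit flow. On
    [8 * l + 1] the roles are exchanged. *)
Definition fs (a : nat) : nat :=
  \sum_(c < V * 8) [&& fact c, odd c & fA c == a] +
  ((a == 8 * dst) + (a == 8 * src + 1)) - ((a == 8 * dst + 1) + (a == 8 * src)).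
Definition fNA := 8 * NL.
Definition fND := 8 * (NL.+1 * V.+1) + 8.

Hypothesis arcs : forall v, v < V -> act v ->
  [/\ l0 v < NL, l1 v < NL, l2 v < NL & l3 v < NL].
Hypothesis src_lt : src < NL.
Hypothesis dst_lt : dst < NL.
Hypothesis src_arc : exists v, [/\ v < V, act v & l2 v = src].
Hypothesis dst_arc : exists v, [/\ v < V, act v & l0 v = dst].

Lemma ell_lt r v : r < 8 -> v < V -> act v -> ell r v < NL.
Proof.
by move=> hr hv av; have [? ? ? ?] := arcs hv av; do 8?[case: r hr => [|r] hr //].
Qed.

Lemma fact_at v r : r < 8 -> fact (v * 8 + r) = act v.
Proof. by move=> hr; rewrite /fact divnMDl // divn_small // addn0. Qed.

Lemma fA_at v r : r < 8 -> fA (v * 8 + r) = 8 * ell r v + nth 0 offA r.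
Proof. by move=> hr; rewrite /fA divnMDl // divn_small // addn0 modnMDl modn_small. Qed.

Lemma fD_at v r : r < 8 -> fD (v * 8 + r) = 8 * (NL.+1 * v.+1) + nth 0 offD r.
Proof. by move=> hr; rewrite /fD divnMDl // divn_small // addn0 modnMDl modn_small. Qed.

Lemma odd_at v r : odd (v * 8 + r) = odd r.
Proof. by rewrite oddD oddM andbF. Qed.

Lemma offD_lt r : nth 0 offD r < 8.
Proof. by do 8?[case: r => [|r] //]; rewrite nth_default. Qed.

Lemma offA_lt7 r : nth 0 offA r < 7.
Proof. by do 8?[case: r => [|r] //]; rewrite nth_default. Qed.

Lemma arc_lt c : c < V * 8 -> c %/ 8 < V.
Proof. by move=> h; rewrite ltn_divLR. Qed.

Lemma flow_labels c : c < V * 8 -> fact c ->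
  [/\ fA c < fNA, fB c < fND, fD c < fND & fD c = fA c + fB c].
Proof.
move=> hc ac; have hv := arc_lt hc.
have hl := ell_lt (ltn_pmod c (isT : 0 < 8)) hv ac.
have hA := ltnW (offA_lt7 (c %% 8)); have hD := offD_lt (c %% 8).
have h1 : NL.+1 * (c %/ 8).+1 <= NL.+1 * V.+1 by rewrite leq_mul2l ltnS ltnW ?orbT.
have h2 : NL.+1 <= NL.+1 * (c %/ 8).+1 by rewrite leq_pmulr.
rewrite /fB /fNA /fND /fD /fA; split; lia.
Qed.

(** The subtraction in [fs] is not truncated: an arc into [dst] has its odd point 1 on the line
    [8 * dst + 1], an arc out of [src] has its odd point 5 on [8 * src], and these two lines
    differ. *)
Lemma fs_add a : fs a + ((a == 8 * dst + 1) + (a == 8 * src)) =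
  \sum_(c < V * 8) [&& fact c, odd c & fA c == a] +
  ((a == 8 * dst) + (a == 8 * src + 1)).
Proof.
rewrite /fs subnK //.
have pos c : c < V * 8 -> [&& fact c, odd c & fA c == a] ->
   0 < \sum_(c < V * 8) [&& fact c, odd c & fA c == a].
  by move=> hc hp; rewrite (bigD1 (Ordinal hc)) //= hp.
case: (eqVneq a (8 * dst + 1)) => [e|_].
  have -> : (a == 8 * src) = false by lia.
  have [v [hv av ev]] := dst_arc.
  have := pos (v * 8 + 1); rewrite fact_at // fA_at // odd_at av /ell /= ev e eqxx.
  by move=> /(_ _ isT) h; apply: leq_trans (leq_addr _ _); apply: h; lia.
case: (eqVneq a (8 * src)) => [e|_] //.
have [v [hv av ev]] := src_arc.
have := pos (v * 8 + 5); rewrite fact_at // fA_at // odd_at av /ell /= ev e addn0 eqxx.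
by move=> /(_ _ isT) h; apply: leq_trans (leq_addr _ _); apply: h; lia.
Qed.

(** Selecting the odd points realises the counts up to the corrections at [src] and [dst], whose
    total weight [8 * dst + (8 * src + 1) - (8 * dst + 1) - 8 * src] is 0. *)
Lemma flow_balance : \sum_(a < fNA) a * fs a + \sum_(d < fND) d * fu d =
  \sum_(c < V * 8) fact c * fA c + \sum_(b < fND) b * ft b.
Proof.
pose PX c := fact c && ~~ odd c; pose PY c := fact c && odd c.
have lX c : c < V * 8 -> PX c -> fD c < fND by move=> hc /andP[/(flow_labels hc)[]].
have lX' c : c < V * 8 -> PX c -> fB c < fND by move=> hc /andP[/(flow_labels hc)[]].
have lY c : c < V * 8 -> PY c -> fA c < fNA by move=> hc /andP[/(flow_labels hc)[]].
have e1 : \sum_(d < fND) d * fu d = \sum_(c < V * 8) PX c * fD c.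
  rewrite -(sum_weighted lX); apply: eq_bigr => d _; congr (_ * _).
  by apply: eq_bigr => c _; rewrite /PX andbA.
have e2 : \sum_(b < fND) b * ft b = \sum_(c < V * 8) PX c * fB c.
  rewrite -(sum_weighted lX'); apply: eq_bigr => d _; congr (_ * _).
  by apply: eq_bigr => c _; rewrite /PX andbA.
have e3 : \sum_(a < fNA) a * fs a = \sum_(c < V * 8) PY c * fA c.
  rewrite -(sum_weighted lY).
  have : \sum_(a < fNA) a * (fs a + ((a == 8 * dst + 1 :> nat) + (a == 8 * src :> nat))) =
    \sum_(a < fNA) a * (\sum_(c < V * 8) (PY c && (fA c == a)) +
  ((a == 8 * dst :> nat) + (a == 8 * src + 1 :> nat))).
    apply: eq_bigr => a _; rewrite fs_add; congr (_ * (_ + _)).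
    by apply: eq_bigr => c _; rewrite /PY andbA.
  under eq_bigr do rewrite !mulnDr; under [in RHS]eq_bigr do rewrite !mulnDr.
  by rewrite !big_split /= !sum_at /fNA; lia.
rewrite e1 e2 e3 -!big_split; apply: eq_bigr => c _ /=.
rewrite /PX /PY; case ac: (fact c) => //=.
have [_ _ _ ->] := flow_labels (ltn_ord c) ac.
by case: (odd c); lia.
Qed.

(** An arc outside of [x] has its odd points selected, just as in the reference counts; its
    contribution [S2] cancels. *)
Lemma fA_sum x w a : (forall v r, v < V -> act v -> r < 8 -> w (v * 8 + r) = x v (+) odd r) ->
  a < fNA ->
  (\sum_(c < V * 8) [&& fact c, fA c == a & w c] = fs a) <->
  \sum_(v < V) (act v && x v) * ((8 * l0 v == a) + (8 * l1 v + 4 == a) +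
     (8 * l2 v + 1 == a) + (8 * l3 v + 6 == a)) + ((a == 8 * dst + 1) + (a == 8 * src)) =
  \sum_(v < V) (act v && x v) * ((8 * l0 v + 1 == a) + (8 * l1 v + 6 == a) +
     (8 * l2 v == a) + (8 * l3 v + 4 == a)) + ((a == 8 * dst) + (a == 8 * src + 1)).
Proof.
move=> hw ha.
pose S0 := \sum_(v < V) (act v && x v) * ((8 * l0 v == a) + (8 * l1 v + 4 == a) +
     (8 * l2 v + 1 == a) + (8 * l3 v + 6 == a)).
pose S1 := \sum_(v < V) (act v && x v) * ((8 * l0 v + 1 == a) + (8 * l1 v + 6 == a) +
     (8 * l2 v == a) + (8 * l3 v + 4 == a)).
pose S2 := \sum_(v < V) (act v && ~~ x v) * ((8 * l0 v + 1 == a) + (8 * l1 v + 6 == a) +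
     (8 * l2 v == a) + (8 * l3 v + 4 == a)).
have e1 : \sum_(c < V * 8) [&& fact c, fA c == a & w c] = S0 + S2.
  rewrite (sum_group (fun c => [&& fact c, fA c == a & w c])) -big_split.
  apply: eq_bigr => v _ /=.
  rewrite (sum8 (fun r => [&& fact (v * 8 + r), fA (v * 8 + r) == a & w (v * 8 + r)])).
  rewrite !fact_at // !fA_at //; case av: (act v) => //=.
  rewrite !hw // /ell /= !addn0.
  by case: (x v); rewrite /= ?andbT ?andbF; lia.
have e2 : \sum_(c < V * 8) [&& fact c, odd c & fA c == a] = S1 + S2.
  rewrite (sum_group (fun c => [&& fact c, odd c & fA c == a])) -big_split.
  apply: eq_bigr => v _ /=.
  rewrite (sum8 (fun r => [&& fact (v * 8 + r), odd (v * 8 + r) & fA (v * 8 + r) == a])).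
  rewrite !fact_at // !fA_at // !odd_at; case av: (act v) => //=.
  by rewrite /ell /=; case: (x v); rewrite /= ?addn0; lia.
have := fs_add a; rewrite e1 e2 -/S0 -/S1; lia.
Qed.

(** The residue of [a] modulo 8 separates the laws: 0 and 1 both express the one of the first graph,
    4 and 6 the one of the second, and lines with other residues contain no point. *)
Lemma fA_flow x w : (forall v r, v < V -> act v -> r < 8 -> w (v * 8 + r) = x v (+) odd r) ->
  (forall a, a < fNA -> \sum_(c < V * 8) [&& fact c, fA c == a & w c] = fs a) <->
  common_flow x.
Proof.
move=> hw.
have eqs l (f : nat -> nat) : \sum_(v < V) (act v && x v) * (f v == l) =
   \sum_(v < V) [&& act v, f v == l & x v].
  by apply: eq_bigr => v _; case: (act v); case: (x v); case: (f v == l).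
have z (f : nat -> nat) k a : (forall v, 8 * f v + k != a) ->
   \sum_(v < V) (act v && x v) * (8 * f v + k == a) = 0.
  by move=> h; rewrite big1 // => v _; rewrite (negbTE (h v)) muln0.
have sc (f : nat -> nat) k l : \sum_(v < V) (act v && x v) * (8 * f v + k == 8 * l + k) =
   \sum_(v < V) [&& act v, f v == l & x v].
  rewrite -eqs; apply: eq_bigr => v _; congr (_ * nat_of_bool _); lia.
have dist a : (\sum_(v < V) (act v && x v) * ((8 * l0 v == a) + (8 * l1 v + 4 == a) +
     (8 * l2 v + 1 == a) + (8 * l3 v + 6 == a)) + ((a == 8 * dst + 1) + (a == 8 * src)) =
  \sum_(v < V) (act v && x v) * ((8 * l0 v + 1 == a) + (8 * l1 v + 6 == a) +
     (8 * l2 v == a) + (8 * l3 v + 4 == a)) + ((a == 8 * dst) + (a == 8 * src + 1))) <->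
  (\sum_(v < V) (act v && x v) * (8 * l0 v + 0 == a) +
   \sum_(v < V) (act v && x v) * (8 * l1 v + 4 == a) +
   \sum_(v < V) (act v && x v) * (8 * l2 v + 1 == a) +
   \sum_(v < V) (act v && x v) * (8 * l3 v + 6 == a) +
     ((a == 8 * dst + 1) + (a == 8 * src)) =
   \sum_(v < V) (act v && x v) * (8 * l0 v + 1 == a) +
   \sum_(v < V) (act v && x v) * (8 * l1 v + 6 == a) +
   \sum_(v < V) (act v && x v) * (8 * l2 v + 0 == a) +
   \sum_(v < V) (act v && x v) * (8 * l3 v + 4 == a) +
     ((a == 8 * dst) + (a == 8 * src + 1))).
  rewrite -!big_split /=.
  rewrite (eq_bigr (fun v : 'I_V => (act v && x v) * (8 * l0 v + 0 == a) +
    (act v && x v) * (8 * l1 v + 4 == a) + (act v && x v) * (8 * l2 v + 1 == a) +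
    (act v && x v) * (8 * l3 v + 6 == a))); last by move=> v _; rewrite !mulnDr addn0.
  rewrite [X in _ = X + _](eq_bigr (fun v : 'I_V => (act v && x v) * (8 * l0 v + 1 == a) +
    (act v && x v) * (8 * l1 v + 6 == a) + (act v && x v) * (8 * l2 v + 0 == a) +
    (act v && x v) * (8 * l3 v + 4 == a))) //; by move=> v _; rewrite !mulnDr addn0.
split=> [H l hl|H a ha]; last first.
  apply/(fA_sum hw ha)/dist.
  have hlt : a %/ 8 < NL by rewrite ltn_divLR // mulnC.
  have [q1 q2] := H _ hlt.
  have ea := divn_eq a 8; have hr : a %% 8 < 8 by rewrite ltn_mod.
  move: (a %/ 8) (a %% 8) ea hlt hr q1 q2 => l r -> hlt hr q1 q2; rewrite mulnC.
  have nz (f : nat -> nat) k : k < 8 -> k != r -> \sum_(v < V) (act v && x v) * (8 * f v + k == 8 * l + r) = 0.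
    by move=> hk hkr; apply: z => v; lia.
  have [e|n0] := eqVneq r 0.
    subst r; rewrite !sc !nz //.
    have -> : (8 * l + 0 == 8 * dst + 1) = false by lia.
    have -> : (8 * l + 0 == 8 * src) = (l == src) by lia.
    have -> : (8 * l + 0 == 8 * dst) = (l == dst) by lia.
    have -> : (8 * l + 0 == 8 * src + 1) = false by lia.
    by lia.
  have [e|n1] := eqVneq r 1.
    subst r; rewrite !sc !nz //.
    have -> : (8 * l + 1 == 8 * dst + 1) = (l == dst) by lia.
    have -> : (8 * l + 1 == 8 * src) = false by lia.
    have -> : (8 * l + 1 == 8 * dst) = false by lia.
    have -> : (8 * l + 1 == 8 * src + 1) = (l == src) by lia.
    by lia.
  have -> : (8 * l + r == 8 * dst + 1) = false by lia.
  have -> : (8 * l + r == 8 * src) = false by lia.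
  have -> : (8 * l + r == 8 * dst) = false by lia.
  have -> : (8 * l + r == 8 * src + 1) = false by lia.
  have [e|n4] := eqVneq r 4; first by subst r; rewrite !sc !nz //; lia.
  have [e|n6] := eqVneq r 6; first by subst r; rewrite !sc !nz //; lia.
  by rewrite !nz // eq_sym.
have hlt r : r < 8 -> 8 * l + r < fNA by rewrite /fNA; lia.
have Ha r (hr : r < 8) := (dist _).1 ((fA_sum hw (hlt r hr)).1 (H _ (hlt r hr))).
have nz (f : nat -> nat) k r : k < 8 -> r < 8 -> k != r -> \sum_(v < V) (act v && x v) * (8 * f v + k == 8 * l + r) = 0.
  by move=> hk hr hkr; apply: z => v; lia.
split.
  have := Ha 0 isT; rewrite !sc !nz //.
  have -> : (8 * l + 0 == 8 * dst + 1) = false by lia.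
  have -> : (8 * l + 0 == 8 * src) = (l == src) by lia.
  have -> : (8 * l + 0 == 8 * dst) = (l == dst) by lia.
  have -> : (8 * l + 0 == 8 * src + 1) = false by lia.
  by lia.
have := Ha 4 isT; rewrite !sc !nz //.
have -> : (8 * l + 4 == 8 * dst + 1) = false by lia.
have -> : (8 * l + 4 == 8 * src) = false by lia.
have -> : (8 * l + 4 == 8 * dst) = false by lia.
have -> : (8 * l + 4 == 8 * src + 1) = false by lia.
by lia.
Qed.

Lemma line_sums_of_flow x : common_flow x ->
  line_sums (V * 8) fNA fND fND fact fA fB fD fs ft fu
    (fun c => x (c %/ 8) (+) odd c).
Proof.
move=> hx; set w := fun c => _.
have hw v r : v < V -> act v -> r < 8 -> w (v * 8 + r) = x v (+) odd r.
  by move=> _ _ hr; rewrite /w divnMDl // divn_small // addn0 odd_at.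
split.
- exact/(fA_flow hw).
- move=> b _; rewrite /ft.
  rewrite (sum_group (fun c => [&& fact c, fB c == b & ~~ w c])).
  rewrite (sum_group (fun c => [&& fact c, ~~ odd c & fB c == b])).
  apply: eq_bigr => v _.
  rewrite (sum8 (fun r => [&& fact (v * 8 + r), fB (v * 8 + r) == b & ~~ w (v * 8 + r)])).
  rewrite (sum8 (fun r => [&& fact (v * 8 + r), ~~ odd (v * 8 + r) & fB (v * 8 + r) == b])).
  rewrite !fact_at // !odd_at; case av: (act v) => //=.
  rewrite !hw // /fB !fA_at // !fD_at // /ell /= ?addn0.
  have -> : 8 * (NL.+1 * v.+1) + 1 - (8 * l0 v + 1) = 8 * (NL.+1 * v.+1) - 8 * l0 v by lia.
  have -> : 8 * (NL.+1 * v.+1) + 3 - (8 * l1 v + 6) = 8 * (NL.+1 * v.+1) + 1 - (8 * l1 v + 4) by lia.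
  have -> : 8 * (NL.+1 * v.+1) + 2 - (8 * l2 v) = 8 * (NL.+1 * v.+1) + 3 - (8 * l2 v + 1) by lia.
  have -> : 8 * (NL.+1 * v.+1) - (8 * l3 v + 4) = 8 * (NL.+1 * v.+1) + 2 - (8 * l3 v + 6) by lia.
  by case: (x v); rewrite /= ?andbT ?andbF; lia.
- move=> d _; rewrite /fu.
  rewrite (sum_group (fun c => [&& fact c, fD c == d & ~~ w c])).
  rewrite (sum_group (fun c => [&& fact c, ~~ odd c & fD c == d])).
  apply: eq_bigr => v _.
  rewrite (sum8 (fun r => [&& fact (v * 8 + r), fD (v * 8 + r) == d & ~~ w (v * 8 + r)])).
  rewrite (sum8 (fun r => [&& fact (v * 8 + r), ~~ odd (v * 8 + r) & fD (v * 8 + r) == d])).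
  rewrite !fact_at // !odd_at; case av: (act v) => //=.
  rewrite !hw //= !fD_at //=.
  by case: (x v); rewrite /= ?andbT ?andbF; lia.
Qed.

Lemma mul_lt_gap k v v' : v < v' -> k * v.+1 + k <= k * v'.+1.
Proof. by move=> h; rewrite addnC -mulnS leq_mul2l ltnS h orbT. Qed.

Lemma fD_inj v v' r r' : r < 8 -> r' < 8 -> fD (v * 8 + r) = fD (v' * 8 + r') ->
  v = v' /\ nth 0 offD r = nth 0 offD r'.
Proof.
move=> hr hr'; rewrite !fD_at // => e.
have := offD_lt r; have := offD_lt r' => h1 h2.
have [l|l|ev] := ltngtP v v'.
- by have := mul_lt_gap NL.+1 l; lia.
- by have := mul_lt_gap NL.+1 l; lia.
by split=> //; rewrite ev in e; lia.
Qed.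

(** Different arcs are separated by size; within an arc the differences of the offsets are distinct
    modulo 8 for the four pairs, while the node labels enter with the factor 8. *)
Lemma fB_inj v v' r r' : v < V -> v' < V -> act v -> act v' -> r < 8 -> r' < 8 ->
  fB (v * 8 + r) = fB (v' * 8 + r') -> v = v' /\ r %/ 2 = r' %/ 2.
Proof.
move=> hv hv' av av' hr hr'; rewrite /fB !fD_at // !fA_at // => e.
have := ell_lt hr hv av; have := ell_lt hr' hv' av'.
move: (ell r v) (ell r' v') e => L L' e hL hL'.
have h1 : NL.+1 <= NL.+1 * v.+1 by rewrite leq_pmulr.
have h2 : NL.+1 <= NL.+1 * v'.+1 by rewrite leq_pmulr.
have g1 := offA_lt7 r; have g2 := offA_lt7 r'.
have k1 := offD_lt r; have k2 := offD_lt r'.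
have [l|l|ev] := ltngtP v v'.
- have := mul_lt_gap NL.+1 l; move: (NL.+1 * v.+1) (NL.+1 * v'.+1) e h1 h2 => P P' e h1 h2 h3.
  by exfalso; lia.
- have := mul_lt_gap NL.+1 l; move: (NL.+1 * v.+1) (NL.+1 * v'.+1) e h1 h2 => P P' e h1 h2 h3.
  by exfalso; lia.
split=> //; rewrite ev in e; move: (NL.+1 * v'.+1) e h2 => P e h2.
clear g1 k1 g2 k2.
do 8?[case: r e hr => [|r] e hr //]; do 8?[case: r' e hr' => [|r'] e hr' //];
  rewrite /= in e; exfalso; lia.
Qed.

(** The lines of the second and third direction link the eight points of an arc into a cycle along
    which selection alternates, so the point 0 decides for the arc. *)
Lemma flow_of_line_sums w :
  line_sums (V * 8) fNA fND fND fact fA fB fD fs ft fu w ->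
  exists x, common_flow x.
Proof.
move=> [hA hB hD].
have lt8 v r : v < V -> r < 8 -> v * 8 + r < V * 8 by lia.
have cE c : c = c %/ 8 * 8 + c %% 8 by rewrite -divn_eq.
(* The line contains just these two points, one of them even, so the prescribed number of unselected
   points on it is 1. The same argument serves for [pairD]. *)
have pairB v r : v < V -> act v -> r < 8 -> ~~ odd r -> w (v * 8 + r.+1) = ~~ w (v * 8 + r).
  move=> hv av hr ho; have hr1 : r.+1 < 8 by lia.
  have [_ lB _ _] := flow_labels (lt8 v r hv hr) (etrans (fact_at v hr) av).
  have [_ lB1 _ _] := flow_labels (lt8 v r.+1 hv hr1) (etrans (fact_at v hr1) av).
  have eB : fB (v * 8 + r.+1) = fB (v * 8 + r).
    rewrite /fB !fD_at // !fA_at //.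
    clear lB lB1; by do 8?[case: r ho hr hr1 => [|r] ho hr hr1 //]; rewrite /ell /=; lia.
  have other c : c < V * 8 -> fact c -> fB c = fB (v * 8 + r) ->
      (c == v * 8 + r) || (c == v * 8 + r.+1).
    move=> hc ac; rewrite (cE c); have hcv := arc_lt hc; have hcr := ltn_pmod c (isT : 0 < 8).
    move=> e; have [e1 e2] := fB_inj hcv hv ac av hcr hr e.
    by rewrite e1; move: (c %% 8) e2 ho; lia.
  have := hB _ lB; rewrite /ft.
  rewrite (@sum_two (fun c => [&& fact c, fB c == fB (v * 8 + r) & ~~ w c]) _ (v * 8 + r) (v * 8 + r.+1));
    rewrite ?lt8 //; first last.
  - by move=> c hc /and3P[ac /eqP e _]; apply: other.
  - by lia.
  rewrite (@sum_two (fun c => [&& fact c, ~~ odd c & fB c == fB (v * 8 + r)]) _ (v * 8 + r) (v * 8 + r.+1));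
    rewrite ?lt8 //; first last.
  - by move=> c hc /and3P[ac _ /eqP e]; apply: other.
  - by lia.
  rewrite !fact_at // av eB eqxx !odd_at /= ho /= .
  by case: (w _); case: (w _).
have pairD v r r' : v < V -> act v -> (r, r') \in [:: (1, 2); (3, 4); (5, 6); (7, 0)] ->
    w (v * 8 + r') = ~~ w (v * 8 + r).
  move=> hv av hp; have [hr hr'] : r < 8 /\ r' < 8.
    by move: hp; rewrite !inE !xpair_eqE; lia.
  have [ho ho'] : odd r /\ ~~ odd r'.
    by move: hp; rewrite !inE !xpair_eqE => /orP[/andP[/eqP-> /eqP->]|/orP[/andP[/eqP-> /eqP->]|/orP[/andP[/eqP-> /eqP->]|/andP[/eqP-> /eqP->]]]].
  have [_ _ lD _] := flow_labels (lt8 v r hv hr) (etrans (fact_at v hr) av).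
  have eD : fD (v * 8 + r') = fD (v * 8 + r).
    rewrite !fD_at //; congr (_ + _).
    by move: hp; rewrite !inE !xpair_eqE => /orP[/andP[/eqP-> /eqP->]|/orP[/andP[/eqP-> /eqP->]|/orP[/andP[/eqP-> /eqP->]|/andP[/eqP-> /eqP->]]]].
  have other c : c < V * 8 -> fact c -> fD c = fD (v * 8 + r) ->
      (c == v * 8 + r) || (c == v * 8 + r').
    move=> hc ac; rewrite (cE c); have hcr := ltn_pmod c (isT : 0 < 8).
    move=> e; have [e1 e2] := fD_inj hcr hr e.
    rewrite e1 !eqn_add2l; move: (c %% 8) hcr e2 hp => q hq e2 hp.
    move: e2; move: hp; rewrite !inE !xpair_eqE => /orP[/andP[/eqP-> /eqP->]|/orP[/andP[/eqP-> /eqP->]|/orP[/andP[/eqP-> /eqP->]|/andP[/eqP-> /eqP->]]]];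
    by do 8?[case: q hq => [|q] hq //].
  have := hD _ lD; rewrite /fu.
  have ne : v * 8 + r != v * 8 + r' by rewrite eqn_add2l; apply/eqP => e; rewrite e (negbTE ho') in ho.
  rewrite (@sum_two (fun c => [&& fact c, fD c == fD (v * 8 + r) & ~~ w c]) _ (v * 8 + r) (v * 8 + r'));
    rewrite ?lt8 //; last first.
    by move=> c hc /and3P[ac /eqP e _]; apply: other.
  rewrite (@sum_two (fun c => [&& fact c, ~~ odd c & fD c == fD (v * 8 + r)]) _ (v * 8 + r) (v * 8 + r'));
    rewrite ?lt8 //; last first.
    by move=> c hc /and3P[ac _ /eqP e]; apply: other.
  rewrite !fact_at // av eD eqxx !odd_at /= ho ho' /=.
  by case: (w _); case: (w _).
exists (fun v => w (v * 8 + 0)).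
apply/(@fA_flow _ w) => // v r hv av hr.
have w1 := pairB v 0 hv av isT isT; have w2 := pairD v 1 2 hv av isT.
have w3 := pairB v 2 hv av isT isT; have w4 := pairD v 3 4 hv av isT.
have w5 := pairB v 4 hv av isT isT; have w6 := pairD v 5 6 hv av isT.
have w7 := pairB v 6 hv av isT isT.
do 8?[case: r hr => [|r] hr //]; rewrite ?w7 ?w6 ?w5 ?w4 ?w3 ?w2 ?w1 /=;
  by case: (w (v * 8 + 0)).
Qed.

Definition flow_instance : instance 2 :=
  let m := fNA + fND + fND + V * 8 in
  let RH := pRH (V * 8) fNA fND fND fact fA fD fs fu in
  let RV := pRV (V * 8) fNA fND fND fact fB fD ft fu in
  let CH := pCH (V * 8) fNA fND fact fA fD in
  let CV := pCV (V * 8) fact fB fD in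
  Instance (\matrix_(i < m.*2, k < 2) block_margin RH RV i k)
           (\matrix_(j < m.*2, k < 2) block_margin CH CV j k).

Lemma flow_consistent :
  consistent dominoes flow_instance <-> exists x, common_flow x.
Proof.
split=> [/block_consistent/lines_of_matrices|[x hx]].
  move=> H; have [w hw] := H flow_labels flow_balance.
  exact: flow_of_line_sums hw.
apply/block_consistent; apply: matrices_of_lines (line_sums_of_flow hx).
exact: flow_labels.
Qed.

End Flow.

(** * Tile assignments *)

Lemma divmod_pair M p r : r < M -> (p * M + r) %/ M = p /\ (p * M + r) %% M = r.
Proof.
move=> h; have hM : 0 < M by case: M h.
by rewrite divnMDl // modnMDl divn_small // modn_small // addn0.
Qed.

Lemma eqn_pair M p r p' r' : r < M -> r' < M ->
  (p * M + r == p' * M + r') = (p == p') && (r == r').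
Proof.
move=> h h'; apply/eqP/andP => [e|[/eqP-> /eqP->] //].
have [d1 m1] := divmod_pair p h; have [d2 m2] := divmod_pair p' h'.
by split; apply/eqP; [rewrite -d1 e d2 | rewrite -m1 e m2].
Qed.

Lemma sum_pick (node c : nat -> nat) N i p0 : p0 < N -> node p0 = i ->
  (forall p, p < N -> node p = i -> p = p0) ->
  \sum_(p < N) (node p == i) * c p = c p0.
Proof.
move=> h0 e h; rewrite (bigD1 (Ordinal h0)) //= e eqxx mul1n big1 ?addn0 // => p.
rewrite -val_eqE /=; case: (eqVneq (node p) i) => // e'.
by rewrite (h p (ltn_ord p) e') eqxx.
Qed.

Lemma sum_unique (P : nat -> bool) n i : \sum_(j < n) P j = 1 -> i < n -> P i ->
  forall Q : nat -> bool, \sum_(j < n) (P j && Q j) = Q i.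
Proof.
move=> h hi Pi Q; pose o := Ordinal hi.
have h1 : \sum_(j < n | j != o) P j = 0.
  by move: h; rewrite (bigD1 o) //= Pi /= add1n => -[].
rewrite (bigD1 o) //= Pi /= big1 ?addn0 // => j hj.
move/eqP: h1; rewrite sum_nat_eq0 => /forallP/(_ j).
by rewrite hj /= eqb0 => /negbTE ->.
Qed.

Lemma sum_has (P : nat -> bool) n : 0 < \sum_(j < n) P j -> has P (iota 0 n).
Proof.
rewrite lt0n; apply: contraR => /hasPn h; rewrite big1 // => i _.
by apply/eqP; rewrite eqb0; apply: h; rewrite mem_iota /=.
Qed.

Section CSP.
Variables (N M K : nat) (allowed : nat -> nat -> bool).
Variables (f1 g1 f2 g2 : nat -> nat -> nat) (dn up : nat -> nat).

(* The place [p] carries a tile [s p]; its right colour must agree with the left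
   colour of the tile at [p.+1], and its bottom colour with the top colour of the
   tile at [dn p]. *)
Definition tile_assignment (s : nat -> nat) : Prop := forall p, p < N ->
  [/\ s p < M, allowed p (s p),
      p.+1 < N -> f1 p (s p) = g1 p.+1 (s p.+1) &
      f2 p (s p) = g2 (dn p) (s (dn p))].

(** The arc [p * M + r] is the tile [r] at the place [p], and the node [p * K + k] is the colour [k]
    on the left of [p] in the first graph and on top of [p] in the second. The additional place [N]
    is where the path ends; as both outer colours are 0, the source is the node 0 and the target
    [N * K]. *)
Definition cV := N * M.
Definition cNL := N.+1 * K.
Definition cact v := allowed (v %/ M) (v %% M).
Definition cl0 v := (v %/ M).+1 * K + f1 (v %/ M) (v %% M).
Definition cl1 v := dn (v %/ M) * K + f2 (v %/ M) (v %% M).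
Definition cl2 v := v %/ M * K + g1 (v %/ M) (v %% M).
Definition cl3 v := v %/ M * K + g2 (v %/ M) (v %% M).

Hypothesis N_gt0 : 0 < N.
Hypothesis colours : forall p r, p < N -> r < M ->
  [/\ f1 p r < K, g1 p r < K, f2 p r < K & g2 p r < K].
Hypothesis g1_first : forall r, g1 0 r = 0.
Hypothesis f1_last : forall r, f1 N.-1 r = 0.
Hypothesis first_allowed : exists2 r, r < M & allowed 0 r.
Hypothesis last_allowed : exists2 r, r < M & allowed N.-1 r.
Hypothesis dn_lt : forall p, p < N -> dn p < N.
Hypothesis up_lt : forall p, p < N -> up p < N.
Hypothesis dnK : forall p, p < N -> up (dn p) = p.
Hypothesis upK : forall p, p < N -> dn (up p) = p.

Lemma csp_arcs v : v < cV -> cact v ->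
  [/\ cl0 v < cNL, cl1 v < cNL, cl2 v < cNL & cl3 v < cNL].
Proof.
rewrite /cV /cl0 /cl1 /cl2 /cl3 /cNL => hv _.
have M0 : 0 < M by case: M hv => //; rewrite muln0.
have hp : v %/ M < N by rewrite ltn_divLR.
have hr : v %% M < M by rewrite ltn_mod.
have [c1 c2 c3 c4] := colours hp hr.
have hd := dn_lt hp.
have lt i c : i <= N -> c < K -> i * K + c < N.+1 * K.
  move=> hi hc; rewrite mulSn addnC; apply: leq_trans (_ : K + i * K <= _).
    by rewrite ltn_add2r.
  by rewrite leq_add2l leq_mul2r hi orbT.
by split; apply: lt => //; apply: ltnW.
Qed.

Definition cnt (h : nat -> nat -> nat) (x : nat -> bool) p k : nat :=
  \sum_(r < M) [&& allowed p r, h p r == k & x (p * M + r)].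

Lemma flow_sum (h : nat -> nat -> nat) (node : nat -> nat) (x : nat -> bool) i k : k < K ->
  (forall p r, p < N -> r < M -> h p r < K) ->
  \sum_(v < cV) [&& cact v, node (v %/ M) * K + h (v %/ M) (v %% M) == i * K + k & x v] =
  \sum_(p < N) (node p == i) * cnt h x p k.
Proof.
move=> hk hh; rewrite /cV.
rewrite (sum_group (fun v => [&& cact v, node (v %/ M) * K + h (v %/ M) (v %% M) == i * K + k & x v])).
apply: eq_bigr => p _; rewrite /cnt big_distrr; apply: eq_bigr => r _ /=.
have [e1 e2] := divmod_pair p (ltn_ord r).
rewrite /cact e1 e2 eqn_pair ?hh //.
by case: (node p == i); rewrite ?mul1n ?mul0n /= ?andbF.
Qed.

Lemma csp_flowE (x : nat -> bool) : common_flow cV cNL cact cl0 cl1 cl2 cl3 0 (N * K) x <->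
  forall i k, i <= N -> k < K ->
  (if 0 < i then cnt f1 x i.-1 k else 0) + ((i == 0) && (k == 0)) =
  (if i < N then cnt g1 x i k else 0) + ((i == N) && (k == 0)) /\
  (i < N -> cnt f2 x (up i) k = cnt g2 x i k).
Proof.
have c1 p r (hp : p < N) (hr : r < M) : f1 p r < K by case: (colours hp hr).
have c2 p r (hp : p < N) (hr : r < M) : g1 p r < K by case: (colours hp hr).
have c3 p r (hp : p < N) (hr : r < M) : f2 p r < K by case: (colours hp hr).
have c4 p r (hp : p < N) (hr : r < M) : g2 p r < K by case: (colours hp hr).
have e0 i k : i <= N -> k < K ->
   \sum_(v < cV) [&& cact v, cl0 v == i * K + k & x v] = if 0 < i then cnt f1 x i.-1 k else 0.
  move=> hi hk; rewrite (@flow_sum f1 S) //; case: posnP => [->|i0].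
    by rewrite big1 // => p _; rewrite eq_sym.
  rewrite (@sum_pick S (fun p => cnt f1 x p k) N i i.-1) ?prednK //.
  by move=> p hp <-.
have e2 i k : i <= N -> k < K ->
   \sum_(v < cV) [&& cact v, cl2 v == i * K + k & x v] = if i < N then cnt g1 x i k else 0.
  move=> hi hk; rewrite (@flow_sum g1 id) //; case: ltnP => [iN|iN].
    by rewrite (@sum_pick id (fun p => cnt g1 x p k) N i i).
  by rewrite big1 // => p _; case: eqP => // e; have := ltn_ord p; rewrite e ltnNge iN.
have e1 i k : i <= N -> k < K ->
   \sum_(v < cV) [&& cact v, cl1 v == i * K + k & x v] = if i < N then cnt f2 x (up i) k else 0.
  move=> hi hk; rewrite (@flow_sum f2 dn) //; case: ltnP => [iN|iN].
    rewrite (@sum_pick dn (fun p => cnt f2 x p k) N i (up i)) ?up_lt ?upK //.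
    by move=> p hp <-; rewrite dnK.
  rewrite big1 // => p _; case: eqP => // e; have := dn_lt (ltn_ord p).
  by rewrite e ltnNge iN.
have e3 i k : i <= N -> k < K ->
   \sum_(v < cV) [&& cact v, cl3 v == i * K + k & x v] = if i < N then cnt g2 x i k else 0.
  move=> hi hk; rewrite (@flow_sum g2 id) //; case: ltnP => [iN|iN].
    by rewrite (@sum_pick id (fun p => cnt g2 x p k) N i i).
  by rewrite big1 // => p _; case: eqP => // e; have := ltn_ord p; rewrite e ltnNge iN.
have es i k : k < K -> (i * K + k == 0) = (i == 0) && (k == 0).
  by move=> hk; rewrite -[0]/(0 * K + 0) eqn_pair //; case: K hk.
have ed i k : k < K -> (i * K + k == N * K) = (i == N) && (k == 0).
  by move=> hk; rewrite -[N * K]addn0 eqn_pair //; case: K hk.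
split=> [H i k hi hk|H l hl].
  have hl : i * K + k < cNL.
    by rewrite /cNL mulSn addnC; apply: leq_trans (_ : K + i * K <= _); rewrite ?ltn_add2r // leq_add2l leq_mul2r hi orbT.
  have [] := H _ hl; rewrite e0 // e1 // e2 // e3 // es // ed //.
  by move=> q1 q2; split=> // iN; move: q2; rewrite iN.
have K0 : 0 < K.
  by move: hl; rewrite /cNL lt0n; apply: contraTneq => ->; rewrite muln0.
have hk : l %% K < K by rewrite ltn_mod.
have hi : l %/ K <= N by rewrite -ltnS ltn_divLR.
have [q1 q2] := H _ _ hi hk.
rewrite (divn_eq l K) e0 // e1 // e2 // e3 // es // ed //; split=> //.
by case: ltnP.
Qed.

(** Whichever colour is used for counting, the total is the number of chosen tiles at [p]; this
    carries that number across neighbouring places. *)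
Lemma cnt_total (h : nat -> nat -> nat) (x : nat -> bool) p : p < N ->
  (forall r, r < M -> h p r < K) ->
  \sum_(k < K) cnt h x p k = \sum_(r < M) (allowed p r && x (p * M + r)).
Proof.
move=> hp hh; rewrite /cnt exchange_big /=; apply: eq_bigr => r _.
have hr := hh r (ltn_ord r).
rewrite (bigD1 (Ordinal hr)) //= eqxx big1 ?addn0 //.
by move=> k; rewrite -val_eqE /= eq_sym => /negbTE ->; rewrite andbF.
Qed.

Lemma flow_assignment :
  (exists x, common_flow cV cNL cact cl0 cl1 cl2 cl3 0 (N * K) x) <->
  exists s, tile_assignment s.
Proof.
split=> [[x /csp_flowE H]|[s H]]; last first.
  exists (fun v => s (v %/ M) == v %% M).
  have cntE h p k : p < N -> cnt h (fun v => s (v %/ M) == v %% M) p k = (h p (s p) == k).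
    move=> hp; have [sM sa _ _] := H p hp; rewrite /cnt.
    rewrite (bigD1 (Ordinal sM)) //=; have [-> ->] := divmod_pair p sM.
    rewrite sa eqxx andbT /= big1 ?addn0 // => r; rewrite -val_eqE /= => hr.
    have [-> ->] := divmod_pair p (ltn_ord r).
    by rewrite [s p == _]eq_sym (negbTE hr) !andbF.
  apply/csp_flowE => i k hi hk; split; last first.
    move=> iN; rewrite !cntE ?up_lt //.
    by have [_ _ _ ->] := H _ (up_lt iN); rewrite upK.
  case: (posnP i) => [->|i0].
    by rewrite N_gt0 cntE // g1_first /= [0 == N]ltn_eqF // eq_sym addn0.
  rewrite /= addn0 cntE; last by lia.
  case: ltnP => iN.
    rewrite cntE // [i == N]ltn_eqF // addn0.
    have [_ _ q _] := H i.-1 (ltac:(lia)); rewrite prednK // in q.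
    by rewrite q.
  have -> : i = N by lia.
  by rewrite eqxx /= f1_last eq_sym.
pose P p r := allowed p r && x (p * M + r).
have c1 p r (hp : p < N) (hr : r < M) : f1 p r < K by case: (colours hp hr).
have c2 p r (hp : p < N) (hr : r < M) : g1 p r < K by case: (colours hp hr).
have c3 p r (hp : p < N) (hr : r < M) : f2 p r < K by case: (colours hp hr).
have c4 p r (hp : p < N) (hr : r < M) : g2 p r < K by case: (colours hp hr).
have cntP h p k : cnt h x p k = \sum_(r < M) (P p r && (h p r == k)).
  by apply: eq_bigr => r _; rewrite /P; case: (allowed p r); case: (x _); case: (h p r == k).
(* The unit entering at the source puts one tile at the place 0; summing the horizontal law over all
   colours passes the number on to the next place. *)
have one p : p < N -> \sum_(r < M) P p r = 1.
  elim: p => [|p IH] hp.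
    have [r0 hr0 _] := first_allowed.
    have K0 : 0 < K by apply: leq_trans (c1 _ _ hp hr0).
    have [q _] := H 0 0 (leq0n _) K0.
    move: q; rewrite /= add0n hp [0 == N]ltn_eqF // addn0 cntP => ->.
    by apply: eq_bigr => r _; rewrite g1_first eqxx andbT.
  have hp' : p < N by apply: ltnW.
  rewrite -(IH hp') -(@cnt_total g1) // -?(@cnt_total f1) //; [ | by move=> r hr; apply: c1 | by move=> r hr; apply: c2].
  apply: eq_bigr => k _; have [q _] := H p.+1 k (ltnW hp) (ltn_ord k).
  by move: q; rewrite /= hp [p.+1 == N]ltn_eqF // !addn0.
pose s p := find (P p) (iota 0 M).
have hs p : p < N -> [/\ s p < M, allowed p (s p) &
    forall Q : nat -> bool, \sum_(j < M) (P p j && Q j) = Q (s p)].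
  move=> hp; have hh : has (P p) (iota 0 M) by apply: sum_has; rewrite one.
  have sM : s p < M by rewrite -[M](size_iota 0) -has_find.
  have Ps : P p (s p) by have := nth_find 0 hh; rewrite nth_iota.
  by split=> //; [case/andP: Ps | apply: sum_unique => //; apply: one].
exists s => p hp; have [sM sa sQ] := hs p hp; split=> //.
  move=> hp1; have [sM1 _ sQ1] := hs _ hp1.
  have hk := c1 p (s p) hp sM.
  have [q _] := H p.+1 _ (ltnW hp1) hk; move: q.
  rewrite /= hp1 [p.+1 == N]ltn_eqF // !addn0 !cntP.
  rewrite (sQ (fun r => f1 p r == _)) (sQ1 (fun r => g1 p.+1 r == _)) eqxx.
  by case: eqP.
have [sM2 _ sQ2] := hs _ (dn_lt hp).
have hk := c3 p (s p) hp sM.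
have [_ /(_ (dn_lt hp))] := H (dn p) _ (ltnW (dn_lt hp)) hk.
rewrite dnK // !cntP (sQ (fun r => f2 p r == _)) (sQ2 (fun r => g2 (dn p) r == _)) eqxx.
by case: eqP.
Qed.

Lemma csp_src_arc : exists v, [/\ v < cV, cact v & cl2 v = 0].
Proof.
have [r hr ar] := first_allowed; exists (0 * M + r).
have [e1 e2] := divmod_pair 0 hr.
rewrite /cV /cact /cl2 e1 e2 g1_first; split=> //.
by rewrite mul0n add0n; apply: leq_trans hr _; rewrite leq_pmull.
Qed.

Lemma csp_dst_arc : exists v, [/\ v < cV, cact v & cl0 v = N * K].
Proof.
have [r hr ar] := last_allowed; exists (N.-1 * M + r).
have [e1 e2] := divmod_pair N.-1 hr.
rewrite /cV /cact /cl0 e1 e2 f1_last prednK // addn0; split=> //.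
by rewrite -[in X in _ < X](prednK N_gt0) mulSn addnC ltn_add2r.
Qed.

Definition csp_instance : instance 2 :=
  flow_instance cV cNL cact cl0 cl1 cl2 cl3 0 (N * K).

Lemma csp_consistent :
  consistent dominoes csp_instance <-> exists s, tile_assignment s.
Proof.
rewrite -flow_assignment; apply: flow_consistent.
- exact: csp_arcs.
- have [r hr _] := first_allowed; have [c1 _ _ _] := colours N_gt0 hr.
  by rewrite /cNL muln_gt0 /=; apply: leq_trans c1.
- have [r hr _] := first_allowed; have [c1 _ _ _] := colours N_gt0 hr.
  by rewrite /cNL ltn_mul2r ltnS leqnn andbT; apply: leq_trans c1.
- exact: csp_src_arc.
- exact: csp_dst_arc.
Qed.

End CSP.

(** * Computation tableaux *)

Lemma code_inj (C : finType) (c d : C) :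
  (enum_rank c : nat) = enum_rank d -> c = d.
Proof. by move/val_inj/enum_rank_inj. Qed.

Section Tableau.
Variable M : machine.

Definition tvec : finType := {ffun 'I_(ntapes M).+1 -> symbol (aux M)}.
Definition blank : tvec := [ffun=> None].

(* State, scanned symbols, and the symbols at the left neighbour of a position,
   at the position and at its right neighbour; positions are relative to the
   heads. *)
Definition ttile : finType := (state M * tvec * tvec * tvec * tvec)%type.
Definition tq (t : ttile) := t.1.1.1.1.
Definition tsc (t : ttile) := t.1.1.1.2.
Definition tl (t : ttile) := t.1.1.2.
Definition tm (t : ttile) := t.1.2.
Definition tr (t : ttile) := t.2.

Definition nexq (q : state M) (s : tvec) : state M :=
  if halting q then q else (delta q s).1.

(** The flags tell whether the position is 0, -1 or 1. As positions are relative to the head, a head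
    moving left brings the old content of [z - 1] to [z], which is the newly written symbol exactly
    for [z = 1]; symmetrically for a move to the right. *)
Definition nexv (c0 cm cp : bool) (q : state M) (s l m r : tvec) : tvec :=
  if halting q then m else
  [ffun i => let a := (delta q s).2 i in
    match a.2 with
    | MoveL => if cp then a.1 else l i
    | Stay => if c0 then a.1 else m i
    | MoveR => if cm then a.1 else r i
    end].

Definition cvec (c : config M) (z : int) : tvec := [ffun i => cell_at (ctapes c i) z].

Lemma cvec0 (c : config M) : [ffun i => scanned (ctapes c i)] = cvec c 0%R.
Proof. by apply/ffunP => i; rewrite !ffunE. Qed.

Lemma step_state (c : config M) : cstate (step c) = nexq (cstate c) (cvec c 0%R).
Proof. by rewrite /step /nexq cvec0; case: ifP => // _; case: delta. Qed.

Lemma step_cvec (c : config M) (z : int) : cvec (step c) z =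
  nexv (z == 0%R) (z == (-1)%R) (z == 1%R) (cstate c) (cvec c 0%R)
    (cvec c (z - 1)%R) (cvec c z) (cvec c (z + 1)%R).
Proof.
rewrite /step /nexv cvec0; case: ifP => // _.
case: delta => q act; apply/ffunP => i; cbn [snd]; rewrite !ffunE; cbn [ctapes]; rewrite ?ffunE.
case: (act i) => a d; cbn [fst snd]; rewrite cell_at_move cell_at_write.
case: d => /=; rewrite ?addr0 //.
- by rewrite (_ : (z + -1 == 0)%R = (z == 1%R)) //; lia.
- by rewrite (_ : (z + 1 == 0)%R = (z == (-1)%R)) //; lia.
Qed.

Notation conf w t := (iter t (@step M) (init_config M w)).

Lemma init_cvec w z i : cvec (init_config M w) z i =
  if (i == ord0) then
    if z is Posz k then nth None [seq Some (inl b) | b <- w] k else None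
  else None.
Proof.
rewrite /cvec /init_config !ffunE cell_at_word; case: eqP => // _.
by case: z => // k; rewrite nth_nil.
Qed.

(** In each step the used part of a tape extends by at most one cell on either side, relative to the
    head. *)
Lemma cvec_support w t (z : int) : (z < - Posz t)%R || (Posz (size w + t) < z)%R ->
  cvec (conf w t) z = blank.
Proof.
elim: t z => [|t IH] z hz.
  apply/ffunP => i; rewrite /= init_cvec ffunE; case: eqP => // _.
  case: z hz => // k hk; rewrite nth_default // size_map; lia.
rewrite iterS step_cvec /nexv.
have -> : (z == 0%R) = false by lia.
have -> : (z == (-1)%R) = false by lia.
have -> : (z == 1%R) = false by lia.
rewrite (IH z) ?(IH (z - 1)%R) ?(IH (z + 1)%R); [ | lia | lia | lia].
case: ifP => // _; apply/ffunP => i; rewrite !ffunE.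
by case: ((delta _ _).2 i) => a [].
Qed.

(** [isb] marks the cells of the delimited input, with bit [b]. [fr] marks those of the certificate,
    which is left open: no work symbols, and a blank is followed by a blank, so that the content is
    a word of arbitrary length up to [P]. *)
Definition inirow (fr isb b : bool) (t : ttile) : bool :=
  [forall i, if i == ord0 then
      if isb then tm t i == Some (inl b)
      else if fr then (if tm t i is Some (inr _) then false else true) &&
        ((tm t i == None) ==> (tr t i == None))
      else tm t i == None
    else tm t i == None].

(** The flags are first row, last row, left border, right border and head column. Every tile of a
    row carries a guess of the scanned symbols, which is verified in the head column; in the last
    row the head column also checks acceptance. *)
Definition allow (t0 tT jl jr jc fr isb b : bool) (t : ttile) : bool :=
  [&& jc ==> (tm t == tsc t), jl ==> (tl t == blank), jr ==> (tr t == blank),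
      t0 ==> ((tq t == start M) && inirow fr isb b t) &
      (tT && jc) ==> (tsc t ord_max == Some (inl true))].

Definition tdflt : ttile := (start M, blank, blank, blank, blank).
Definition tnat (r : nat) : ttile := nth tdflt (enum ttile) r.

Lemma tnatK (t : ttile) : tnat (enum_rank t) = t.
Proof. exact: nth_enum_rank. Qed.

Definition tM : nat := #|ttile|.
Definition tc1 : finType := (state M * tvec * tvec * tvec)%type.
Definition tc2 : finType := (state M * tvec)%type.
Definition tK : nat := #|tc1| + #|tc2|.

Variables (x : seq bool) (P T W : nat).

Definition tWd := W * 2 + 1.
Definition tN := T.+1 * tWd.
Definition trow p := p %/ tWd.
Definition tcol p := p %% tWd.
Definition tL := size x * 2 + 1.
Definition dbit k :=
  if k == size x * 2 then false else if odd k then nth false x (k %/ 2) else true.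
Definition tisb p := (W <= tcol p) && (tcol p < W + tL).
Definition tfr p := (W + tL <= tcol p) && (tcol p < W + tL + P).
Definition tallowed p r :=
  allow (trow p == 0) (trow p == T) (tcol p == 0) (tcol p == W * 2) (tcol p == W)
    (tfr p) (tisb p) (dbit (tcol p - W)) (tnat r).
(** Equality with [left1] of the next tile spreads the state and the scanned symbols over the row
    and makes the windows of neighbours overlap correctly. *)
Definition right1 (t : ttile) : nat := enum_rank ((tq t, tsc t, tm t, tr t) : tc1).
Definition left1 (t : ttile) : nat := enum_rank ((tq t, tsc t, tl t, tm t) : tc1).
Definition bottom2 (c0 cm cp : bool) (t : ttile) : nat :=
  enum_rank ((nexq (tq t) (tsc t),
              nexv c0 cm cp (tq t) (tsc t) (tl t) (tm t) (tr t)) : tc2).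
Definition top2 (t : ttile) : nat := enum_rank ((tq t, tm t) : tc2).
(** The path of places runs through the ends of rows; the colour 0 on both sides of such a passage
    decouples the rows. *)
Definition tf1 p r := if tcol p == W * 2 then 0 else right1 (tnat r).
Definition tg1 p r := if tcol p == 0 then 0 else left1 (tnat r).
Definition tf2 p r := if trow p == T then 0 else
  bottom2 (tcol p == W) ((tcol p).+1 == W) (tcol p == W.+1) (tnat r).
Definition tg2 p r := if trow p == 0 then 0 else top2 (tnat r).
(** The vertical successor has to be a permutation of the places. The last row is followed by the
    first one, and the colour 0 on both sides makes this link vacuous. *)
Definition tdn p := (p + tWd) %% tN.
Definition tup p := (p + (tN - tWd)) %% tN.

Lemma tWd_gt0 : 0 < tWd. Proof. by rewrite /tWd addn1. Qed.
Lemma tN_gt0 : 0 < tN. Proof. by rewrite /tN muln_gt0 tWd_gt0. Qed.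

Lemma tat t j : j < tWd -> trow (t * tWd + j) = t /\ tcol (t * tWd + j) = j.
Proof. exact: divmod_pair. Qed.

Lemma tat_lt t j : t <= T -> j < tWd -> t * tWd + j < tN.
Proof.
move=> ht hj; rewrite /tN mulSn addnC; apply: leq_trans (_ : tWd + t * tWd <= _).
  by rewrite ltn_add2r.
by rewrite leq_add2l leq_mul2r ht orbT.
Qed.

Lemma tplace p : p < tN ->
  [/\ p = trow p * tWd + tcol p, trow p <= T & tcol p < tWd].
Proof.
move=> hp; rewrite /trow /tcol -divn_eq ltn_mod tWd_gt0; split=> //.
by rewrite -ltnS ltn_divLR ?tWd_gt0.
Qed.

Lemma tdn_at t j : t < T -> j < tWd -> tdn (t * tWd + j) = t.+1 * tWd + j.
Proof.
move=> ht hj; rewrite /tdn.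
have -> : t * tWd + j + tWd = t.+1 * tWd + j by rewrite mulSn; lia.
by rewrite modn_small // tat_lt.
Qed.

Lemma tdn_last j : j < tWd -> tdn (T * tWd + j) = j.
Proof.
move=> hj; rewrite /tdn addnAC [T * _ + _]addnC -mulSn modnDl modn_small //.
by have := @tat_lt 0 j (leq0n _) hj.
Qed.

Lemma tcolours p r : p < tN -> r < tM ->
  [/\ tf1 p r < tK, tg1 p r < tK, tf2 p r < tK & tg2 p r < tK].
Proof.
move=> _ _; rewrite /tf1 /tg1 /tf2 /tg2 /tK.
have l1 (c : tc1) : enum_rank c < #|tc1| + #|tc2|.
  by apply: leq_trans (ltn_ord (enum_rank c)) _; rewrite leq_addr.
have l2 (c : tc2) : enum_rank c < #|tc1| + #|tc2|.
  by apply: leq_trans (ltn_ord (enum_rank c)) _; rewrite leq_addl.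
have l0 := leq_ltn_trans (leq0n _) (l2 (start M, blank)).
by split; case: ifP => _ //; rewrite ?/right1 ?/left1 ?/bottom2 ?/top2.
Qed.

Lemma tg1_first r : tg1 0 r = 0.
Proof. by rewrite /tg1 /tcol mod0n. Qed.

Lemma tN_pred : tN.-1 = T * tWd + W * 2.
Proof. by rewrite /tN mulSn /tWd; lia. Qed.

Lemma tf1_last r : tf1 tN.-1 r = 0.
Proof.
by rewrite /tf1 tN_pred; have [|_ ->] := @tat T (W * 2); rewrite ?eqxx // /tWd addn1.
Qed.

Lemma tdn_lt p : p < tN -> tdn p < tN.
Proof. by move=> _; rewrite ltn_mod tN_gt0. Qed.

Lemma tup_lt p : p < tN -> tup p < tN.
Proof. by move=> _; rewrite ltn_mod tN_gt0. Qed.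

Lemma tWd_le : tWd <= tN.
Proof. by rewrite /tN leq_pmull. Qed.

Lemma tdnK p : p < tN -> tup (tdn p) = p.
Proof.
by move=> hp; rewrite /tup /tdn modnDml -addnA subnKC ?tWd_le // modnDr modn_small.
Qed.

Lemma tupK p : p < tN -> tdn (tup p) = p.
Proof.
by move=> hp; rewrite /tup /tdn modnDml -addnA subnK ?tWd_le // modnDr modn_small.
Qed.

Lemma tfirst_allowed : 0 < W -> 0 < T -> exists2 r, r < tM & tallowed 0 r.
Proof.
move=> W0 T0; exists (enum_rank tdflt); first exact: ltn_ord.
rewrite /tallowed tnatK /trow /tcol div0n mod0n /allow /inirow /tfr /tisb /tcol mod0n.
rewrite (leqNgt W) W0 (leqNgt (W + tL)) addn_gt0 W0 /=.
rewrite [0 == W]ltn_eqF // [0 == T]ltn_eqF // !eqxx /= implybT /=.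
by rewrite andbT; apply/forallP => i; rewrite /tdflt /tm /= ffunE eqxx; case: ifP.
Qed.

Lemma tlast_allowed : 0 < W -> 0 < T -> exists2 r, r < tM & tallowed tN.-1 r.
Proof.
move=> W0 T0; exists (enum_rank tdflt); first exact: ltn_ord.
have [|e1 e2] := @tat T (W * 2); first by rewrite /tWd addn1.
rewrite /tallowed tnatK tN_pred e1 e2 /allow.
have -> : (W * 2 == W) = false by lia.
have -> : (T == 0) = false by lia.
by rewrite !eqxx andbF /= implybT.
Qed.

(** Within [T] steps nothing but blanks can appear at the borders of the tableau or beyond, so
    cutting it off there loses nothing. *)
Hypothesis W_large : tL + P + T < W.

Let zc (j : nat) : int := (Posz j - Posz W)%R.

Definition ttile_at w t j : ttile :=
  (cstate (conf w t), cvec (conf w t) 0%R, cvec (conf w t) (zc j - 1)%R,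
   cvec (conf w t) (zc j), cvec (conf w t) (zc j + 1)%R).

Lemma size_pair_word y : size (pair_word x y) = tL + size y.
Proof. by rewrite /pair_word size_cat delimitE size_map size_iota. Qed.

Lemma nth_pair_word y k : nth None [seq Some (inl b) | b <- pair_word x y] k =
  if k < tL then Some (inl (dbit k)) else
  nth None [seq Some (inl b) | b <- y] (k - tL) :> symbol (aux M).
Proof.
rewrite /pair_word map_cat nth_cat size_map delimitE size_map size_iota.
case: ifP => // hk; rewrite -map_comp (nth_map 0) ?size_iota // nth_iota //.
Qed.

Lemma assignment_of_run y : size y <= P ->
  scanned (ctapes (conf (pair_word x y) T) ord_max) = Some (inl true) ->
  exists s, tile_assignment tN tM tallowed tf1 tg1 tf2 tg2 tdn s.
Proof.
move=> hy hacc; set w := pair_word x y in hacc.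
have hw : size w = tL + size y by rewrite size_pair_word.
pose s p : nat := enum_rank (ttile_at w (trow p) (tcol p)).
exists s => p hp.
have [pE ht hj] := tplace hp; set t := trow p in pE ht *; set j := tcol p in pE hj *.
split.
- exact: ltn_ord.
- rewrite /tallowed /s tnatK -/t -/j /allow /tm /tsc /tl /tr /tq /=.
  apply/and5P; split; apply/implyP.
  + by move/eqP=> ej; rewrite /zc ej subrr.
  + move/eqP=> ej; rewrite cvec_support //; rewrite /zc ej; lia.
  + move/eqP=> ej; rewrite cvec_support //; rewrite /zc ej hw; lia.
  + move/eqP=> et; rewrite et /= eqxx /=; apply/forallP => i.
    rewrite /tm /tr /= !init_cvec; case: eqP => [ei|//].
    rewrite /tisb /tfr -/j /zc.
    case: (leqP W j) => hWj /=; last first.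
      have -> : (W + tL <= j) = false by lia.
      have [k ->] : exists k, (Posz j - Posz W)%R = Negz k by exists (W - j.+1); lia.
      by [].
    have -> : (Posz j - Posz W)%R = Posz (j - W) by lia.
    rewrite nth_pair_word.
    have -> : (j < W + tL) = (j - W < tL) by lia.
    case hL: (j - W < tL); first by rewrite eqxx.
    have -> : (W + tL <= j) by lia.
    case: ifP => hP /=.
      apply/andP; split.
        by case: (ltnP (j - W - tL) (size y)) => hs; [rewrite (nth_map false) | rewrite nth_default ?size_map].
      rewrite addn1; apply/implyP; rewrite nth_pair_word.
      have -> : ((j - W).+1 < tL) = false by lia.
      case: (ltnP (j - W - tL) (size y)) => hs; first by rewrite (nth_map false).
      by move=> _; rewrite nth_default // size_map; lia.
    by rewrite nth_default // size_map; lia.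
  + by move=> /andP[/eqP et _]; rewrite ffunE et -hacc.
- move=> hp1; rewrite /tf1 /tg1 -/j.
  have [ej|nj] := eqVneq j (W * 2).
    have e : p.+1 = t.+1 * tWd + 0 by rewrite pE ej mulSn /tWd; lia.
    by rewrite e; have [_ ->] := tat t.+1 tWd_gt0.
  have hj1 : j.+1 < tWd by move: hj nj; rewrite /tWd; lia.
  have e : p.+1 = t * tWd + j.+1 by rewrite pE addnS.
  have [er ec] := tat t hj1.
  rewrite /s e er ec -/t -/j /= !tnatK /right1 /left1 /tm /tsc /tl /tr /tq /=.
  have -> : (zc j.+1 - 1)%R = zc j by rewrite /zc; lia.
  by have -> : zc j.+1 = (zc j + 1)%R by rewrite /zc; lia.
- rewrite /tf2 /tg2 -/t -/j.
  have [et|nt] := eqVneq t T.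
    by rewrite pE et tdn_last //; have [] := tat 0 hj; rewrite mul0n add0n => ->.
  have ht1 : t < T by lia.
  have [er ec] := tat t.+1 hj.
  rewrite /s [in tdn p]pE tdn_at // er ec -/t -/j /= !tnatK /bottom2 /top2 /tm /tsc /tl /tr /tq /=.
  rewrite step_state step_cvec.
  have -> : (zc j == 0%R) = (j == W) by rewrite /zc; lia.
  have -> : (zc j == (-1)%R) = (j.+1 == W) by rewrite /zc; lia.
  by have -> : (zc j == 1%R) = (j == W.+1) by rewrite /zc; lia.
Qed.

(** The local conditions of [inirow] suffice for a list to be a word of bits followed by blanks. *)
Lemma bits_prefix_blank (A : finType) (l : seq (symbol A)) k :
  (forall i, i < size l -> if nth None l i is Some (inr _) then false else true) ->
  (forall i, i.+1 < size l -> nth None l i = None -> nth None l i.+1 = None) ->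
  nth None l k = nth None [seq Some (inl b) | b <- bits_prefix l] k.
Proof.
elim: l k => [|a l IH] k h1 h2 /=; first by rewrite !nth_nil.
case: a h1 h2 => [[b|c]|] h1 h2 /=.
- case: k => //= k; apply: IH => [i hi|i hi]; first exact: (h1 i.+1).
  exact: (h2 i.+1).
- by have := h1 0 isT.
- rewrite nth_nil; case: k => //= k.
  have [hk|hk] := ltnP k (size l); last by rewrite nth_default.
  elim: k hk => [|k IHk] hk; first exact: (h2 0).
  by apply: (h2 k.+1) => //; apply: IHk; apply: ltnW.
Qed.

Lemma size_bits_prefix (A : finType) (l : seq (symbol A)) :
  size (bits_prefix l) <= size l.
Proof. by elim: l => //= -[[b|c]|] l IH. Qed.

(** The certificate is read off from the first row; after that the assignment has no freedom and
    must be the tableau of the run. *)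
Lemma run_of_assignment s :
  tile_assignment tN tM tallowed tf1 tg1 tf2 tg2 tdn s ->
  exists2 y, size y <= P &
  scanned (ctapes (conf (pair_word x y) T) ord_max) = Some (inl true).
Proof.
move=> H; pose th t j := tnat (s (t * tWd + j)).
have Hal t j : t <= T -> j < tWd ->
    allow (t == 0) (t == T) (j == 0) (j == W * 2) (j == W)
     ((W + tL <= j) && (j < W + tL + P)) ((W <= j) && (j < W + tL)) (dbit (j - W)) (th t j).
  move=> ht hj; have [_ + _ _] := H _ (tat_lt ht hj).
  by rewrite /tallowed /tfr /tisb; have [-> ->] := tat t hj.
have Hri t j : t <= T -> j.+1 < tWd ->
    [/\ tq (th t j) = tq (th t j.+1), tsc (th t j) = tsc (th t j.+1),
       tm (th t j) = tl (th t j.+1) & tr (th t j) = tm (th t j.+1)].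
  move=> ht hj1; have hj := ltnW hj1.
  have [_ _ + _] := H _ (tat_lt ht hj).
  have := tat_lt ht hj1; rewrite addnS => -> /(_ isT).
  rewrite /tf1 /tg1 -addnS; have [_ ->] := tat t hj; have [_ ->] := tat t hj1.
  have -> : (j == W * 2) = false by move: hj1; rewrite /tWd; lia.
  by move=> /= /code_inj[].
have Hdn t j : t < T -> j < tWd ->
    tq (th t.+1 j) = nexq (tq (th t j)) (tsc (th t j)) /\
    tm (th t.+1 j) = nexv (j == W) (j.+1 == W) (j == W.+1) (tq (th t j)) (tsc (th t j))
       (tl (th t j)) (tm (th t j)) (tr (th t j)).
  move=> ht hj; have [_ _ _] := H _ (tat_lt (ltnW ht) hj).
  rewrite tdn_at // /tf2 /tg2; have [-> ->] := tat t hj; have [-> _] := tat t.+1 hj.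
  by rewrite ltn_eqF //= => /code_inj[-> ->].
have W0 : W < tWd by rewrite /tWd; lia.
have Hq t j : t <= T -> j < tWd -> tq (th t j) = tq (th t W) /\ tsc (th t j) = tsc (th t W).
  move=> ht.
  have all0 : forall j, j < tWd -> tq (th t j) = tq (th t 0) /\ tsc (th t j) = tsc (th t 0).
    elim=> [//|k IH] hk; have [e1 e2 _ _] := Hri t k ht hk.
    by rewrite -e1 -e2; apply: IH; apply: ltnW.
  by move=> hj; have [-> ->] := all0 j hj; have [-> ->] := all0 W W0.
have Hsc t : t <= T -> tsc (th t W) = tm (th t W).
  by move=> ht; have /and5P[] := Hal t W ht W0; rewrite eqxx /= => /eqP.
pose lst := [seq tm (th 0 (W + tL + k)) ord0 | k <- iota 0 P].
pose y := bits_prefix lst.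
have szl : size lst = P by rewrite size_map size_iota.
have hy : size y <= P by rewrite -szl; apply: size_bits_prefix.
exists y => //; set w := pair_word x y.
have hw : size w = tL + size y by rewrite size_pair_word.
have ini j : j < tWd -> inirow ((W + tL <= j) && (j < W + tL + P)) ((W <= j) && (j < W + tL)) (dbit (j - W)) (th 0 j)
   /\ tq (th 0 j) = start M.
  by move=> hj; have /and5P[_ _ _ + _] := Hal 0 j (leq0n _) hj; rewrite /= => /andP[/eqP].
have lstP k : k < P -> nth None lst k = tm (th 0 (W + tL + k)) ord0.
  by move=> hk; rewrite (nth_map 0) ?size_iota // nth_iota.
have ylst k : nth None lst k = nth None [seq Some (inl b) | b <- y] k.
  apply: bits_prefix_blank => i; rewrite szl => hi.
    rewrite lstP //; have hj : W + tL + i < tWd by rewrite /tWd; lia.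
    have [/forallP/(_ ord0) + _] := ini _ hj; rewrite eqxx.
    have -> : (W <= W + tL + i) && (W + tL + i < W + tL) = false by lia.
    have -> : (W + tL <= W + tL + i) && (W + tL + i < W + tL + P) by lia.
    by case/andP.
  rewrite !lstP //; last by lia.
  have hj : (W + tL + i).+1 < tWd by rewrite /tWd; lia.
  have [/forallP/(_ ord0) + _] := ini _ (ltnW hj); rewrite eqxx.
  have -> : (W <= W + tL + i) && (W + tL + i < W + tL) = false by lia.
  have -> : (W + tL <= W + tL + i) && (W + tL + i < W + tL + P) by lia.
  case/andP=> _ /implyP + e; rewrite e => /(_ isT)/eqP.
  by have [_ _ _ ->] := Hri 0 _ (leq0n _) hj; rewrite -addnS.
(* Only the state and the middle symbols are carried by the induction; the side symbols of a tile
   are middle symbols of its neighbours, or blanks at a border. *)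
have main t : t <= T -> tq (th t W) = cstate (conf w t) /\
    forall j, j < tWd -> tm (th t j) = cvec (conf w t) (zc j).
  elim: t => [|t IH] ht.
    split; first by have [_ ->] := ini W W0.
    move=> j hj; apply/ffunP => i; rewrite /= init_cvec.
    have [/forallP/(_ i) + _] := ini _ hj; case: eqP => [ei|_]; last by move/eqP.
    rewrite /zc; case: (leqP W j) => hWj /=; last first.
      have -> : (W + tL <= j) = false by lia.
      have [k ->] : exists k, (Posz j - Posz W)%R = Negz k by exists (W - j.+1); lia.
      by move/eqP.
    have -> : (Posz j - Posz W)%R = Posz (j - W) by lia.
    rewrite nth_pair_word.
    have -> : (j < W + tL) = (j - W < tL) by lia.
    case: ifP => [_ /eqP //|hL].
    have hWL : W + tL <= j by lia.
    rewrite hWL; case: ltnP => hP /=.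
      move=> _; rewrite -ylst lstP; last by lia.
      by rewrite ei; congr (tm (th 0 _) ord0); lia.
    move/eqP=> ->; rewrite nth_default // size_map; lia.
  have ht' := ltnW ht; have [e1 e2] := IH ht'.
  have esc : tsc (th t W) = cvec (conf w t) 0%R.
    by rewrite Hsc // e2 // /zc subrr.
  split.
    have [-> _] := Hdn t W ht W0.
    by rewrite iterS step_state e1 esc.
  move=> j hj; have [_ ->] := Hdn t j ht hj.
  rewrite iterS step_cvec; have [-> ->] := Hq t j ht' hj.
  rewrite e1 esc e2 //.
  have -> : (zc j == 0%R) = (j == W) by rewrite /zc; lia.
  have -> : (zc j == (-1)%R) = (j.+1 == W) by rewrite /zc; lia.
  have -> : (zc j == 1%R) = (j == W.+1) by rewrite /zc; lia.
  have -> : tl (th t j) = cvec (conf w t) (zc j - 1)%R.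
    case: j hj => [|j] hj.
      have /and5P[_ + _ _ _] := Hal t 0 ht' hj; rewrite eqxx /= => /eqP ->.
      rewrite cvec_support // /zc; lia.
    have [_ _ <- _] := Hri t j ht' hj; rewrite e2; last by apply: ltnW.
    by congr cvec; rewrite /zc; lia.
  have -> // : tr (th t j) = cvec (conf w t) (zc j + 1)%R.
  have [ej|nj] := eqVneq j (W * 2).
    have /and5P[_ _ + _ _] := Hal t j ht' hj; rewrite ej eqxx /= => /eqP ->.
    rewrite cvec_support // /zc hw; lia.
  have hj1 : j.+1 < tWd by move: hj nj; rewrite /tWd; lia.
  have [_ _ _ ->] := Hri t j ht' hj1; rewrite e2 //.
  by congr cvec; rewrite /zc; lia.
have [_ hm] := main T (leqnn _).
have /and5P[_ _ _ _] := Hal T W (leqnn _) W0; rewrite !eqxx /= => /eqP.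
by rewrite Hsc // hm // /zc subrr ffunE.
Qed.

Definition tableau_instance : instance 2 :=
  csp_instance tN tM tK tallowed tf1 tg1 tf2 tg2 tdn.

Lemma tableau_consistent : 0 < T ->
  consistent dominoes tableau_instance <->
  exists2 y, size y <= P &
  scanned (ctapes (conf (pair_word x y) T) ord_max) = Some (inl true).
Proof.
move=> T0; have W0 : 0 < W by lia.
have -> : consistent dominoes tableau_instance <->
   exists s, tile_assignment tN tM tallowed tf1 tg1 tf2 tg2 tdn s.
  apply: (@csp_consistent _ _ _ _ _ _ _ _ _ tup).
  - exact: tN_gt0.
  - exact: tcolours.
  - exact: tg1_first.
  - exact: tf1_last.
  - exact: tfirst_allowed.
  - exact: tlast_allowed.
  - exact: tdn_lt.
  - exact: tup_lt.
  - exact: tdnK.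
  - exact: tupK.
split=> [[s]|[y hy hacc]]; first exact: run_of_assignment.
exact: assignment_of_run hy hacc.
Qed.

End Tableau.

(** * Hardness *)

(** The argument is itself an expression, so closure under substitution is built in and nested
    definitions can be treated one at a time. *)
Definition ExF (g : seq bool -> nat -> nat) : Prop :=
  forall F, Ex F -> Ex (fun w v => g w (F w v)).
Definition ExF2 (g : seq bool -> nat -> nat -> nat) : Prop :=
  forall F G, Ex F -> Ex G -> Ex (fun w v => g w (F w v) (G w v)).

(** A computed boolean may be treated as a constant parameter: both instances are expressions, and a
    conditional chooses between them. *)
Lemma Ex_case (g : bool -> seq bool -> seq nat -> nat) (b : seq bool -> seq nat -> bool) :
  (forall c, Ex (g c)) -> Ex (fun w v => b w v) -> Ex (fun w v => g (b w v) w v).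
Proof.
move=> hg hb; apply: Ex_ext (Ex_if hb (hg true) (hg false)) => w v.
by case: (b w v).
Qed.

Lemma Ex_tableD (g : nat -> nat) m d F : (forall r, m <= r -> g r = d) -> Ex F ->
  Ex (fun w v => g (F w v)).
Proof.
move=> hd hF.
apply: Ex_ext (Ex_if (Ex_leq (Ex_S hF) (Ex_const m)) (Ex_table g m hF) (Ex_const d)) => w v.
by case: ltnP => // h; rewrite hd.
Qed.

Lemma Ex_nth_nil I : Ex (fun w v => nth 0 [::] (I w v)).
Proof. by apply: Ex_ext (Ex_const 0) => w v; rewrite nth_nil. Qed.

Lemma Ex_nth_cons a (s : seq bool -> seq nat -> seq nat) I : Ex I -> Ex a ->
  Ex (fun w v => nth 0 (s w v) (I w v).-1) ->
  Ex (fun w v => nth 0 (a w v :: s w v) (I w v)).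
Proof.
move=> hI ha hs; apply: Ex_ext (Ex_if (Ex_eq hI (Ex_const 0)) ha hs) => w v.
by case: (I w v).
Qed.

Lemma ExF_sum (C : seq bool -> nat) (P : seq bool -> nat -> nat -> nat) :
  Ex (fun w _ => C w) -> ExF2 P -> ExF (fun w a => \sum_(c < C w) P w a c).
Proof.
move=> hC hP F hF.
apply: (@Ex_sum (fun w _ => C w) (fun w v c => P w (F w v) c)) => //.
exact: hP (Ex_wk hF) Ex_head.
Qed.

Ltac ex_step := first [assumption | lazymatch goal with
  | |- Ex (fun w v => addn (@?A w v) (@?B w v)) => apply: (@Ex_add A B)
  | |- Ex (fun w v => subn (@?A w v) (@?B w v)) => apply: (@Ex_sub A B)
  | |- Ex (fun w v => muln (@?A w v) (@?B w v)) => apply: (@Ex_mul A B)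
  | |- Ex (fun w v => divn (@?A w v) (@?B w v)) => apply: (@Ex_div A B)
  | |- Ex (fun w v => modn (@?A w v) (@?B w v)) => apply: (@Ex_mod A B)
  | |- Ex (fun w v => S (@?A w v)) => apply: (@Ex_S A)
  | |- Ex (fun w v => predn (@?A w v)) => apply: (@Ex_pred A)
  | |- Ex (fun w v => nat_of_bool (odd (@?A w v))) => apply: (@Ex_odd A)
  | |- Ex (fun w v => nat_of_bool (leq (@?A w v) (@?B w v))) => apply: (@Ex_leq A B)
  | |- Ex (fun w v => nat_of_bool (@eq_op Datatypes_nat__canonical__eqtype_Equality (@?A w v) (@?B w v))) =>
       apply: (@Ex_eq A B)
  | |- Ex (fun w v => nat_of_bool (andb (@?A w v) (@?B w v))) => apply: (@Ex_and A B)
  | |- Ex (fun w v => nat_of_bool (orb (@?A w v) (@?B w v))) => apply: (@Ex_or A B)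
  | |- Ex (fun w v => nat_of_bool (negb (@?A w v))) => apply: (@Ex_neg A)
  | |- Ex (fun w v => nat_of_bool true) => exact: (Ex_const 1)
  | |- Ex (fun w v => nat_of_bool false) => exact: (Ex_const 0)
  | |- Ex (fun w v => nat_of_bool (nth false w (@?A w v))) => apply: (@Ex_bit A)
  | |- Ex (fun w v => size w) => exact: Ex_size
  | |- Ex (fun w v => head 0 v) => exact: Ex_head
  | |- Ex (fun w v => nat_of_bool (if _ then _ else _)) => apply: Ex_ifb
  | |- Ex (fun w v => if _ then _ else _) => apply: Ex_if
  | _ => first [ match goal with
                 | H : ExF ?g |- _ => apply: H
                 | H : ExF2 ?g |- _ => apply: H
                 end
               | apply: Ex_const]
  end].
Ltac ex := repeat ex_step.

Section ExFlow.
Variables (V NL src dst : seq bool -> nat).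
Variables (act : seq bool -> nat -> bool) (l0 l1 l2 l3 : seq bool -> nat -> nat).
Hypotheses (hV : Ex (fun w _ => V w)) (hNL : Ex (fun w _ => NL w)).
Hypotheses (hsrc : Ex (fun w _ => src w)) (hdst : Ex (fun w _ => dst w)).
Hypothesis hact : ExF (fun w v => act w v).
Hypotheses (h0 : ExF l0) (h1 : ExF l1) (h2 : ExF l2) (h3 : ExF l3).

Lemma ExF_fA : ExF (fun w c => fA (l0 w) (l1 w) (l2 w) (l3 w) c).
Proof.
move=> F hF; rewrite /fA /ell /offA; ex.
  by do 8!(apply: Ex_nth_cons; [by ex| by ex|]); exact: Ex_nth_nil.
by do 8!(apply: Ex_nth_cons; [by ex| by ex|]); exact: Ex_nth_nil.
Qed.

Lemma ExF_fD : ExF (fun w c => fD (NL w) c).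
Proof.
move=> F hF; rewrite /fD /offD; ex.
by do 8!(apply: Ex_nth_cons; [by ex| by ex|]); exact: Ex_nth_nil.
Qed.

Lemma ExF_fB : ExF (fun w c => fB (NL w) (l0 w) (l1 w) (l2 w) (l3 w) c).
Proof. move=> F hF; rewrite /fB; have hA := ExF_fA; have hD := ExF_fD; ex. Qed.

Lemma ExF_fact : ExF (fun w c => fact (act w) c).
Proof. move=> F hF; rewrite /fact; ex. Qed.

Lemma ExF_ft : ExF (fun w b => ft (V w) (NL w) (act w) (l0 w) (l1 w) (l2 w) (l3 w) b).
Proof.
apply: (@ExF_sum (fun w => V w * 8) (fun w b c =>
  [&& fact (act w) c, ~~ odd c & fB (NL w) (l0 w) (l1 w) (l2 w) (l3 w) c == b])); first by ex.
by move=> F G hF hG; have hB := ExF_fB; have hc := ExF_fact; ex.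
Qed.

Lemma ExF_fu : ExF (fun w b => fu (V w) (NL w) (act w) b).
Proof.
apply: (@ExF_sum (fun w => V w * 8) (fun w b c =>
  [&& fact (act w) c, ~~ odd c & fD (NL w) c == b])); first by ex.
by move=> F G hF hG; have hB := ExF_fD; have hc := ExF_fact; ex.
Qed.

Lemma ExF_fs : ExF (fun w a => fs (V w) (act w) (l0 w) (l1 w) (l2 w) (l3 w) (src w) (dst w) a).
Proof.
have hs : ExF (fun w a => \sum_(c < V w * 8)
   [&& fact (act w) c, odd c & fA (l0 w) (l1 w) (l2 w) (l3 w) c == a]).
  apply: (@ExF_sum (fun w => V w * 8) (fun w a c =>
    [&& fact (act w) c, odd c & fA (l0 w) (l1 w) (l2 w) (l3 w) c == a])); first by ex.
  by move=> F G hF hG; have hB := ExF_fA; have hc := ExF_fact; ex.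
by move=> F hF; rewrite /fs; ex.
Qed.

Lemma Ex_fNA : Ex (fun w _ => fNA (NL w)).
Proof. rewrite /fNA; ex. Qed.

Lemma Ex_fND : Ex (fun w _ => fND (V w) (NL w)).
Proof. rewrite /fND; ex. Qed.

Lemma ExF_npoints (P : seq bool -> nat -> nat -> bool) : ExF2 (fun w a c => P w a c) ->
  ExF (fun w a => npoints (V w * 8) (fact (act w)) (P w a)).
Proof.
move=> hP; apply: (@ExF_sum (fun w => V w * 8) (fun w a c => fact (act w) c && P w a c)); first by ex.
by move=> F G hF hG; have hc := ExF_fact; ex.
Qed.

Definition flowRH w := pRH (V w * 8) (fNA (NL w)) (fND (V w) (NL w)) (fND (V w) (NL w)) (fact (act w))
  (fA (l0 w) (l1 w) (l2 w) (l3 w)) (fD (NL w))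
  (fs (V w) (act w) (l0 w) (l1 w) (l2 w) (l3 w) (src w) (dst w)) (fu (V w) (NL w) (act w)).
Definition flowRV w := pRV (V w * 8) (fNA (NL w)) (fND (V w) (NL w)) (fND (V w) (NL w)) (fact (act w))
  (fB (NL w) (l0 w) (l1 w) (l2 w) (l3 w)) (fD (NL w))
  (ft (V w) (NL w) (act w) (l0 w) (l1 w) (l2 w) (l3 w)) (fu (V w) (NL w) (act w)).
Definition flowCH w := pCH (V w * 8) (fNA (NL w)) (fND (V w) (NL w)) (fact (act w))
  (fA (l0 w) (l1 w) (l2 w) (l3 w)) (fD (NL w)).
Definition flowCV w := pCV (V w * 8) (fact (act w)) (fB (NL w) (l0 w) (l1 w) (l2 w) (l3 w)) (fD (NL w)).
Definition flowm w := fNA (NL w) + fND (V w) (NL w) + fND (V w) (NL w) + V w * 8.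

Lemma ExF_flowRH : ExF flowRH.
Proof.
have hD := ExF_fD.
have q2 : ExF2 (fun w a c => fD (NL w) c < a) by move=> G I hG hI; ex.
have hA := ExF_fA.
have q1 : ExF2 (fun w a c => fA (l0 w) (l1 w) (l2 w) (l3 w) c < a) by move=> G I hG hI; ex.
have hNA := Ex_fNA; have hND := Ex_fND.
have n1 := @ExF_npoints (fun w a c => fA (l0 w) (l1 w) (l2 w) (l3 w) c < a) q1.
have n2 := @ExF_npoints (fun w a c => fD (NL w) c < a) q2.
move=> F hF; rewrite /flowRH /pRH {q1 q2 hA hD}.
apply: Ex_if; first by clear n1 n2; ex.
  by apply: Ex_add; [exact: n1|exact: ExF_fs].
apply: Ex_if; first by clear n1 n2; ex.
  exact: Ex_const.
apply: Ex_if; first by clear n1 n2; ex.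
  have hd : Ex (fun w v => F w v - (fNA (NL w) + fND (V w) (NL w))) by clear n1 n2; ex.
  by apply: Ex_add; [exact: n2|exact: ExF_fu].
exact: Ex_const.
Qed.

Lemma ExF_flowRV : ExF flowRV.
Proof.
have hD := ExF_fD.
have q2 : ExF2 (fun w a c => fD (NL w) c < a) by move=> G I hG hI; ex.
have hB := ExF_fB.
have q1 : ExF2 (fun w a c => a < fB (NL w) (l0 w) (l1 w) (l2 w) (l3 w) c) by move=> G I hG hI; ex.
have hNA := Ex_fNA; have hND := Ex_fND.
have n1 := @ExF_npoints (fun w a c => a < fB (NL w) (l0 w) (l1 w) (l2 w) (l3 w) c) q1.
have n2 := @ExF_npoints (fun w a c => fD (NL w) c < a) q2.
have n3 := @ExF_npoints (fun w a c => true) (fun _ _ _ _ => Ex_const 1).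
move=> F hF; rewrite /flowRV /pRV {q1 q2 hB hD}.
apply: Ex_if; first by clear n1 n2 n3; ex.
  exact: Ex_const.
apply: Ex_if; first by clear n1 n2 n3; ex.
  have hd : Ex (fun w v => F w v - fNA (NL w)) by clear n1 n2 n3; ex.
  by apply: Ex_add; [exact: n1|exact: ExF_ft].
apply: Ex_if; first by clear n1 n2 n3; ex.
  have hd : Ex (fun w v => F w v - (fNA (NL w) + fND (V w) (NL w))) by clear n1 n2 n3; ex.
  by apply: Ex_sub; [exact: (n3 F)|apply: Ex_add; [exact: n2|exact: ExF_fu]].
exact: Ex_const.
Qed.

Lemma ExF_flowCH : ExF flowCH.
Proof.
move=> F hF; rewrite /flowCH /pCH.
have hA := ExF_fA; have hD := ExF_fD; have hc := ExF_fact.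
by have hNA := Ex_fNA; have hND := Ex_fND; ex.
Qed.

Lemma ExF_flowCV : ExF flowCV.
Proof.
move=> F hF; rewrite /flowCV /pCV.
by have hB := ExF_fB; have hD := ExF_fD; have hc := ExF_fact; ex.
Qed.

Lemma Ex_flowm : Ex (fun w _ => flowm w).
Proof. by have hNA := Ex_fNA; have hND := Ex_fND; rewrite /flowm; ex. Qed.

End ExFlow.

(** * Instances as enumerated lists of numbers *)

Definition listing (n : nat) (F G : nat -> nat -> nat) (e : nat) : nat :=
  if e == 0 then n else
  if e <= n * 2 then F (e.-1 %/ 2) (e.-1 %% 2)
  else G ((e.-1 - n * 2) %/ 2) ((e.-1 - n * 2) %% 2).

Lemma entries_matrix n (F : nat -> nat -> nat) :
  entries (\matrix_(i < n, k < 2) F i k) =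
  [seq F (e %/ 2) (e %% 2) | e <- iota 0 (n * 2)].
Proof.
have -> : entries (\matrix_(i < n, k < 2) F i k) =
   flatten [seq [:: F i 0; F i 1] | i <- iota 0 n].
  rewrite /entries -val_enum_ord -map_comp; congr flatten; apply: eq_map => i.
  by rewrite !enum_ordSl enum_ord0 /= !mxE.
elim: n => // n IH; have -> : n.+1 * 2 = n * 2 + 2 by lia.
rewrite (iotaD 0 (n * 2) 2) map_cat -IH -(addn1 n) (iotaD 0 n 1) map_cat flatten_cat /= !add0n; congr (_ ++ _).
by rewrite mulnK // modnMl -[(n * 2).+1]addn1 divnMDl // modnMDl addn0.
Qed.

Lemma encode_instanceE n (F G : nat -> nat -> nat) :
  encode_instance (Instance (\matrix_(i < n, k < 2) F i k) (\matrix_(i < n, k < 2) G i k)) =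
  encode_numbers [seq listing n F G e | e <- iota 0 (n * 4).+1].
Proof.
rewrite /encode_instance !entries_matrix [grid_size _]/=.
apply: (congr1 (fun s => encode_numbers (n :: s))); rewrite -/(iota _ _) -/(map _ _).
have -> : n * 4 = n * 2 + n * 2 by lia.
rewrite iotaD map_cat; congr (_ ++ _).
  rewrite -[1]addn0 iotaDl -map_comp; apply/eq_in_map => e.
  by rewrite mem_iota /listing /= add0n => ->.
have -> : iota (1 + n * 2) (n * 2) = [seq (1 + n * 2) + e | e <- iota 0 (n * 2)].
  by rewrite -iotaDl addn0.
rewrite -map_comp; apply/eq_in_map => e _.
rewrite /listing /= add1n leqNgt ltnS leq_addr /=.
by have -> : n * 2 + e - n * 2 = e by lia.
Qed.

Section ExInstance.
Variables (m : seq bool -> nat) (RH RV CH CV : seq bool -> nat -> nat).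
Hypothesis hm : Ex (fun w _ => m w).
Hypotheses (hRH : ExF RH) (hRV : ExF RV) (hCH : ExF CH) (hCV : ExF CV).

Lemma Ex_half F : Ex F -> Ex (fun w v => (F w v)./2).
Proof.
by move=> hF; apply: Ex_ext (Ex_div hF (Ex_const 2)) => w v; rewrite divn2.
Qed.

Lemma Ex_double F : Ex F -> Ex (fun w v => (F w v).*2).
Proof.
by move=> hF; apply: Ex_ext (Ex_mul hF (Ex_const 2)) => w v; rewrite muln2.
Qed.

Lemma ExF2_block (f g : seq bool -> nat -> nat) : ExF f -> ExF g ->
  ExF2 (fun w i k => block_margin (f w) (g w) i k).
Proof.
move=> hf hg F G hF hG; rewrite /block_margin.
have hh := Ex_half hF; have := hf _ hh; have := hg _ hh => h1 h2; ex.
Qed.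

Lemma instance_polytime : polytime (fun w => encode_instance
  (Instance (\matrix_(i < (m w).*2, k < 2) block_margin (RH w) (RV w) i k)
            (\matrix_(j < (m w).*2, k < 2) block_margin (CH w) (CV w) j k))).
Proof.
have hn := Ex_double hm.
have hR := ExF2_block hRH hRV; have hC := ExF2_block hCH hCV.
apply: polytime_ext (numbers_polytime (cnt := fun w => ((m w).*2 * 4).+1)
  (ent := fun w e => listing (m w).*2 (block_margin (RH w) (RV w)) (block_margin (CH w) (CV w)) e) _ _).
- by move=> w; rewrite encode_instanceE.
- by ex.
- by rewrite /listing; ex.
Qed.
End ExInstance.

Section ExCSP.
Variables (N M K : seq bool -> nat).
Variables (allowed : seq bool -> nat -> nat -> bool).
Variables (f1 g1 f2 g2 : seq bool -> nat -> nat -> nat) (dn : seq bool -> nat -> nat).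
Hypotheses (hN : Ex (fun w _ => N w)) (hM : Ex (fun w _ => M w)) (hK : Ex (fun w _ => K w)).
Hypothesis hal : ExF2 (fun w p r => allowed w p r).
Hypotheses (hf1 : ExF2 f1) (hg1 : ExF2 g1) (hf2 : ExF2 f2) (hg2 : ExF2 g2).
Hypothesis hdn : ExF dn.

Lemma csp_polytime : polytime (fun w => encode_instance
  (csp_instance (N w) (M w) (K w) (allowed w) (f1 w) (g1 w) (f2 w) (g2 w) (dn w))).
Proof.
have hV : Ex (fun w _ => cV (N w) (M w)) by rewrite /cV; ex.
have hNL : Ex (fun w _ => cNL (N w) (K w)) by rewrite /cNL; ex.
have hsrc := Ex_const 0.
have hdst : Ex (fun w _ => N w * K w) by ex.
have hact : ExF (fun w v => cact (M w) (allowed w) v) by move=> F hF; rewrite /cact; ex.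
have h0 : ExF (fun w v => cl0 (M w) (K w) (f1 w) v) by move=> F hF; rewrite /cl0; ex.
have h1 : ExF (fun w v => cl1 (M w) (K w) (f2 w) (dn w) v) by move=> F hF; rewrite /cl1; ex.
have h2 : ExF (fun w v => cl2 (M w) (K w) (g1 w) v) by move=> F hF; rewrite /cl2; ex.
have h3 : ExF (fun w v => cl3 (M w) (K w) (g2 w) v) by move=> F hF; rewrite /cl3; ex.
have hm := Ex_flowm hV hNL.
have hRH := ExF_flowRH hV hNL hsrc hdst hact h0 h1 h2 h3.
have hRV := ExF_flowRV hV hNL hact h0 h1 h2 h3.
have hCH := ExF_flowCH hV hNL hact h0 h1 h2 h3.
have hCV := ExF_flowCV hV hNL hact h0 h1 h2 h3.
exact: (instance_polytime hm hRH hRV hCH hCV).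
Qed.
End ExCSP.

Section ExTableau.
Variables (M : machine) (P T W : seq bool -> nat).
Hypotheses (hP : Ex (fun w _ => P w)) (hT : Ex (fun w _ => T w)) (hW : Ex (fun w _ => W w)).

Lemma tnat_default r : tM M <= r -> tnat M r = tdflt M.
Proof. by move=> h; rewrite /tnat nth_default // -cardE. Qed.

(** The machine does not depend on the input, hence every function of its tiles is a finite table;
    this is how the transition function enters an expression. *)
Lemma Ex_tile (g : ttile M -> nat) F : Ex F -> Ex (fun w v => g (tnat M (F w v))).
Proof.
move=> hF; apply: (@Ex_tableD (fun r => g (tnat M r)) (tM M) (g (tdflt M))) => // r hr.
by rewrite tnat_default.
Qed.

Lemma Ex_dbit F : Ex F -> Ex (fun w v => dbit w (F w v)).
Proof. by move=> hF; rewrite /dbit; ex. Qed.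

Lemma tableau_polytime : polytime (fun w =>
  encode_instance (tableau_instance M w (P w) (T w) (W w))).
Proof.
have hWd : Ex (fun w _ => tWd (W w)) by rewrite /tWd; ex.
have hNt : Ex (fun w _ => tN (T w) (W w)) by rewrite /tN; ex.
have hrow : ExF (fun w p => trow (W w) p) by move=> F hF; rewrite /trow; ex.
have hcol : ExF (fun w p => tcol (W w) p) by move=> F hF; rewrite /tcol; ex.
have hL : Ex (fun w _ => tL w) by rewrite /tL; ex.
have hisb : ExF (fun w p => tisb w (W w) p) by move=> F hF; rewrite /tisb; ex.
have hfr : ExF (fun w p => tfr w (P w) (W w) p) by move=> F hF; rewrite /tfr; ex.
apply: csp_polytime => //; try exact: Ex_const.
- move=> F G hF hG; rewrite /tallowed.
  (* The place enters through eight booleans only; for fixed values a table of tiles remains, and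
     the booleans are then released from the last to the first. *)
  have e8 b1 b2 b3 b4 b5 b6 b7 b8 := Ex_tile (allow (M := M) b1 b2 b3 b4 b5 b6 b7 b8) hG.
  have e7 b1 b2 b3 b4 b5 b6 b7 := Ex_case (e8 b1 b2 b3 b4 b5 b6 b7)
    (Ex_dbit (F := fun w v => tcol (W w) (F w v) - W w) (ltac:(by ex))).
  have e6 b1 b2 b3 b4 b5 b6 := Ex_case (e7 b1 b2 b3 b4 b5 b6) (hisb _ hF).
  have e5 b1 b2 b3 b4 b5 := Ex_case (e6 b1 b2 b3 b4 b5) (hfr _ hF).
  have e4 b1 b2 b3 b4 := Ex_case (e5 b1 b2 b3 b4) (Ex_eq (hcol _ hF) hW).
  have e3 b1 b2 b3 := Ex_case (e4 b1 b2 b3) (Ex_eq (hcol _ hF) (Ex_mul hW (Ex_const 2))).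
  have e2 b1 b2 := Ex_case (e3 b1 b2) (Ex_eq (hcol _ hF) (Ex_const 0)).
  have e1 b1 := Ex_case (e2 b1) (Ex_eq (hrow _ hF) hT).
  exact: Ex_case e1 (Ex_eq (hrow _ hF) (Ex_const 0)).
- move=> F G hF hG; rewrite /tf1; have := Ex_tile (@right1 M) hG => h; ex.
- move=> F G hF hG; rewrite /tg1; have := Ex_tile (@left1 M) hG => h; ex.
- move=> F G hF hG; rewrite /tf2.
  have e3 b1 b2 b3 := Ex_tile (bottom2 (M := M) b1 b2 b3) hG.
  have e2 b1 b2 := Ex_case (e3 b1 b2) (Ex_eq (hcol _ hF) (Ex_S hW)).
  have e1 b1 := Ex_case (e2 b1) (Ex_eq (Ex_S (hcol _ hF)) hW).
  have e0 := Ex_case e1 (Ex_eq (hcol _ hF) hW).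
  by apply: Ex_if => //; ex.
- move=> F G hF hG; rewrite /tg2; have := Ex_tile (@top2 M) hG => h; ex.
- by move=> F hF; rewrite /tdn; ex.
Qed.
End ExTableau.

(** * Injectivity of the encodings *)

Lemma delimit_cons b w : delimit (b :: w) = [:: true, b & delimit w].
Proof. by []. Qed.

Lemma pair_word_inj w w' s s' : pair_word w s = pair_word w' s' -> w = w' /\ s = s'.
Proof.
rewrite /pair_word; elim: w w' => [|b w IH] [|b' w'] //; first by case.
by rewrite !delimit_cons /= => -[-> /IH[-> ->]].
Qed.

Lemma binary_inj : injective binary.
Proof.
have nb n i : nth false (binary n) i = odd (n %/ 2 ^ i).
  rewrite /binary; have [hi|hi] := ltnP i (trunc_log 2 n).+1; first by rewrite nth_mkseq.
  rewrite nth_default ?size_mkseq // divn_small //.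
  by apply: leq_trans (trunc_log_ltn n (isT : 1 < 2)) _; rewrite leq_exp2l.
(* [k] is a common bound for the numbers of digits; halving removes the lowest digit. *)
have key k : forall n n', n < 2 ^ k -> n' < 2 ^ k ->
    (forall i, odd (n %/ 2 ^ i) = odd (n' %/ 2 ^ i)) -> n = n'.
  elim: k => [|k IH] n n' hn hn' h; first by move: hn hn'; rewrite expn0; lia.
  have e0 : odd n = odd n' by have := h 0; rewrite expn0 !divn1.
  have e1 : n %/ 2 = n' %/ 2.
    apply: IH => [||i]; rewrite ?ltn_divLR // -?expnSr //.
    by rewrite -!divnMA -!expnS.
  by rewrite (divn_eq n 2) (divn_eq n' 2) e1 !modn2 e0.
move=> n n' e; apply: (key (n + n')) => [||i].
- by apply: leq_trans (ltn_expl _ (isT : 1 < 2)) _; rewrite leq_exp2l // leq_addr.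
- by apply: leq_trans (ltn_expl _ (isT : 1 < 2)) _; rewrite leq_exp2l // leq_addl.
- by rewrite -!nb e.
Qed.

Lemma encode_numbers_inj : injective encode_numbers.
Proof.
elim=> [|a s IH] [|b t] //.
by move/pair_word_inj => -[/binary_inj -> /IH ->].
Qed.

Lemma entries_inj h n : injective (@entries h n).
Proof.
move=> A B e; apply/matrixP => i k.
have sz (X : 'M[nat]_(n, h)) : size (entries X) = n * h.
  by rewrite size_allpairs -!cardE !card_ord.
have nthE (X : 'M[nat]_(n, h)) : nth 0 (entries X) (index (i, k) [seq (i, k) | i <- enum 'I_n, k <- enum 'I_h]) = X i k.
  have -> : entries X = [seq X u.1 u.2 | u <- [seq (i, k) | i <- enum 'I_n, k <- enum 'I_h]].
    by rewrite /entries map_allpairs.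
  have hin : (i, k) \in [seq (i, k) | i <- enum 'I_n, k <- enum 'I_h].
    by apply: allpairs_f; rewrite mem_enum.
  by rewrite (nth_map (i, k)) ?index_mem // nth_index.
by rewrite -nthE e nthE.
Qed.

Lemma encode_instance_inj h : injective (@encode_instance h).
Proof.
case=> n r c [n' r' c'] /encode_numbers_inj[/= e]; subst n'.
have sz (X : 'M[nat]_(n, h)) : size (entries X) = n * h.
  by rewrite size_allpairs -!cardE !card_ord.
move=> e; have := congr1 (take (n * h)) e; have := congr1 (drop (n * h)) e.
rewrite !drop_size_cat ?sz // !take_size_cat ?sz //.
by move=> /entries_inj -> /entries_inj ->.
Qed.

Lemma horner_nat_mono (p : {poly nat}) a b : a <= b -> p.[a]%R <= p.[b]%R.
Proof.
move=> h; rewrite /horner; elim: (polyseq p) => //= c s IH.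
by apply: leq_add => //; apply: leq_mul.
Qed.

Lemma iter_halted (M : machine) w a b : a <= b ->
  halting (cstate (iter a (@step M) (init_config M w))) ->
  iter b (@step M) (init_config M w) = iter a (@step M) (init_config M w).
Proof.
move=> hab hh; rewrite -(subnK hab) iterD; elim: (b - a) => //= n ->.
by rewrite {1}/step hh.
Qed.

Theorem consistency_NP_hard : NP_hard (consistency_problem dominoes).
Proof.
move=> L [R [p [[f [[M [q hM]] hf]] hL]]].
pose P (w : seq bool) := p.[size w]%R.
(* [tL w + P w] bounds the length of the input paired with a certificate. The successor makes the
   time positive, and a halted machine may take further steps. *)
pose T (w : seq bool) := (q.[(tL w + P w)%N]%R).+1.
pose W (w : seq bool) := (tL w + P w + T w).+1.
have hP : Ex (fun w _ => P w) by apply: Ex_poly; ex.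
have htL : Ex (fun w _ => tL w) by rewrite /tL; ex.
have hT : Ex (fun w _ => T w) by apply: Ex_S; apply: Ex_poly; ex.
have hW : Ex (fun w _ => W w) by rewrite /W; ex.
exists (fun w => encode_instance (tableau_instance M w (P w) (T w) (W w))).
split; first exact: tableau_polytime.
move=> x.
have -> : consistency_problem dominoes (encode_instance (tableau_instance M x (P x) (T x) (W x)))
   <-> consistent dominoes (tableau_instance M x (P x) (T x) (W x)).
  split=> [[I [/encode_instance_inj <-]] //|h].
  by exists (tableau_instance M x (P x) (T x) (W x)).
rewrite tableau_consistent //.
have key y : size y <= P x ->
   (scanned (ctapes (iter (T x) (@step M) (init_config M (pair_word x y))) ord_max) = Some (inl true)
    <-> R x y).
  move=> hy; have [hh ho] := hM (pair_word x y).
  have hle : q.[size (pair_word x y)]%R <= T x.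
    rewrite /T size_pair_word; apply: leqW; apply: horner_nat_mono.
    by rewrite leq_add2l.
  rewrite (iter_halted hle hh).
  have -> : R x y <-> f (pair_word x y).
    rewrite -hf; split=> [h|[x' [y' [/pair_word_inj[-> ->]] //]]].
    by exists x, y.
  (* The output is a single bit, so the symbol scanned on the last tape decides. *)
  move: ho; rewrite /output /=.
  by case: (scanned _) => [[b|c]|] //= -[-> _]; case: (f _); split.
rewrite hL; split=> [[y [hy hR]]|[y hy hs]].
  by exists y => //; apply/key.
by exists y; split=> //; apply/key.
Qed.

(** * Membership in NP *)

Section Numerals.
Variable ent : nat -> nat.

Definition numpos (e : nat) : nat := \sum_(i < e) numlen (ent i).

Lemma numposS e : numpos e.+1 = numpos e + numlen (ent e).
Proof. by rewrite /numpos big_ord_recr. Qed.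

Lemma encode_numbersS cnt : encode_numbers [seq ent e | e <- iota 0 cnt.+1] =
  encode_numbers [seq ent e | e <- iota 0 cnt] ++ delimit (binary (ent cnt)).
Proof.
by rewrite /encode_numbers -[cnt.+1]addn1 iotaD !map_cat flatten_cat /= cats0.
Qed.

Lemma size_encode_numbers cnt :
  size (encode_numbers [seq ent e | e <- iota 0 cnt]) = numpos cnt.
Proof.
elim: cnt => [|cnt IH]; first by rewrite /numpos big_ord0.
by rewrite encode_numbersS size_cat IH delimit_binary size_map size_iota numposS.
Qed.

Lemma leq_numpos a b : a <= b -> numpos a <= numpos b.
Proof.
move=> h; rewrite -(subnKC h); elim: (b - a) => [|d IH]; first by rewrite addn0.
by rewrite addnS numposS; apply: leq_trans IH (leq_addr _ _).
Qed.

Lemma nth_encode_numbers cnt e j : e < cnt -> j < numlen (ent e) ->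
  nth false (encode_numbers [seq ent e | e <- iota 0 cnt]) (numpos e + j) =
  numbit (ent e) j.
Proof.
elim: cnt => // cnt IH; rewrite ltnS encode_numbersS nth_cat size_encode_numbers.
rewrite leq_eqVlt => /orP[/eqP <- hj|he hj].
  rewrite ltnNge leq_addr /= addKn delimit_binary (nth_map 0) ?size_iota //.
  by rewrite nth_iota.
have hlt : numpos e + j < numpos cnt.
  by apply: leq_trans (leq_numpos he); rewrite numposS ltn_add2l.
by rewrite hlt IH.
Qed.

Lemma numpos_split cnt i : i < numpos cnt ->
  exists e j, [/\ e < cnt, j < numlen (ent e) & i = numpos e + j].
Proof.
elim: cnt => [|cnt IH]; first by rewrite /numpos big_ord0.
have [hi _|hi] := ltnP i (numpos cnt).
  by have [e [j [he hj ->]]] := IH hi; exists e, j; split=> //; apply: ltnW.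
rewrite numposS => h; exists cnt, (i - numpos cnt); rewrite ltn_subLR // h.
by split=> //; rewrite subnKC.
Qed.

(** The word is given by its length [m] and its bits [X], so that the test applies to a component of
    a pair that is never extracted as a word. *)
Definition spells (cnt m : nat) (X : nat -> bool) : bool :=
  (m == numpos cnt) &&
  all (fun e => all (fun j => ~~ (X (numpos e + j) (+) numbit (ent e) j))
                    (iota 0 (numlen (ent e)))) (iota 0 cnt).

Lemma spellsP cnt x : reflect (x = encode_numbers [seq ent e | e <- iota 0 cnt])
  (spells cnt (size x) (nth false x)).
Proof.
apply: (iffP andP) => [[/eqP hm /allP h]|->].
  apply: (@eq_from_nth _ false) => [|i]; rewrite ?size_encode_numbers // hm.
  move=> /numpos_split[e [j [he hj ->]]].
  rewrite nth_encode_numbers //.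
  have /h/allP/(_ j) : e \in iota 0 cnt by rewrite mem_iota.
  by rewrite mem_iota => /(_ hj); rewrite negb_add => /eqP.
rewrite size_encode_numbers eqxx; split=> //.
apply/allP => e; rewrite mem_iota => he; apply/allP => j; rewrite mem_iota => hj.
by rewrite nth_encode_numbers // addbb.
Qed.

Lemma leq_size_encode_numbers cnt :
  cnt <= size (encode_numbers [seq ent e | e <- iota 0 cnt]).
Proof.
rewrite size_encode_numbers; elim: cnt => // cnt IH.
by rewrite numposS /numlen addn1 addnS ltnS (leq_trans IH) // leq_addr.
Qed.
End Numerals.

Section Certificate.
Variables (s : nat) (Y : nat -> bool).

(* A certificate has two bits per cell, so that its length determines the grid. *)
Definition side : nat := \sum_(i < s) (i.+1 * i.+1 * 2 <= s).
Definition cell_bit (i j k : nat) : bool := Y ((i * side + j) * 2 + k).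
Definition row_count (i k : nat) : nat := \sum_(j < side) cell_bit i j k.
Definition col_count (j k : nat) : nat := \sum_(i < side) cell_bit i j k.

Definition cell_ok (i j : nat) : bool :=
  [&& ~~ cell_bit i j 0 || (j.+1 < side), ~~ cell_bit i j 1 || (i.+1 < side) &
   cell_bit i j 0 + cell_bit i j 1 + ((0 < j) && cell_bit i j.-1 0)
   + ((0 < i) && cell_bit i.-1 j 1) <= 1].

Definition valid_bits : bool :=
  all (fun i => all (cell_ok i) (iota 0 side)) (iota 0 side).

Lemma valid_bitsP : reflect (valid_tiling side cell_bit) valid_bits.
Proof.
apply: (iffP allP) => [h i j hi hj|h i].
  have /h/allP/(_ j) : i \in iota 0 side by rewrite mem_iota.
  rewrite mem_iota => /(_ hj) /and3P[/orP h1 /orP h2 h3]; split=> //.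
    by move=> hb; case: h1 => //; rewrite hb.
  by move=> hb; case: h2 => //; rewrite hb.
rewrite mem_iota => hi; apply/allP => j; rewrite mem_iota => hj.
have [h1 h2 h3] := h i j hi hj; apply/and3P; split=> //.
  by case: (cell_bit i j 0) h1 => // ->.
by case: (cell_bit i j 1) h2 => // ->.
Qed.

(** The input is not decoded: the margins are computed from the certificate, and the input is
    compared with their encoding. Malformed inputs are rejected by the same comparison. *)
Definition checks (m : nat) (X : nat -> bool) : bool :=
  valid_bits && spells (listing side row_count col_count) (side * 4).+1 m X.

Lemma sideE n : s = n * n * 2 -> side = n.
Proof.
move=> hs; rewrite /side.
have -> : \sum_(i < s) (i.+1 * i.+1 * 2 <= s) = \sum_(i < s) (i < n).
  apply: eq_bigr => i _; congr nat_of_bool; rewrite [X in _ <= X]hs leq_pmul2r //.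
  move: (i : nat) => {}i; apply/idP/idP => h; last by apply: leq_mul.
  by rewrite ltnNge; apply/negP => h'; have := leq_mul h' h'; move: h; nia.
by rewrite sum_ltn hs; apply/minn_idPr; nia.
Qed.
End Certificate.

Definition certifies (x y : seq bool) : bool :=
  checks (size y) (nth false y) (size x) (nth false x).

(** The certificate has [n * n * 2] bits, and [n] is at most the input size because the encoding
    consists of [4 * n + 1] nonempty numerals. *)
Lemma consistency_certificate x : consistency_problem dominoes x <->
  exists y, size y <= size x * size x * 2 /\ certifies x y.
Proof.
split=> [[[n r c] [-> /consistentP[B [hB hr hc]]]]|[y [_ /andP[/valid_bitsP hv /spellsP ->]]]].
  pose y := mkseq (fun e => B (e %/ 2 %/ n) ((e %/ 2) %% n) (e %% 2)) (n * n * 2).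
  have hs : side (size y) = n by apply: sideE; exact: size_mkseq.
  have hb i j k : i < n -> j < n -> k < 2 -> cell_bit (size y) (nth false y) i j k = B i j k.
    move=> hi hj hk; rewrite /cell_bit hs nth_mkseq; last by nia.
    rewrite divnMDl // modnMDl (divn_small hk) (modn_small hk) addn0.
    by rewrite divnMDl ?(leq_trans _ hi) // modnMDl (divn_small hj) (modn_small hj) addn0.
  have er : r = (\matrix_(i < n, k < 2) row_count (size y) (nth false y) i k)%R.
    apply/matrixP => i k; rewrite mxE -hr /row_count hs; apply: eq_bigr => j _.
    by rewrite hb.
  have ec : c = (\matrix_(j < n, k < 2) col_count (size y) (nth false y) j k)%R.
    apply/matrixP => j k; rewrite mxE -hc /col_count hs; apply: eq_bigr => i _.
    by rewrite hb.
  exists y; split.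
    rewrite size_mkseq er ec encode_instanceE.
    have := @leq_size_encode_numbers (listing n (row_count (size y) (nth false y))
      (col_count (size y) (nth false y))) (n * 4).+1.
    by move: (size (encode_numbers _)) => z hz; rewrite leq_pmul2r //; apply: leq_mul; lia.
  apply/andP; split.
    apply/valid_bitsP; rewrite hs => i j hi hj; have [h1 h2 h3] := hB i j hi hj.
    rewrite (hb i j 0) // (hb i j 1) //; split=> //; move: h3.
    rewrite (hb i j.-1 0) ?(leq_ltn_trans (leq_pred _) hj) //.
    by rewrite (hb i.-1 j 1) ?(leq_ltn_trans (leq_pred _) hi).
  by apply/spellsP; rewrite er ec encode_instanceE hs.
exists (Instance
  (\matrix_(i < side (size y), k < 2) row_count (size y) (nth false y) i k)%R
  (\matrix_(j < side (size y), k < 2) col_count (size y) (nth false y) j k)%R).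
split; first by rewrite encode_instanceE.
apply/consistentP; exists (cell_bit (size y) (nth false y)).
by split=> // i k; rewrite mxE.
Qed.

(** * Recognition of paired words *)

Section Unpair.
Variable w : seq bool.

(** The bits at even positions are the continuation marks of the delimited word; the sum counts how
    many of them precede the first 0. *)
Definition half_size : nat :=
  \sum_(i < size w) all (fun j => nth false w (j * 2)) (iota 0 i.+1).
Definition is_pair : bool :=
  [&& half_size * 2 < size w, all (fun j => nth false w (j * 2)) (iota 0 half_size)
    & ~~ nth false w (half_size * 2)].
Definition first_bit (i : nat) : bool := (i < half_size) && nth false w (i * 2 + 1).
Definition second_size : nat := size w - (half_size * 2 + 1).
Definition second_bit (j : nat) : bool := nth false w (half_size * 2 + 1 + j).
End Unpair.

Lemma nth_false_pair_word x y k : nth false (pair_word x y) k =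
  if k < size x * 2 then (if odd k then nth false x (k %/ 2) else true)
  else if k == size x * 2 then false else nth false y (k - (size x * 2 + 1)).
Proof.
rewrite /pair_word nth_cat delimitE size_map size_iota.
have [hk|hk] := ltnP k (size x * 2 + 1).
  rewrite (nth_map 0) ?size_iota // nth_iota // add0n.
  by case: (ltngtP k (size x * 2)) => // h; exfalso; move: hk; lia.
by case: (ltngtP k (size x * 2)) => // h; exfalso; move: hk; lia.
Qed.

Lemma half_size_pair x y : half_size (pair_word x y) = size x.
Proof.
rewrite /half_size.
under eq_bigr => i _.
  have -> : all (fun j => nth false (pair_word x y) (j * 2)) (iota 0 i.+1) = (i < size x).
    apply/allP/idP => [/(_ (minn i (size x)))|hi j].
      rewrite mem_iota add0n ltnS geq_minl nth_false_pair_word => /(_ isT).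
      by case: (ltnP i (size x)) => // _; rewrite ltnn eqxx.
    rewrite mem_iota => hj; rewrite nth_false_pair_word ltn_pmul2r //.
    by rewrite (leq_trans hj hi) muln2 odd_double.
  over.
by rewrite sum_ltn; apply/minn_idPr; rewrite size_pair_word /tL; lia.
Qed.

Lemma pair_word_bits x y : [/\ is_pair (pair_word x y),
  first_bit (pair_word x y) = nth false x, second_size (pair_word x y) = size y
  & second_bit (pair_word x y) = nth false y].
Proof.
have hs := size_pair_word x y; rewrite /tL in hs.
rewrite /is_pair /second_size half_size_pair hs addKn; split=> //.
- apply/and3P; split; first by lia.
    apply/allP => j; rewrite mem_iota => hj; rewrite nth_false_pair_word ltn_pmul2r //.
    by rewrite (hj : j < size x) muln2 odd_double.
  by rewrite nth_false_pair_word ltnn eqxx.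
- apply: functional_extensionality => i; rewrite /first_bit half_size_pair nth_false_pair_word.
  case: ltnP => hi /=; last by rewrite nth_default.
  have -> : i * 2 + 1 < size x * 2 by lia.
  by rewrite addn1 /= muln2 odd_double -muln2 -addn1 divnMDl // addn0.
- apply: functional_extensionality => j; rewrite /second_bit half_size_pair nth_false_pair_word.
  by rewrite addKn; case: (ltngtP (size x * 2 + 1 + j) (size x * 2)) => // h; exfalso; move: h; lia.
Qed.

(** Only the marks are constrained; the bits at odd positions before the end mark form an arbitrary
    first word, and everything after it is the second. *)
Lemma is_pairP w : is_pair w -> exists x y, w = pair_word x y.
Proof.
move=> /and3P[h1 /allP h2 /negbTE h3].
exists (mkseq (fun i => nth false w (i * 2 + 1)) (half_size w)), (drop (half_size w * 2 + 1) w).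
apply: (@eq_from_nth _ false) => [|k hk].
  by rewrite size_pair_word /tL size_mkseq size_drop; lia.
rewrite nth_false_pair_word size_mkseq nth_drop.
case: (ltngtP k (half_size w * 2)) => h; last by rewrite h h3.
  have hd : k %/ 2 < half_size w by rewrite ltn_divLR.
  have ek := divn_eq k 2; rewrite modn2 in ek.
  case: ifP => ho; rewrite ho in ek; first by rewrite nth_mkseq // -ek.
  rewrite ek addn0; apply: (h2 (k %/ 2)).
  by rewrite mem_iota.
by rewrite subnKC //; lia.
Qed.

Definition accepts (w : seq bool) : bool :=
  is_pair w && checks (second_size w) (second_bit w) (half_size w) (first_bit w).

Lemma acceptsP w : (exists x y, w = pair_word x y /\ certifies x y) <-> accepts w.
Proof.
split=> [[x [y [-> h]]]|/andP[/is_pairP[x [y ->]]]].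
  by have [h1 h2 h3 h4] := pair_word_bits x y; rewrite /accepts h1 h2 h3 h4 half_size_pair.
have [h1 h2 h3 h4] := pair_word_bits x y; rewrite h2 h3 h4 half_size_pair => h.
by exists x, y.
Qed.

Lemma Ex_xorb (P Q : seq bool -> seq nat -> bool) :
  Ex (fun w v => P w v) -> Ex (fun w v => Q w v) ->
  Ex (fun w v => ~~ (P w v (+) Q w v)).
Proof.
by move=> hP hQ; apply: Ex_ext (Ex_ifb hP hQ (Ex_neg hQ)) => w v; case: (P w v); case: (Q w v).
Qed.

Section ExCheck.
Variables (m s : seq bool -> nat) (X Y : seq bool -> nat -> bool).
Hypotheses (hm : Ex (fun w _ => m w)) (hs : Ex (fun w _ => s w)).
Hypotheses (hX : ExF (fun w i => X w i)) (hY : ExF (fun w i => Y w i)).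

Lemma Ex_side : Ex (fun w _ => side (s w)).
Proof.
apply: (@Ex_sum (fun w _ => s w) (fun w _ i => i.+1 * i.+1 * 2 <= s w)) => //.
by have hh := Ex_head; ex.
Qed.

Lemma Ex_cell_bit F G H : Ex F -> Ex G -> Ex H ->
  Ex (fun w v => cell_bit (s w) (Y w) (F w v) (G w v) (H w v)).
Proof.
move=> hF hG hH; have hn := Ex_side; rewrite /cell_bit.
by apply: (hY (F := fun w v => (F w v * side (s w) + G w v) * 2 + H w v)); clear hX hY; ex.
Qed.

Lemma ExF2_row_count : ExF2 (fun w i k => row_count (s w) (Y w) i k).
Proof.
move=> F G hF hG; apply: (@Ex_sum (fun w _ => side (s w))
  (fun w v j => cell_bit (s w) (Y w) (F w v) j (G w v))); first exact: Ex_side.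
exact: Ex_cell_bit (Ex_wk hF) Ex_head (Ex_wk hG).
Qed.

Lemma ExF2_col_count : ExF2 (fun w j k => col_count (s w) (Y w) j k).
Proof.
move=> F G hF hG; apply: (@Ex_sum (fun w _ => side (s w))
  (fun w v i => cell_bit (s w) (Y w) i (F w v) (G w v))); first exact: Ex_side.
exact: Ex_cell_bit Ex_head (Ex_wk hF) (Ex_wk hG).
Qed.

Lemma Ex_valid_bits : Ex (fun w _ => valid_bits (s w) (Y w)).
Proof.
apply: (@Ex_all (fun w _ => side (s w))
  (fun w v i => all (cell_ok (s w) (Y w) i) (iota 0 (side (s w))))); first exact: Ex_side.
apply: (@Ex_all (fun w _ => side (s w))
  (fun w v j => cell_ok (s w) (Y w) (head 0 v) j)); first exact: Ex_side.
have hn := Ex_side; have hj := Ex_head; have hi := Ex_wk Ex_head.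
have h0 := Ex_const 0; have h1 := Ex_const 1.
have b0 := Ex_cell_bit hi hj h0; have b1 := Ex_cell_bit hi hj h1.
have b2 := Ex_cell_bit hi (Ex_pred hj) h0; have b3 := Ex_cell_bit (Ex_pred hi) hj h1.
by rewrite /cell_ok; clear hX hY; ex.
Qed.

Lemma Ex_spells (cnt : seq bool -> nat) (ent : seq bool -> nat -> nat) :
  Ex (fun w _ => cnt w) -> ExF ent ->
  Ex (fun w _ => spells (ent w) (cnt w) (m w) (X w)).
Proof.
move=> hc he.
have hl : ExF (fun w e => numlen (ent w e)).
  by move=> F hF; apply: (Ex_comp1 (g := numlen) Ex_numlen); apply: he.
have hp : ExF (fun w e => numpos (ent w) e).
  move=> F hF; apply: (@Ex_sum F (fun w v i => numlen (ent w i))) => //.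
  exact: hl Ex_head.
apply: Ex_and; first exact: Ex_eq hm (hp _ hc).
apply: (@Ex_all (fun w _ => cnt w) (fun w v e =>
  all (fun j => ~~ (X w (numpos (ent w) e + j) (+) numbit (ent w e) j))
      (iota 0 (numlen (ent w e))))) => //.
apply: (@Ex_all (fun w v => numlen (ent w (head 0 v))) (fun w v j =>
  ~~ (X w (numpos (ent w) (head 0 v) + j) (+) numbit (ent w (head 0 v)) j))).
  exact: hl Ex_head.
have hj := Ex_head; have hi := Ex_wk Ex_head.
apply: Ex_xorb; first exact: hX (Ex_add (hp _ hi) hj).
exact: (Ex_comp2 (g := fun a b => numbit a b) Ex_numbit (he _ hi) hj).
Qed.

Lemma Ex_checks : Ex (fun w _ => checks (s w) (Y w) (m w) (X w)).
Proof.
have hn := Ex_side.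
apply: Ex_and; first exact: Ex_valid_bits.
apply: (@Ex_spells (fun w => (side (s w) * 4).+1)
  (fun w => listing (side (s w)) (row_count (s w) (Y w)) (col_count (s w) (Y w)))).
  by clear hX hY; ex.
have hr := ExF2_row_count; have hc := ExF2_col_count.
move=> F hF; rewrite /listing; clear hX hY.
apply: Ex_if; first by clear hr hc; ex.
  exact: hn.
apply: Ex_if; first by clear hr hc; ex.
  by apply: hr; clear hc; ex.
by apply: hc; clear hr; ex.
Qed.
End ExCheck.

Lemma Ex_accepts : Ex (fun w _ => accepts w).
Proof.
have h0 : Ex (fun w v => nth false w (head 0 v * 2)) by ex.
have hh : Ex (fun w _ => half_size w).
  apply: (@Ex_sum (fun w _ => size w)
    (fun w _ i => all (fun j => nth false w (j * 2)) (iota 0 i.+1))); first by ex.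
  apply: (@Ex_all (fun w v => (head 0 v).+1) (fun w _ j => nth false w (j * 2))) => //.
  by ex.
apply: Ex_and.
  apply: Ex_and; first by ex.
  apply: Ex_and; last by ex.
  exact: (@Ex_all (fun w _ => half_size w) (fun w _ j => nth false w (j * 2))).
apply: Ex_checks => //.
- by rewrite /second_size; ex.
- by move=> F hF; rewrite /first_bit; ex.
- by move=> F hF; rewrite /second_bit; ex.
Qed.

Theorem consistency_in_NP : in_NP (consistency_problem dominoes).
Proof.
exists certifies, ('X * 'X + 'X * 'X)%R; split.
  exists accepts; split; last exact: acceptsP.
  exact: decision_polytime Ex_accepts.
move=> x; rewrite consistency_certificate hornerD hornerM hornerX.
have -> // : (size x * size x + size x * size x)%R = size x * size x * 2.
by rewrite muln2 -addnn.
Qed.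

Theorem theorem2 : NP_complete (consistency_problem dominoes).
Proof. by split; [exact: consistency_in_NP | exact: consistency_NP_hard]. Qed.
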